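(* Assume hypothesis $(\tilde{\mathcal H})$ holds, $\sigma^2>0$, and the initial law $\mu_0$ defines a continuous linear form $f\mapsto\int f\,d\mu_0$ both on $\mathcal B$ and on $\tilde{\mathcal B}$. Then $$\sup_{x\in\mathbb R}\Big|\mathbb P\Big(\frac{S_n}{\sigma\sqrt n}\le x\Big)-\mathcal N(0,1)(]-\infty,x])\Big| = O(n^{-1/2}).$$
   Context: Let $(E,\mathcal E)$ be a measurable space, $Q$ a transition probability on $E$ admitting an invariant probability $\nu$, $(X_n)_{n\ge0}$ a Markov chain with transition $Q$ and initial law $\mu_0$, and $\xi:E\to\mathbb R$ a measurable $\nu$-integrable function with $\nu(\xi)=0$; put $S_n=\sum_{k=1}^n\xi(X_k)$. $\mathbf 1$ is the constant function $1$. For $t\in\mathbb R$, $Q(t)f(x)=\int e^{it\xi(y)}f(y)\,Q(x,dy)$. For a Banach space $(\mathcal B,\|\cdot\|)$ of measurable complex functions on $E$, $Q$ is called $\mathcal B$-geometrically ergodic if $\mathbf 1\in\mathcal B$, $\mathcal B$ embeds continuously in $L^1(\nu)$, $Q$ is bounded on $\mathcal B$, and there are $\kappa_0<1$, $C\ge0$ with $\|Q^nf-\nu(f)\mathbf 1\|\le C\kappa_0^n\|f\|$ for all $n\ge1$, $f\in\mathcal B$. If so and $\xi\in\mathcal B$, set $\check\xi=\sum_{n\ge0}Q^n\xi$, and if $\mathcal B\subset L^2(\nu)$, $\sigma^2=\nu(\check\xi^2)-\nu((Q\check\xi)^2)$, $\psi=Q(\check\xi^2)-(Q\check\xi)^2-\sigma^2\mathbf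 1$. Hypothesis $(\mathcal H)$: there is a Banach space $(\mathcal B,\|\cdot\|)$ with $\mathcal B\subset L^3(\nu)$, $\xi\in\mathcal B$, such that (H1) $Q$ is $\mathcal B$-geometrically ergodic; (H2) $\sum_{p\ge0}\nu(|Q^p\psi|^{3/2})^{2/3}<\infty$; (H3) $\sup\{\nu(|e^{it\xi}-1||f|): \|f\|\le1\}=O(|t|)$ as $t\to0$; (H4) there is an open interval $I\ni0$ such that for $t\in I$, $Q(t)$ is bounded on $\mathcal B$, there are $\kappa<1$, $C\ge0$ with $\|Q(t)^nf\|\le C\kappa^n\|f\|+C\nu(|f|)$ for all $n\ge1,t\in I,f\in\mathcal B$, and the essential spectral radius of $Q(t)$ on $\mathcal B$ is $\le\kappa$. Hypothesis $(\tilde{\mathcal H})$: $(\mathcal H)$ holds on $\mathcal B$, and $\mathcal B$ is contained in a Banach space $(\tilde{\mathcal B},\|\cdot\|_\sim)$ such that $Q$ is $\tilde{\mathcal B}$-geometrically ergodic and $\sup\{\|Q(t)f-Qf\|_\sim: f\in\mathcal B,\|f\|\le1\}=O(|t|)$ as $t\to0$. *)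

(* Defs.v *)
From HB Require Import structures.
From mathcomp Require Import all_boot all_order all_algebra.
From mathcomp Require Import all_classical all_reals all_analysis.
From mathcomp Require Import complex.
Set Implicit Arguments.
Unset Strict Implicit.
Unset Printing Implicit Defensive.
Import Order.TTheory GRing.Theory Num.Theory.
Import numFieldTopology.Exports numFieldNormedType.Exports.
Local Open Scope classical_set_scope.
Local Open Scope ring_scope.

Section MarkovDefs.
Context {R : realType} {d : measure_display} {E : measurableType d}.
Local Notation C := R[i].
Local Notation kern := (E -> {measure set E -> \bar R}).

Definition cabs (c : C) : R := ComplexField.Normc.normc c.

Definition expi (th : R) : C := Complex (cos th) (sin th).

Definition cmeas (f : E -> C) : Prop :=
  measurable_fun setT (fun y => complex.Re (f y)) /\
  measurable_fun setT (fun y => complex.Im (f y)).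

Definition cintegrable (mu : {measure set E -> \bar R}) (f : E -> C) : Prop :=
  mu.-integrable setT (fun y => (complex.Re (f y))%:E) /\
  mu.-integrable setT (fun y => (complex.Im (f y))%:E).

Definition cint (mu : {measure set E -> \bar R}) (f : E -> C) : C :=
  Complex (Rintegral mu setT (fun y => complex.Re (f y)))
          (Rintegral mu setT (fun y => complex.Im (f y))).

Definition Qop (Q : kern) (f : E -> C) : E -> C := fun x => cint (Q x) f.
Definition Qr (Q : kern) (h : E -> R) : E -> R := fun x => Rintegral (Q x) setT h.

Definition Qt (Q : kern) (xi : E -> R) (t : R) (f : E -> C) : E -> C :=
  Qop Q (fun y => expi (t * xi y) * f y).

Definition cst1 : E -> C := fun _ => 1.

Definition banach_fun (S : set (E -> C)) (N : (E -> C) -> R) : Prop :=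
  (forall f, S f -> cmeas f) /\
  S (fun _ => 0) /\
  (forall f g, S f -> S g -> S (fun x => f x + g x)) /\
  (forall (c : C) f, S f -> S (fun x => c * f x)) /\
  (forall f, S f -> 0 <= N f) /\
  (forall f, S f -> N f = 0 -> f = (fun _ => 0)) /\
  (forall f g, S f -> S g -> N (fun x => f x + g x) <= N f + N g) /\
  (forall (c : C) f, S f -> N (fun x => c * f x) = cabs c * N f) /\
  (forall u : nat -> E -> C, (forall n, S (u n)) ->
     (forall e, 0 < e -> exists M, forall m n, (M <= m)%N -> (M <= n)%N ->
        N (fun x => u m x - u n x) < e) ->
     exists g, S g /\ N (fun x => u n x - g x) @[n --> \oo] --> (0 : R)).

Definition op_bounded (S : set (E -> C)) (N : (E -> C) -> R)
  (T : (E -> C) -> (E -> C)) : Prop :=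
  (forall f, S f -> S (T f)) /\ exists c, forall f, S f -> N (T f) <= c * N f.

Definition Q_defined_on (Q : kern) (S : set (E -> C)) : Prop :=
  forall f, S f -> forall x, cintegrable (Q x) f.

Definition embeds_L1 (nu : {measure set E -> \bar R}) (S : set (E -> C))
  (N : (E -> C) -> R) : Prop :=
  (forall f, S f -> nu.-integrable setT (fun x => (cabs (f x))%:E)) /\
  exists c, forall f, S f -> Rintegral nu setT (fun x => cabs (f x)) <= c * N f.

Definition in_L3 (nu : {measure set E -> \bar R}) (S : set (E -> C)) : Prop :=
  forall f, S f -> nu.-integrable setT (fun x => (cabs (f x) ^+ 3)%:E).

Definition geom_ergodic (Q : kern) (nu : {measure set E -> \bar R})
  (S : set (E -> C)) (N : (E -> C) -> R) : Prop :=
  S cst1 /\ embeds_L1 nu S N /\ Q_defined_on Q S /\ op_bounded S N (Qop Q) /\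
  exists kappa0 c, kappa0 < 1 /\ 0 <= c /\
    forall n f, (1 <= n)%N -> S f ->
      N (fun x => iter n (Qop Q) f x - cint nu f) <= c * kappa0 ^+ n * N f.

Definition compact_op (S : set (E -> C)) (N : (E -> C) -> R)
  (K : (E -> C) -> (E -> C)) : Prop :=
  (forall f g (a : C), S f -> S g ->
     K (fun x => a * f x + g x) = (fun x => a * K f x + K g x)) /\
  (forall f, S f -> S (K f)) /\
  (forall e, 0 < e -> exists (m : nat) (g : nat -> E -> C),
     (forall i, (i < m)%N -> S (g i)) /\
     forall f, S f -> N f <= 1 ->
       exists i, (i < m)%N /\ N (fun x => K f x - g i x) < e).

(** essential spectral radius of T on (S,N) is <= k, where the essential
    spectral radius is lim_n ||T^n||_ess^{1/n}, ||A||_ess = inf_{K compact} ||A - K||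
    (spectral radius of T in the Calkin algebra, Gelfand's formula). *)
Definition ess_spec_rad_le (S : set (E -> C)) (N : (E -> C) -> R)
  (T : (E -> C) -> (E -> C)) (k : R) : Prop :=
  forall k', k < k' -> exists M, forall n, (M <= n)%N ->
    exists K, compact_op S N K /\
      forall f, S f -> N (fun x => iter n T f x - K f x) <= k' ^+ n * N f.

Definition is_xicheck (Q : kern) (S : set (E -> C)) (N : (E -> C) -> R)
  (xi : E -> R) (g : E -> C) : Prop :=
  S g /\
  N (fun x => (\sum_(k < n) iter k (Qop Q) (fun y => (xi y)%:C%C) x) - g x)
    @[n --> \oo] --> (0 : R).

(** sigma^2 = nu(xicheck^2) - nu((Q xicheck)^2)  (xicheck real-valued) *)
Definition sigma2 (Q : kern) (nu : {measure set E -> \bar R}) (g : E -> C) : R :=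
  Rintegral nu setT (fun x => complex.Re (g x) ^+ 2)
  - Rintegral nu setT (fun x => Qr Q (fun y => complex.Re (g y)) x ^+ 2).

Definition psi (Q : kern) (nu : {measure set E -> \bar R}) (g : E -> C) : E -> R :=
  fun x => Qr Q (fun y => complex.Re (g y) ^+ 2) x - Qr Q (fun y => complex.Re (g y)) x ^+ 2
           - sigma2 Q nu g.

Definition hypH (Q : kern) (nu : {measure set E -> \bar R}) (xi : E -> R)
  (S : set (E -> C)) (N : (E -> C) -> R) : Prop :=
  banach_fun S N /\ in_L3 nu S /\ S (fun x => (xi x)%:C%C) /\
  geom_ergodic Q nu S N /\
  (forall g, is_xicheck Q S N xi g ->
     (\sum_(0 <= p <oo)
        poweR (\int[nu]_x (powR `|iter p (Qr Q) (psi Q nu g) x| (3 / 2))%:E)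
              (2 / 3) < +oo)%E) /\
  (exists c delta, 0 < delta /\ forall t, `|t| < delta ->
     forall f, S f -> N f <= 1 ->
       (\int[nu]_x (cabs (expi (t * xi x) - 1) * cabs (f x))%:E
          <= (c * `|t|)%:E)%E) /\
  (exists a b, a < 0 < b /\
     (forall t, a < t < b -> op_bounded S N (Qt Q xi t)) /\
     exists kappa c, kappa < 1 /\ 0 <= c /\
       (forall n t f, (1 <= n)%N -> a < t < b -> S f ->
          N (iter n (Qt Q xi t) f)
            <= c * kappa ^+ n * N f + c * Rintegral nu setT (fun x => cabs (f x))) /\
       (forall t, a < t < b -> ess_spec_rad_le S N (Qt Q xi t) kappa)).

Definition hypHtilde (Q : kern) (nu : {measure set E -> \bar R}) (xi : E -> R)
  (S : set (E -> C)) (N : (E -> C) -> R)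
  (S2 : set (E -> C)) (N2 : (E -> C) -> R) : Prop :=
  hypH Q nu xi S N /\ banach_fun S2 N2 /\ S `<=` S2 /\ geom_ergodic Q nu S2 N2 /\
  exists c delta, 0 < delta /\ forall t, `|t| < delta ->
    forall f, S f -> N f <= 1 ->
      N2 (fun x => Qt Q xi t f x - Qop Q f x) <= c * `|t|.

Definition cont_form (mu0 : {measure set E -> \bar R}) (S : set (E -> C))
  (N : (E -> C) -> R) : Prop :=
  (forall f, S f -> cintegrable mu0 f) /\
  exists c, forall f, S f -> cabs (cint mu0 f) <= c * N f.

Fixpoint fdd (Q : kern) (A : nat -> set E) (k n : nat) (x : E) : \bar R :=
  match n with
  | 0 => 1%E
  | n'.+1 => (\int[Q x]_(y in A k) fdd Q A k.+1 n' y)%E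
  end.

End MarkovDefs.

Definition markov_chain {R : realType} {d : measure_display} {E : measurableType d}
  {dO : measure_display} {Omega : measurableType dO} (P : probability Omega R)
  (X : nat -> Omega -> E) (Q : E -> {measure set E -> \bar R})
  (mu0 : {measure set E -> \bar R}) : Prop :=
  (forall n, measurable_fun setT (X n)) /\
  forall n (A : nat -> set E), (forall k, measurable (A k)) ->
    (P [set w | forall k, (k <= n)%N -> A k (X k w)]
      = \int[mu0]_(x in A 0%N) fdd Q A 1%N n x)%E.

(* Main.v *)
(** For small [t > 0] write [Q(t)^n 1 = a_n v_n] with [nu(v_n) = 1].  Since [Q] contracts
    the kernel of [nu] and [Q(t) - Q] is [O(t)] in the weak norms [nu|.|] and [|.|_~], the
    inequality in (H4) makes a power of [Q(t)] a contraction of that kernel for the strong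
    norm; hence [v_n] converges geometrically to an eigenvector [h] of [Q(t)], and
    [Q(t)^n 1 = la^n q_n h + O(t th^n)] with [q_n], [la], [h] within [O(t)] of [1], the
    error terms being measured in [|.|_~].

    The expansion [la = 1 - sigma^2 t^2 / 2 + O(t^3)] is not obtained by differentiation.
    Writing [xi = G - Q G] with [G = xicheck], [S_n] is a martingale up to a coboundary, and
    (H2) gives [|nu(Q(t)^n 1) - (1 - sigma^2 t^2 / 2)^n| <= C t] for all [n <= t^-2].
    Comparing [n]-th powers for [n] of order [t^-2] then yields the expansion of [la].

    As [E exp(i t S_n) = mu0 (Q(t)^n 1)], this bounds the distance of the characteristic
    function to [exp(- sigma^2 t^2 n / 2)], and Esseen's smoothing argument with the Fejer
    kernel concludes. *)

Require Import Defs.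
From HB Require Import structures.
From mathcomp Require Import all_boot all_order all_algebra.
From mathcomp Require Import all_classical all_reals all_analysis.
From mathcomp Require Import complex measurable_realfun ring lra.
Import Order.TTheory GRing.Theory Num.Theory.
Import numFieldTopology.Exports numFieldNormedType.Exports.
Local Open Scope classical_set_scope.
Local Open Scope ring_scope.

(** * Complex scalars and integrals *)

Section Cabs.
Context {R : realType}.
Implicit Types (w z : R[i]) (x y : R).

(** The perturbation [Q(t) - Q] is small only from the strong norm to the weaker norms, so classical
    analytic perturbation theory is out of reach and [la] is not known to be differentiable. Powers
    make up for this: an error [O(t)] on [la^n] with [n] of order [t^-2] is an error [O(t^3)] on
    [la]. That order is what the rate demands, since [n t^3] against a Gaussian factor in [n t^2]
    integrates, after division by [t], to [O(n^{-1/2})]. Because Esseen's bound divides by [t], all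
    other errors must carry a factor [t] as well. No spectral projector is built: only the orbit of
    [1] is followed, which is why the scalar [q_n] depends on [n]. The exponent 3/2 in (H2) is
    conjugate to 3. Replacing the twisted operator by [Q] in front of [Q^p psi] costs [t] times the
    product of a martingale increment, in [L^3], with [Q^p psi]. Summability over [p] keeps the
    total of order [t] during [t^-2] steps. *)

Lemma normcE (z : R[i]) : `|z| = (cabs z)%:C%C. Proof. by case: z. Qed.

Lemma cabs_ge0 z : 0 <= cabs z.
Proof. by case: z => a b; rewrite /cabs /= sqrtr_ge0. Qed.

Lemma cabsE z : cabs z = Num.sqrt (complex.Re z ^+ 2 + complex.Im z ^+ 2).
Proof. by case: z. Qed.

Lemma cabsD w z : cabs (w + z) <= cabs w + cabs z.
Proof. exact: le_normcD. Qed.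

Lemma cabsM w z : cabs (w * z) = cabs w * cabs z.
Proof. exact: ComplexField.Normc.normcM. Qed.

Lemma cabsN z : cabs (- z) = cabs z.
Proof. exact: normcN. Qed.

Lemma cabsBC w z : cabs (w - z) = cabs (z - w).
Proof. by rewrite -cabsN opprB. Qed.

Lemma cabs0 : cabs (0 : R[i]) = 0.
Proof. exact: ComplexField.Normc.normc0. Qed.

Lemma cabs1 : cabs (1 : R[i]) = 1.
Proof. exact: ComplexField.Normc.normc1. Qed.

Lemma cabs_eq0 z : cabs z = 0 -> z = 0.
Proof. exact: ComplexField.Normc.eq0_normc. Qed.

Lemma cabsV z : cabs z^-1 = (cabs z)^-1.
Proof. exact: ComplexField.Normc.normcV. Qed.

Lemma cabsX z n : cabs (z ^+ n) = cabs z ^+ n.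
Proof.
by elim: n => [|n IH]; [rewrite !expr0 cabs1|rewrite !exprS cabsM IH].
Qed.

Lemma cabs_gt0 z : (0 < cabs z) = (z != 0).
Proof.
rewrite lt_def cabs_ge0 andbT; apply/idP/idP; apply: contraNN => /eqP.
  by move=> ->; rewrite cabs0.
by move/cabs_eq0 => ->.
Qed.

Lemma cabs_real x : cabs (x%:C%C : R[i]) = `|x|.
Proof. by rewrite cabsE /= expr0n addr0 sqrtr_sqr. Qed.

Lemma cabs_triangle w z (u : R[i]) : cabs (w - u) <= cabs (w - z) + cabs (z - u).
Proof. by apply: le_trans (cabsD _ _); rewrite addrA subrK. Qed.

Lemma cabsB w z : cabs (w - z) <= cabs w + cabs z.
Proof. by apply: le_trans (cabsD _ _) _; rewrite cabsN. Qed.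

Lemma lerB_cabs w z : cabs w - cabs z <= cabs (w - z).
Proof. by rewrite lerBlDr; apply: le_trans (cabsD _ _); rewrite subrK. Qed.

Lemma Re_le_cabs z : `|complex.Re z| <= cabs z.
Proof. by rewrite cabsE -sqrtr_sqr ler_wsqrtr // lerDl sqr_ge0. Qed.

Lemma Im_le_cabs z : `|complex.Im z| <= cabs z.
Proof. by rewrite cabsE -sqrtr_sqr ler_wsqrtr // lerDr sqr_ge0. Qed.

Lemma cabs_le_ReIm z : cabs z <= `|complex.Re z| + `|complex.Im z|.
Proof.
rewrite cabsE -(ger0_norm (addr_ge0 (normr_ge0 _) (normr_ge0 _))) -sqrtr_sqr.
rewrite ler_wsqrtr // sqrrD !real_normK ?num_real //.
by rewrite -addrA lerD2l lerDr mulrn_wge0 // mulr_ge0.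
Qed.

Lemma cReD w z : complex.Re (w + z) = complex.Re w + complex.Re z.
Proof. by case: w z => [a b] [c d]. Qed.
Lemma cImD w z : complex.Im (w + z) = complex.Im w + complex.Im z.
Proof. by case: w z => [a b] [c d]. Qed.
Lemma cReM w z : complex.Re (w * z) =
  complex.Re w * complex.Re z - complex.Im w * complex.Im z.
Proof. by case: w z => [a b] [c d]. Qed.
Lemma cImM w z : complex.Im (w * z) =
  complex.Re w * complex.Im z + complex.Im w * complex.Re z.
Proof. by case: w z => [a b] [c d]. Qed.
Lemma cReN z : complex.Re (- z) = - complex.Re z. Proof. by case: z. Qed.
Lemma cImN z : complex.Im (- z) = - complex.Im z. Proof. by case: z. Qed.

Lemma complex_ext w z :
  complex.Re w = complex.Re z -> complex.Im w = complex.Im z -> w = z.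
Proof. by case: w z => [a b] [c d] /= -> ->. Qed.

Lemma cabs_Re_conj z : complex.Re (z^*%C / (cabs z)%:C%C * z) = cabs z.
Proof.
have [->|z0] := eqVneq z 0; first by rewrite mulr0 cabs0.
have cz : (cabs z)%:C%C != 0 :> R[i].
  by rewrite eq_complex /= eqxx andbT gt_eqF // cabs_gt0.
suff -> : z^*%C / (cabs z)%:C%C * z = (cabs z)%:C%C by [].
by rewrite mulrAC (mulrC _ z) -sqr_normc normcE expr2 mulfK.
Qed.

Lemma cabs_conj z : cabs z^*%C = cabs z.
Proof. by case: z => a b; rewrite /cabs /= sqrrN. Qed.

Lemma expiD x y : expi (x + y) = expi x * expi y :> R[i].
Proof.
by apply: complex_ext; rewrite /= ?cosD ?sinD // addrC mulrC [X in _ + X]mulrC addrC.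
Qed.

Lemma expi0 : expi 0 = 1 :> R[i].
Proof. by apply: complex_ext; rewrite /= ?cos0 ?sin0. Qed.

Lemma cabs_expi x : cabs (expi x) = 1.
Proof. by rewrite cabsE /= cos2Dsin2 sqrtr1. Qed.

Lemma expiNM x : expi (- x) * expi x = 1 :> R[i].
Proof. by rewrite -expiD addNr expi0. Qed.

(** Mean value theorem. Iterating it produces the Taylor bounds for sine and cosine below, each
    inequality being the derivative of the next. *)
Lemma ge0_of_derive (f df : R -> R) :
  (forall x, is_derive x 1 f (df x)) -> f 0 = 0 ->
  (forall x, 0 <= x -> 0 <= df x) -> forall x, 0 <= x -> 0 <= f x.
Proof.
move=> fdf f0 df0 x x0.
have [|y] := @MVT_segment _ f df 0 x x0 (fun y _ => fdf y).
  by apply: derivable_within_continuous => y _; have [] := fdf y.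
rewrite in_itv /= => /andP[y0 _]; rewrite f0 !subr0 => ->.
by rewrite mulr_ge0 // df0.
Qed.

Lemma sin_le_id x : 0 <= x -> 0 <= x - sin x.
Proof.
have D y : is_derive y (1 : R) (fun x : R => x - sin x) (1 - cos y).
  by apply: is_derive_eq.
apply: (ge0_of_derive _ _ D) => [|y _]; first by rewrite sin0 subr0.
by rewrite subr_ge0 cos_le1.
Qed.

Lemma cos_ge_quadratic x : 0 <= x -> 0 <= cos x - 1 + x ^+ 2 / 2.
Proof.
have D y : is_derive y (1 : R) (fun x : R => cos x - 1 + x ^+ 2 / 2) (y - sin y).
  by apply: is_derive_eq; rewrite /GRing.scale /=; field.
by apply: (ge0_of_derive _ _ D) => [|y]; [rewrite cos0; field|exact: sin_le_id].
Qed.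

Lemma sin_ge_cubic x : 0 <= x -> 0 <= sin x - x + x ^+ 3 / 6.
Proof.
have D y : is_derive y (1 : R) (fun x : R => sin x - x + x ^+ 3 / 6)
    (cos y - 1 + y ^+ 2 / 2).
  by apply: is_derive_eq; rewrite /GRing.scale /=; field.
by apply: (ge0_of_derive _ _ D) => [|y];
  [rewrite sin0; field|exact: cos_ge_quadratic].
Qed.

(** Three integrations of [sin <= 1]. A cubic remainder, rather than the sharper quartic one, is
    what third moments can control. *)
Lemma cos_le_cubic x : 0 <= x -> 0 <= x ^+ 3 / 6 - x ^+ 2 / 2 + 1 - cos x.
Proof.
have D1 y : is_derive y (1 : R) (fun x : R => x - 1 + cos x) (1 - sin y).
  by apply: is_derive_eq; rewrite /GRing.scale /=; field.
have D2 y : is_derive y (1 : R) (fun x : R => x ^+ 2 / 2 - x + sin x)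
    (y - 1 + cos y).
  by apply: is_derive_eq; rewrite /GRing.scale /=; field.
have D3 y : is_derive y (1 : R) (fun x : R => x ^+ 3 / 6 - x ^+ 2 / 2 + 1 - cos x)
    (y ^+ 2 / 2 - y + sin y).
  by apply: is_derive_eq; rewrite /GRing.scale /=; field.
apply: (ge0_of_derive _ _ D3); first by rewrite cos0; field.
apply: (ge0_of_derive _ _ D2); first by rewrite sin0; field.
apply: (ge0_of_derive _ _ D1) => [|y _]; first by rewrite cos0; field.
by rewrite subr_ge0 sin_le1.
Qed.

Lemma cos_quadratic_bound x : 1 - cos x <= x ^+ 2 / 2.
Proof.
have := cos_ge_quadratic `|x| (normr_ge0 x).
by rewrite cos_norm real_normK ?num_real //; lra.
Qed.

Lemma cos_taylor2 x : `|cos x - 1 + x ^+ 2 / 2| <= `|x| ^+ 3 / 6.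
Proof.
have := cos_ge_quadratic `|x| (normr_ge0 x).
have := cos_le_cubic `|x| (normr_ge0 x).
rewrite cos_norm real_normK ?num_real // => h1 h2.
by rewrite ger0_norm //; lra.
Qed.

Lemma sin_taylor2 x : `|sin x - x| <= `|x| ^+ 3 / 6.
Proof.
wlog x0 : x / 0 <= x => [H|].
  have [|/ltW x0] := leP 0 x; first exact: H.
  have := H (- x); rewrite oppr_ge0 sinN normrN => /(_ x0).
  by rewrite -opprD normrN.
have := sin_ge_cubic x x0; have := sin_le_id x x0; rewrite (ger0_norm x0) => h1 h2.
by rewrite ler_norml; lra.
Qed.

Lemma cabs_expiB1 x : cabs (expi x - 1) <= `|x|.
Proof.
rewrite cabsE /= subr0 -[leRHS]sqrtr_sqr ler_wsqrtr //.
have := cos_quadratic_bound x; have := cos2Dsin2 x; lra.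
Qed.

Lemma expi_taylor2 x :
  cabs (expi x - 1 - Complex 0 x + (x ^+ 2 / 2)%:C%C) <= `|x| ^+ 3.
Proof.
apply: le_trans (cabs_le_ReIm _) _ => /=.
have := cos_taylor2 x; have := sin_taylor2 x.
rewrite !subr0 !addr0 => h1 h2; apply: le_trans (lerD h2 h1) _.
have : 0 <= `|x| ^+ 3 by rewrite exprn_ge0.
by lra.
Qed.

End Cabs.

(** * Integrals of complex functions and the extended [L^1] norm *)

Section ComplexIntegral.
Context {R : realType} {d : measure_display} {E : measurableType d}.
Implicit Types (F G : E -> R[i]) (mu : {measure set E -> \bar R}).

(** Kept in the extended reals so that the triangle and contraction inequalities hold for all
    measurable functions; integrability is then finiteness of this value. *)
Definition eL1 mu F : \bar R := (\int[mu]_x (cabs (F x))%:E)%E.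

Lemma cmeas_cst (c : R[i]) : cmeas (fun _ : E => c).
Proof. by split; exact: measurable_cst. Qed.

Lemma cmeasD F G : cmeas F -> cmeas G -> cmeas (fun x => F x + G x).
Proof.
move=> [F1 F2] [G1 G2]; split => /=.
  by under eq_fun do rewrite cReD; exact: measurable_funD.
by under eq_fun do rewrite cImD; exact: measurable_funD.
Qed.

Lemma cmeasM F G : cmeas F -> cmeas G -> cmeas (fun x => F x * G x).
Proof.
move=> [F1 F2] [G1 G2]; split => /=.
  by under eq_fun do rewrite cReM; apply: measurable_funB; exact: measurable_funM.
by under eq_fun do rewrite cImM; apply: measurable_funD; exact: measurable_funM.
Qed.

Lemma cmeasB F G : cmeas F -> cmeas G -> cmeas (fun x => F x - G x).
Proof.
move=> [F1 F2] [G1 G2]; split => /=.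
  by under eq_fun do rewrite cReD cReN; exact: measurable_funB.
by under eq_fun do rewrite cImD cImN; exact: measurable_funB.
Qed.

Lemma cmeas_real (h : E -> R) :
  measurable_fun setT h -> cmeas (fun x => (h x)%:C%C).
Proof. by move=> mh; split => //=; exact: measurable_cst. Qed.

Lemma cmeas_expi (h : E -> R) :
  measurable_fun setT h -> cmeas (fun x => expi (h x)).
Proof.
by move=> mh; split => /=; apply: measurableT_comp => //;
  apply: continuous_measurable_fun; [exact: continuous_cos|exact: continuous_sin].
Qed.

Lemma measurable_cabs F : cmeas F -> measurable_fun setT (fun x => cabs (F x)).
Proof.
move=> [F1 F2]; under eq_fun do rewrite cabsE.
apply: measurableT_comp.
  by apply: continuous_measurable_fun; exact: sqrt_continuous.
by apply: measurable_funD; exact: measurable_funX.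
Qed.

Lemma measurable_ecabs F :
  cmeas F -> measurable_fun setT (fun x => (cabs (F x))%:E).
Proof. by move=> mF; apply/measurable_EFinP; exact: measurable_cabs. Qed.

Lemma cintegrableP mu F : cmeas F ->
  cintegrable mu F <-> (eL1 mu F < +oo)%E.
Proof.
move=> mF; split.
  move=> [iR iI].
  apply: (@le_lt_trans _ _ (\int[mu]_x (`|complex.Re (F x)|%:E + `|complex.Im (F x)|%:E))%E).
    apply: ge0_le_integral => //.
    - by move=> x _; rewrite lee_fin cabs_ge0.
    - exact: measurable_ecabs.
    - by apply: emeasurable_funD; apply/measurable_EFinP; apply: measurableT_comp => //;
        [exact: mF.1|exact: mF.2].
    - by move=> x _; rewrite lee_fin cabs_le_ReIm.
  rewrite ge0_integralD //.
  - have /integrableP[_ h1] := iR; have /integrableP[_ h2] := iI.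
    by rewrite lte_add_pinfty.
  - by apply/measurable_EFinP; apply: measurableT_comp => //; exact: mF.1.
  - by apply/measurable_EFinP; apply: measurableT_comp => //; exact: mF.2.
move=> h.
have hi : mu.-integrable setT (fun x => (cabs (F x))%:E).
  apply/integrableP; split; first exact: measurable_ecabs.
  by under eq_integral do rewrite /= ger0_norm ?cabs_ge0 //.
split; apply: (le_integrable _ _ _ hi) => //.
- by apply/measurable_EFinP; exact: mF.1.
- by move=> x _ /=; rewrite lee_fin (ger0_norm (cabs_ge0 _)) Re_le_cabs.
- by apply/measurable_EFinP; exact: mF.2.
- by move=> x _ /=; rewrite lee_fin (ger0_norm (cabs_ge0 _)) Im_le_cabs.
Qed.

Lemma cabs_integrable mu F : cmeas F -> (eL1 mu F < +oo)%E ->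
  mu.-integrable setT (fun x => (cabs (F x))%:E).
Proof.
move=> mF h; apply/integrableP; split; first exact: measurable_ecabs.
by under eq_integral do rewrite /= ger0_norm ?cabs_ge0 //.
Qed.

Lemma cintegrableZ mu (c : R[i]) F : cmeas F -> cintegrable mu F ->
  cintegrable mu (fun x => c * F x).
Proof.
move=> mF /(cintegrableP _ _ mF) h; apply/cintegrableP.
  by apply: cmeasM => //; exact: cmeas_cst.
rewrite /eL1; under eq_integral do rewrite cabsM EFinM.
rewrite ge0_integralZl //.
- by rewrite lte_mul_pinfty // ?lee_fin ?cabs_ge0.
- exact: measurable_ecabs.
- by move=> x _; rewrite lee_fin cabs_ge0.
- by rewrite lee_fin cabs_ge0.
Qed.

Lemma cintegrableD mu F G : cintegrable mu F -> cintegrable mu G ->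
  cintegrable mu (fun x => F x + G x).
Proof.
move=> [F1 F2] [G1 G2]; split => /=.
  by under eq_fun do rewrite cReD EFinD; exact: integrableD.
by under eq_fun do rewrite cImD EFinD; exact: integrableD.
Qed.

Lemma cintD mu F G : cintegrable mu F -> cintegrable mu G ->
  cint mu (fun x => F x + G x) = cint mu F + cint mu G.
Proof.
move=> [F1 F2] [G1 G2]; apply: complex_ext; rewrite ?cReD ?cImD /= -RintegralD //.
  by apply: eq_Rintegral => x _; rewrite cReD.
by apply: eq_Rintegral => x _; rewrite cImD.
Qed.

Lemma integrable_EFinZl mu (k : R) (h : E -> R) :
  mu.-integrable setT (fun x => (h x)%:E) ->
  mu.-integrable setT (fun x => (k * h x)%:E).
Proof.
move=> ih; under eq_fun do rewrite EFinM.
exact: (@integrableZl _ _ _ _ _ measurableT k _ ih).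
Qed.

Lemma cintZ mu (c : R[i]) F : cintegrable mu F ->
  cint mu (fun x => c * F x) = c * cint mu F.
Proof.
move=> [F1 F2]; apply: complex_ext.
  rewrite cReM /= -!RintegralZl // -RintegralB //; try exact: integrable_EFinZl.
  by apply: eq_Rintegral => x _; rewrite cReM.
rewrite cImM /= -!RintegralZl // -RintegralD //; try exact: integrable_EFinZl.
by apply: eq_Rintegral => x _; rewrite cImM.
Qed.

Lemma cintegrableB mu F G : cintegrable mu F -> cintegrable mu G ->
  cintegrable mu (fun x => F x - G x).
Proof.
move=> [F1 F2] [G1 G2]; split => /=.
  by under eq_fun do rewrite cReD cReN EFinB; exact: integrableB.
by under eq_fun do rewrite cImD cImN EFinB; exact: integrableB.
Qed.

Lemma cintB mu F G : cintegrable mu F -> cintegrable mu G ->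
  cint mu (fun x => F x - G x) = cint mu F - cint mu G.
Proof.
move=> [F1 F2] [G1 G2]; apply: complex_ext; rewrite ?cReD ?cReN ?cImD ?cImN /= -RintegralB //.
  by apply: eq_Rintegral => x _; rewrite cReD cReN.
by apply: eq_Rintegral => x _; rewrite cImD cImN.
Qed.

Lemma cint_cst mu (c : R[i]) : mu setT = 1%E -> cint mu (fun _ => c) = c.
Proof.
by move=> mu1; apply: complex_ext; rewrite /= Rintegral_cst // mu1 mulr1.
Qed.

Lemma cint_real mu (h : E -> R) :
  cint mu (fun x => (h x)%:C%C) = (Rintegral mu setT h)%:C%C.
Proof. by apply: complex_ext => //=; rewrite Rintegral_cst // mul0r. Qed.

(* Multiplying [F] by the unit complex number that makes its integral real and
   nonnegative reduces the bound to the real one. *)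
Lemma le_cabs_cint mu F : cmeas F -> ((cabs (cint mu F))%:E <= eL1 mu F)%E.
Proof.
move=> mF; have [hoo|] := ltP (eL1 mu F) +oo%E; last first.
  by rewrite leye_eq => /eqP ->; rewrite leey.
have iF : cintegrable mu F by apply/cintegrableP.
rewrite -cabs_Re_conj; set c := _ / _.
have c1 : cabs c <= 1.
  rewrite /c cabsM cabsV cabs_conj cabs_real ger0_norm ?cabs_ge0 //.
  have [->|z0] := eqVneq (cint mu F) 0; first by rewrite cabs0 mul0r ler01.
  by rewrite divff // gt_eqF // cabs_gt0.
rewrite -cintZ //.
have [iR iI] := cintegrableZ mu c F mF iF.
rewrite /= /Rintegral fineK; last exact: integrable_fin_num.
apply: le_integral => //.
  exact: cabs_integrable.
move=> x _; rewrite lee_fin; apply: le_trans (ler_norm _) _.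
by apply: le_trans (Re_le_cabs _) _; rewrite cabsM ler_piMl // cabs_ge0.
Qed.

Lemma eL1_ge0 mu F : (0 <= eL1 mu F)%E.
Proof. by apply: integral_ge0 => x _; rewrite lee_fin cabs_ge0. Qed.

Lemma eL1D mu F G : cmeas F -> cmeas G ->
  (eL1 mu (fun x => F x + G x)%R <= eL1 mu F + eL1 mu G)%E.
Proof.
move=> mF mG; rewrite -ge0_integralD //; last 4 first.
- by move=> x _; rewrite lee_fin cabs_ge0.
- exact: measurable_ecabs.
- by move=> x _; rewrite lee_fin cabs_ge0.
- exact: measurable_ecabs.
apply: ge0_le_integral => //.
- by move=> x _; rewrite lee_fin cabs_ge0.
- by apply: measurable_ecabs; exact: cmeasD.
- by apply: emeasurable_funD; exact: measurable_ecabs.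
- by move=> x _; rewrite -EFinD lee_fin cabsD.
Qed.

Lemma eL1Z mu (c : R[i]) F : cmeas F ->
  eL1 mu (fun x => c * F x)%R = ((cabs c)%:E * eL1 mu F)%E.
Proof.
move=> mF; rewrite /eL1; under eq_integral do rewrite cabsM EFinM.
rewrite ge0_integralZl //.
- exact: measurable_ecabs.
- by move=> x _; rewrite lee_fin cabs_ge0.
- by rewrite lee_fin cabs_ge0.
Qed.

End ComplexIntegral.

(** * The transition kernel as an operator, and invariance of [nu] *)

Section KernelOperator.
Context {R : realType} {d : measure_display} {E : measurableType d}.
Context (Q : R.-pker E ~> E) (nu : probability E R).
Implicit Types (F G : E -> R[i]).

Lemma measurable_kernel_integral (k : E -> \bar R) : (forall y, 0 <= k y)%E ->
  measurable_fun setT k -> measurable_fun setT (fun x => \int[Q x]_y k y)%E.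
Proof.
move=> k0 mk; apply: measurable_fun_integral_kernel => // U mU.
exact: measurable_kernel.
Qed.

Lemma measurable_kernel_Rintegral (h : E -> R) : measurable_fun setT h ->
  measurable_fun setT (fun x => Rintegral (Q x) setT h).
Proof.
move=> mh; apply: measurableT_comp => //.
under eq_fun do rewrite integralE.
by apply: emeasurable_funB; apply: measurable_kernel_integral => //;
  [apply: measurable_funepos|apply: measurable_funeneg]; exact/measurable_EFinP.
Qed.

Lemma cmeas_Qop F : cmeas F -> cmeas (Qop Q F).
Proof. by move=> [F1 F2]; split; exact: measurable_kernel_Rintegral. Qed.

Lemma Qop1 (c : R[i]) : Qop Q (fun _ => c) = (fun _ => c).
Proof. by apply/funext => x; rewrite /Qop cint_cst //; exact: prob_kernel. Qed.

(** Composition [kcomp] expects its second kernel on the product of the first two spaces; this is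
    [Q] seen as such a kernel. *)
Definition snd_kernel : E * E -> {measure set E -> \bar R} := fun z => Q z.2.

Lemma measurable_snd_kernel U :
  measurable U -> measurable_fun setT (snd_kernel ^~ U).
Proof.
move=> mU; apply: (measurableT_comp (measurable_kernel Q U mU)).
exact: measurable_snd.
Qed.

HB.instance Definition _ :=
  @isKernel.Build _ _ _ _ _ snd_kernel measurable_snd_kernel.

Lemma snd_kernel_prob z : snd_kernel z setT = 1%E.
Proof. exact: prob_kernel. Qed.

HB.instance Definition _ :=
  @Kernel_isProbability.Build _ _ _ _ _ snd_kernel snd_kernel_prob.

Hypothesis nu_inv : forall A, measurable A -> nu A = (\int[nu]_x Q x A)%E.

(** [nu] and the composition of the constant kernel [nu] with [Q] agree on measurable sets, hence
    integrate alike. The composition is evaluated at a base point, so an empty [E] is excluded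
    first, [nu] having mass 1. *)
Lemma integral_invariant (f : E -> \bar R) : (forall y, 0 <= f y)%E ->
  measurable_fun setT f ->
  (\int[nu]_x f x = \int[nu]_x \int[Q x]_y f y)%E.
Proof.
move=> f0 mf; have [x0|E0] := pselect (inhabited E); last first.
  have nu0 : (nu setT = 0)%E.
    rewrite (_ : setT = set0) ?measure0 //.
    by apply/seteqP; split => // x _; apply: E0; exists.
  by have := @probability_setT _ _ _ nu; rewrite nu0 => /eqP; rewrite eqe eq_sym oner_eq0.
case: x0 => x0.
pose l := kprobability (measurable_cst (nu : pprobability E R) : measurable_fun [set: E] _).
transitivity (\int[kcomp l snd_kernel x0]_z f z)%E; last exact: integral_kcomp.
by apply: eq_measure_integral => A mA _; exact: nu_inv.
Qed.

Lemma eL1_Qop F : cmeas F -> (eL1 nu (Qop Q F) <= eL1 nu F)%E.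
Proof.
move=> mF; rewrite [leRHS]integral_invariant //; last 2 first.
- by move=> y; rewrite lee_fin cabs_ge0.
- exact: measurable_ecabs.
apply: ge0_le_integral => //.
- by move=> x _; rewrite lee_fin cabs_ge0.
- by apply: measurable_ecabs; exact: cmeas_Qop.
- apply: measurable_kernel_integral; last exact: measurable_ecabs.
  by move=> y; rewrite lee_fin cabs_ge0.
- by move=> x _; exact: le_cabs_cint.
Qed.

Lemma integrable_Qnonneg (f : E -> \bar R) : (forall y, 0 <= f y)%E ->
  measurable_fun setT f -> (\int[nu]_x f x < +oo)%E ->
  nu.-integrable setT (fun x => \int[Q x]_y f y)%E.
Proof.
move=> f0 mf foo; apply/integrableP; split; first exact: measurable_kernel_integral.
rewrite integral_invariant // in foo.
by under eq_integral do rewrite gee0_abs ?integral_ge0 //.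
Qed.

Lemma ae_lty_Q (f : E -> \bar R) : (forall y, 0 <= f y)%E ->
  measurable_fun setT f -> (\int[nu]_x f x < +oo)%E ->
  {ae nu, forall x, (\int[Q x]_y f y < +oo)%E}.
Proof.
move=> f0 mf foo.
have := integrable_ae measurableT (integrable_Qnonneg _ f0 mf foo).
apply: filterS => x /(_ I); rewrite ge0_fin_numE //.
exact: integral_ge0.
Qed.

Lemma ae_cintegrable F : cmeas F -> (eL1 nu F < +oo)%E ->
  {ae nu, forall x, cintegrable (Q x) F}.
Proof.
move=> mF oF.
have := ae_lty_Q _ _ (measurable_ecabs F mF) oF.
have F0 y : (0 <= (cabs (F y))%:E)%E by rewrite lee_fin cabs_ge0.
move=> /(_ F0); apply: filterS => x xoo.
exact/cintegrableP.
Qed.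

Lemma Rintegral_invariant (h : E -> R) : nu.-integrable setT (EFin \o h) ->
  Rintegral nu setT (fun x => Rintegral (Q x) setT h) = Rintegral nu setT h.
Proof.
move=> ih; set H := EFin \o h.
have mH : measurable_fun setT H by exact: measurable_int ih.
have mp : measurable_fun setT (H^\+)%E by exact: measurable_funepos.
have mn : measurable_fun setT (H^\-)%E by exact: measurable_funeneg.
have p0 y : (0 <= H^\+ y)%E by exact: funepos_ge0.
have n0 y : (0 <= H^\- y)%E by exact: funeneg_ge0.
have poo : (\int[nu]_x H^\+ x < +oo)%E by exact: integral_funepos_lt_pinfty.
have noo : (\int[nu]_x H^\- x < +oo)%E by exact: integral_funeneg_lt_pinfty.
congr fine; rewrite [RHS]integralE.
rewrite [X in (X - _)%E]integral_invariant // [X in (_ - X)%E]integral_invariant //.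
rewrite -integralB //; try exact: integrable_Qnonneg.
(* The two integrands agree only where [Q x] integrates both parts of [h] finitely; elsewhere [fine]
   returns a default value. Those points form a [nu]-null set. *)
apply: ae_eq_integral => //.
- by apply/measurable_EFinP; apply: measurable_kernel_Rintegral; exact/measurable_EFinP.
- by apply: emeasurable_funB; exact: measurable_kernel_integral.
have := ae_lty_Q _ p0 mp poo; have := ae_lty_Q _ n0 mn noo.
apply: filterS2 => x nx px _; rewrite /Rintegral integralE fineK //.
rewrite fin_numB ge0_fin_numE ?px ?ge0_fin_numE ?nx //; exact: integral_ge0.
Qed.

Lemma cint_Qop F : cintegrable nu F -> cint nu (Qop Q F) = cint nu F.
Proof.
by move=> [F1 F2]; apply: complex_ext; rewrite /= Rintegral_invariant.
Qed.

End KernelOperator.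

(** * Perturbation of a geometrically ergodic operator *)

Section Geometric.
Context {R : realType}.

Lemma expr_eventually_lt (th c e : R) : 0 <= th < 1 -> 0 < e ->
  exists M, forall n, (M <= n)%N -> c * th ^+ n < e.
Proof.
move=> /andP[th0 th1] e0.
have := @cvg_expr R th; rewrite ger0_norm // => /(_ th1) h.
have h2 : (fun n => c * th ^+ n) @ \oo --> (0 : R).
  by rewrite -(mulr0 c); apply: cvgMr.
have /cvgrPdist_lt /(_ e e0) [M _ HM] := h2.
exists M => n Mn; have := HM n Mn.
by rewrite /= sub0r normrN; apply: le_lt_trans; exact: ler_norm.
Qed.

Lemma bernoulli_le (x : R) n : 0 <= x <= 1 -> 1 - n%:R * x <= (1 - x) ^+ n.
Proof.
move=> /andP[x0 x1]; elim: n => [|n IH]; first by rewrite expr0 mul0r subr0.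
rewrite exprS; apply: (@le_trans _ _ ((1 - x) * (1 - n%:R * x))).
  rewrite -natr1; have : 0 <= n%:R * x * x by rewrite !mulr_ge0.
  by lra.
by rewrite ler_wpM2l // subr_ge0.
Qed.

(** The rate [th] is chosen so that [th ^+ M >= 3 / 4] by Bernoulli. Then the step
    [4 D / 2 + D = 3 D <= 4 D * th ^+ M] closes the induction, and the same bound covers the initial
    times. *)
Lemma geom_halving (M : nat) (y : nat -> R) (D : R) : (0 < M)%N -> 0 <= D ->
  let th := 1 - (4 * M%:R)^-1 in
  (forall j, (j < M)%N -> y j <= D) ->
  (forall n, y (n + M)%N <= y n / 2 + D * th ^+ n) ->
  forall n, y n <= 4 * D * th ^+ n.
Proof.
move=> M0 D0 th yj yM.
have M1 : 1 <= M%:R :> R by rewrite ler1n.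
have i0 : 0 <= (4 * M%:R : R)^-1 <= 1.
  by rewrite invr_ge0 mulr_ge0 //= invf_le1; lra.
have th01 : 0 <= th <= 1 by rewrite /th; lra.
have thM : 3 / 4 <= th ^+ M.
  apply: le_trans (bernoulli_le _ _ i0).
  rewrite invfM mulrCA divff ?mulr1; first lra.
  by rewrite pnatr_eq0 -lt0n.
elim/ltn_ind => n IH; have [nM|Mn] := ltnP n M.
  apply: le_trans (yj n nM) _.
  have : th ^+ M <= th ^+ n by apply: ler_wiXn2l => //; [lra|lra|exact: ltnW].
  move=> h; have : 0 <= D * (th ^+ n - 3 / 4) by rewrite mulr_ge0 //; lra.
  by lra.
rewrite -(subnK Mn); set m := (n - M)%N.
apply: le_trans (yM m) _; have := IH m; rewrite ltn_subrL M0 (leq_trans M0 Mn) /= => /(_ isT) h.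
rewrite exprD; have t0 : 0 <= D * th ^+ m by rewrite mulr_ge0 // exprn_ge0 //; lra.
have : 0 <= D * th ^+ m * (th ^+ M - 3 / 4) by rewrite mulr_ge0 //; lra.
by lra.
Qed.

Lemma ler_small (x y : R) : (forall e, 0 < e -> x <= y + e) -> x <= y.
Proof. by move=> h; apply/ler_addgt0Pr. Qed.

Lemma ler_small_mul (x c : R) : 0 <= c ->
  (forall e, 0 < e -> x <= c * e) -> x <= 0.
Proof.
move=> c0 h; apply: ler_small => e e0; rewrite add0r.
have c1 : 0 < c + 1 by lra.
have := h (e / (c + 1)) (divr_gt0 e0 c1); move=> /le_trans; apply.
rewrite mulrCA ler_piMr ?(ltW e0) // ler_pdivrMr // mul1r; lra.
Qed.

End Geometric.

(** * Abstract perturbation theorem for one strong norm and two weaker seminorms *)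

Section Perturbation.
Context {R : realType} {T : Type}.
Local Notation C := R[i].
Local Notation fn := (T -> C).
Variables (S : fn -> Prop) (N w N2 : fn -> R) (nu : fn -> C) (A : fn -> fn).
Variables (K ka : R).
Local Notation one := (fun _ : T => 1 : C).

Definition lin_on (B : fn -> fn) := (forall f, S f -> S (B f)) /\
  forall (a : C) f g, S f -> S g -> B ((a \*o f) \+ g) = (a \*o B f) \+ B g.

Definition seminorm_on (p : fn -> R) := (forall f, S f -> 0 <= p f) /\
  (forall f g, S f -> S g -> p (f \+ g) <= p f + p g) /\
  (forall (a : C) f, S f -> p (a \*o f) = cabs a * p f).

Hypothesis SD : forall f g, S f -> S g -> S (f \+ g).
Hypothesis SZ : forall (a : C) f, S f -> S (a \*o f).
Hypothesis S1 : S one.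
Hypothesis Nn : seminorm_on N.
Hypothesis wn : seminorm_on w.
Hypothesis N2n : seminorm_on N2.
Hypothesis N_eq0 : forall f, S f -> N f = 0 -> f = (fun _ => 0).
Hypothesis Ncompl : forall u : nat -> fn, (forall n, S (u n)) ->
  (forall e, 0 < e -> exists M, forall m n, (M <= m)%N -> (M <= n)%N ->
     N (u m \- u n) < e) ->
  exists g, S g /\ forall e, 0 < e -> exists M, forall n, (M <= n)%N ->
     N (u n \- g) < e.
Hypothesis nuL : forall (a : C) f g, S f -> S g ->
  nu ((a \*o f) \+ g) = a * nu f + nu g.
Hypothesis nu1 : nu one = 1.
Hypothesis nuw : forall f, S f -> cabs (nu f) <= w f.
Hypothesis wN : forall f, S f -> w f <= K * N f.
Hypothesis K1 : 1 <= K.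
Hypothesis ka01 : 0 < ka < 1.
Hypothesis AL : lin_on A.
Hypothesis A1 : A one = one.
Hypothesis Anu : forall f, S f -> nu (A f) = nu f.
Hypothesis Aw : forall f, S f -> w (A f) <= K * w f.
Hypothesis AN2 : forall f, S f -> N2 (A f) <= K * N2 f.
Hypothesis AnN : forall n f, S f -> nu f = 0 -> N (iter n A f) <= K * ka ^+ n * N f.
Hypothesis AnN2 : forall n f, S f -> nu f = 0 ->
  N2 (iter n A f) <= K * ka ^+ n * N2 f.

(** Hypotheses of Keller-Liverani type: a Doeblin-Fortet inequality for all powers, and a distance
    to [A] measured from [N] into the weaker [w] and [N2]. In the application [B] is [Q(t)] and
    [tau] is [t]. *)
Definition perturbed (B : fn -> fn) (tau : R) :=
  lin_on B /\
  (forall n f, S f -> N (iter n B f) <= K * ka ^+ n * N f + K * w f) /\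
  (forall f, S f -> w (B f \- A f) <= K * tau * N f) /\
  (forall f, S f -> N2 (B f \- A f) <= K * tau * N f).

Let SB f g : S f -> S g -> S (f \- g).
Proof.
move=> Sf Sg; rewrite (_ : f \- g = f \+ ((-1) \*o g)).
  by apply: SD => //; exact: SZ.
by apply/funext => x /=; rewrite mulN1r.
Qed.

Let pB p f g : seminorm_on p -> S f -> S g -> p (f \- g) <= p f + p g.
Proof.
move=> [_ [pD pZ]] Sf Sg; rewrite (_ : f \- g = f \+ ((-1) \*o g)).
  apply: le_trans (pD _ _ _ _) _ => //; first exact: SZ.
  by rewrite pZ // cabsN cabs1 mul1r.
by apply/funext => x /=; rewrite mulN1r.
Qed.

Let pBC p f g : seminorm_on p -> S f -> S g -> p (f \- g) = p (g \- f).
Proof.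
move=> [_ [pD pZ]] Sf Sg; rewrite (_ : f \- g = (-1) \*o (g \- f)).
  by rewrite pZ ?cabsN ?cabs1 ?mul1r //; exact: SB.
by apply/funext => x /=; rewrite mulN1r opprB.
Qed.

Let linB B f g : lin_on B -> S f -> S g -> B (f \- g) = B f \- B g.
Proof.
move=> [BS BL] Sf Sg; rewrite (_ : f \- g = ((-1) \*o g) \+ f).
  by rewrite BL //; apply/funext => x /=; rewrite mulN1r addrC.
by apply/funext => x /=; rewrite mulN1r addrC.
Qed.

(** Linearity is available only in the form [a f + g]; the zero function is supplied as [f \- f]. *)
Let linZ B (a : C) f : lin_on B -> S f -> B (a \*o f) = a \*o B f.
Proof.
move=> BL Sf; have h0 : B (f \- f) = B f \- B f by exact: linB.
rewrite (_ : a \*o f = (a \*o f) \+ (f \- f)).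
  rewrite BL.2 //; last exact: SB.
  by rewrite h0; apply/funext => x /=; rewrite subrr addr0.
by apply/funext => x /=; rewrite subrr addr0.
Qed.

Let linD B f g : lin_on B -> S f -> S g -> B (f \+ g) = B f \+ B g.
Proof.
move=> [BS BL] Sf Sg; rewrite (_ : f \+ g = (1 \*o f) \+ g).
  by rewrite BL //; apply/funext => x /=; rewrite mul1r.
by apply/funext => x /=; rewrite mul1r.
Qed.

Let lin_iter B n : lin_on B -> lin_on (iter n B).
Proof.
move=> [BS BL]; split; first by elim: n => // n IH f Sf; exact/BS/IH.
have BSn f : S f -> S (iter n B f) by elim: n f => // n IH f Sf; exact/BS/IH.
elim: n BSn => // n IH BSn a f g Sf Sg /=.
have BSn' h : S h -> S (iter n B h).
  by clear -BS => Sh; elim: n => // n IH; exact: BS.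
by rewrite IH // BL //; exact: BSn'.
Qed.

Let nuZ (a : C) f : S f -> nu (a \*o f) = a * nu f.
Proof.
move=> Sf; have h : nu ((-1) \*o f \+ f) = 0 by rewrite nuL // mulN1r addNr.
rewrite (_ : a \*o f = (a \*o f) \+ ((-1) \*o f \+ f)).
  by rewrite nuL ?h ?addr0 //; apply: SD => //; exact: SZ.
by apply/funext => x /=; rewrite mulN1r addNr addr0.
Qed.

Let nuB f g : S f -> S g -> nu (f \- g) = nu f - nu g.
Proof.
move=> Sf Sg; rewrite (_ : f \- g = ((-1) \*o g) \+ f).
  by rewrite nuL // mulN1r addrC.
by apply/funext => x /=; rewrite mulN1r addrC.
Qed.

Let nuN f : S f -> cabs (nu f) <= K * N f.
Proof. by move=> Sf; apply: le_trans (nuw _ Sf) (wN _ Sf). Qed.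

Let Anun n f : S f -> nu (iter n A f) = nu f.
Proof. by move=> Sf; elim: n => //= n IH; rewrite Anu //; apply: (lin_iter _ n AL).1. Qed.

Let A1n n : iter n A one = one.
Proof. by elim: n => //= n ->. Qed.

(** Uniform bound for the powers of [B] in [N]: [K] from the strong term of the Doeblin-Fortet
    inequality, [K * K] from the weak one through [wN]. *)
Definition C1 : R := K + K * K.

(* [drift n] bounds [p (B^n f - A^n f) / (tau * N f)] for both weak norms. *)
Definition drift n : R := iter n (fun c => K * C1 + K * c) 0.

Let K0 : 0 <= K. Proof. exact: le_trans ler01 K1. Qed.
Let C1_ge1 : 1 <= C1.
Proof.
by have k1 := K1; rewrite /C1 -[leLHS]addr0 lerD // mulr_ge0 // K0.
Qed.

Let drift_ge0 n : 0 <= drift n.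
Proof.
have c1 := C1_ge1; elim: n => //= n IH.
by rewrite addr_ge0 // mulr_ge0 //; lra.
Qed.

Let drift_homo m n : (m <= n)%N -> drift m <= drift n.
Proof.
have k1 := K1; have c1 := C1_ge1.
apply: (@homo_leq _ drift (fun x y => x <= y)) => //; first exact: le_trans.
move=> k /=; have := drift_ge0 k => h.
have : 0 <= K * C1 by rewrite mulr_ge0 //; lra.
have : 0 <= (K - 1) * drift k by rewrite mulr_ge0 //; lra.
by rewrite /drift /=; lra.
Qed.

(** * A single perturbed operator: drift, contraction on the kernel of [nu], eigenvector *)

Section OnePerturbation.
Variables (B : fn -> fn) (tau : R).
Hypothesis hB : perturbed B tau.
Hypothesis tau0 : 0 <= tau.

Let BL : lin_on B. Proof. by case: hB. Qed.
Let SBn n f : S f -> S (iter n B f).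
Proof. exact: (lin_iter _ n BL).1. Qed.
Let SAn n f : S f -> S (iter n A f).
Proof. exact: (lin_iter _ n AL).1. Qed.

Lemma iter_bounded n f : S f -> N (iter n B f) <= C1 * N f.
Proof.
have k01 := ka01.
move=> Sf; have [_ [h _]] := hB; apply: le_trans (h n f Sf) _.
have Nf : 0 <= N f by apply: Nn.1.
have k1 : ka ^+ n <= 1 by apply: exprn_ile1; lra.
have := wN f Sf => hw.
have : 0 <= K * N f * (1 - ka ^+ n) by rewrite !mulr_ge0 // subr_ge0.
have : 0 <= K * (K * N f - w f) by rewrite mulr_ge0 // subr_ge0.
by rewrite /C1; lra.
Qed.

(** Telescoping [B^(n+1) - A^(n+1) = (B - A) B^n + A (B^n - A^n)], with [B^n f] bounded in the
    strong norm. The constant [drift n] may grow with [n], so it serves only up to a fixed time. *)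
Lemma iter_drift p n f : seminorm_on p ->
  (forall f, S f -> p (A f) <= K * p f) ->
  (forall f, S f -> p (B f \- A f) <= K * tau * N f) ->
  S f -> p (iter n B f \- iter n A f) <= drift n * tau * N f.
Proof.
move=> pn pA pBA Sf; have Nf : 0 <= N f by apply: Nn.1.
elim: n => [|n IH] /=.
  rewrite (_ : f \- f = 0 \*o f); last by apply/funext => x /=; rewrite subrr mul0r.
  by rewrite pn.2.2 // cabs0 !mul0r.
have Sb := SBn n f Sf; have Sa := SAn n f Sf.
rewrite (_ : B _ \- A _ = (B (iter n B f) \- A (iter n B f))
    \+ A (iter n B f \- iter n A f)); last first.
  by rewrite linB //; apply/funext => x /=; rewrite addrA subrK.
have S' : S (iter n B f \- iter n A f) by exact: SB.
apply: le_trans (pn.2.1 _ _ _ _) _.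
- by apply: SB; [apply: BL.1|apply: AL.1].
- exact: AL.1.
have h1 := pBA _ Sb; have h2 := pA _ S'; have h3 := iter_bounded n f Sf.
apply: le_trans (lerD h1 h2) _.
have : 0 <= K * tau * (C1 * N f - N (iter n B f)) by rewrite !mulr_ge0 // subr_ge0.
have : 0 <= K * (drift n * tau * N f - p (iter n B f \- iter n A f)).
  by rewrite mulr_ge0 // subr_ge0.
by rewrite /drift /=; lra.
Qed.

Lemma w_drift n f : S f -> w (iter n B f \- iter n A f) <= drift n * tau * N f.
Proof. by apply: iter_drift => //; have [_ [_ []]] := hB. Qed.

Lemma N2_drift n f : S f -> N2 (iter n B f \- iter n A f) <= drift n * tau * N f.
Proof. by apply: iter_drift => //; have [_ [_ []]] := hB. Qed.

Lemma nu_drift n f : S f -> cabs (nu (iter n B f) - nu f) <= drift n * tau * N f.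
Proof.
move=> Sf; rewrite -[X in _ - X](Anun n) // -nuB //; [|exact: SBn|exact: SAn].
by apply: le_trans (nuw _ _) (w_drift _ _ _) => //; apply: SB; [exact: SBn|exact: SAn].
Qed.

(** The Doeblin-Fortet inequality over the last [m] steps leaves the weak norm of [B^m g]. That norm
    is small because [A^m g] is, [g] lying in the kernel of [nu], and because [B^m - A^m] has size
    [tau] in [w]. *)
Lemma contraction_ker m g : S g -> nu g = 0 ->
  N (iter (m + m) B g) <= ((K * C1 + K * K * K) * ka ^+ m + K * drift m * tau) * N g.
Proof.
have k01 := ka01.
move=> Sg g0; rewrite iterD; have [_ [h _]] := hB.
have Sm := SBn m g Sg; have Sa := SAn m g Sg.
apply: le_trans (h m _ Sm) _.
have Ng : 0 <= N g by apply: Nn.1.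
have k0 : 0 <= ka ^+ m by apply: exprn_ge0; lra.
have h1 := iter_bounded m g Sg.
have h2 : w (iter m B g) <= w (iter m A g) + drift m * tau * N g.
  rewrite (_ : iter m B g = iter m A g \+ (iter m B g \- iter m A g)).
    apply: le_trans (wn.2.1 _ _ _ _) _ => //; first exact: SB.
    by rewrite lerD2l; exact: w_drift.
  by apply/funext => x /=; rewrite addrC subrK.
have h3 := wN _ Sa; have h4 := AnN m g Sg g0.
have : 0 <= K * ka ^+ m * (C1 * N g - N (iter m B g)) by rewrite !mulr_ge0 // subr_ge0.
have : 0 <= K * (K * (K * ka ^+ m * N g - N (iter m A g))) by rewrite !mulr_ge0 // subr_ge0.
have : 0 <= K * (w (iter m A g) + drift m * tau * N g - w (iter m B g)) by rewrite mulr_ge0 // subr_ge0.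
have : 0 <= K * (K * N (iter m A g) - w (iter m A g)) by rewrite mulr_ge0 // subr_ge0.
by lra.
Qed.

(** Bound for all [N (v n)]. The induction over blocks of length [M] yields
    [2 * C1 * N one + (KB + N one) / 2], which is at most [KB] as soon as
    [KB >= 4 * C1 * N one + N one]. *)
Definition KB : R := 5 * C1 * N one.

Variables (M : nat) (eta : R).
Local Notation th := (1 - (4 * M%:R)^-1 : R).
Hypothesis M0 : (0 < M)%N.
Hypothesis eta0 : 0 <= eta.
Hypothesis etaK : eta * (1 + K * KB) <= 1 / 4.
Hypothesis ker_eta : forall g, S g -> nu g = 0 -> N (iter M B g) <= eta * N g.
Hypothesis kaM : K * ka ^+ M <= 1 / 2.
Hypothesis tau_drift : drift M * tau * KB <= 1 / 2.

Let u n := iter n B one.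
Let a n := nu (u n).
Let v n := (a n)^-1 \*o u n.

Let Su n : S (u n). Proof. exact: SBn. Qed.
Let Sv n : S (v n). Proof. exact: SZ. Qed.

Let N1_ge0 : 0 <= N one. Proof. exact: Nn.1. Qed.
Let KB_ge0 : 0 <= KB.
Proof. by rewrite /KB !mulr_ge0 //; apply: le_trans C1_ge1. Qed.
Let N1_KB : 4 * (C1 * N one) + N one <= KB.
Proof.
have c1 := C1_ge1; rewrite /KB.
have : 0 <= (C1 - 1) * N one by rewrite mulr_ge0 // subr_ge0.
by lra.
Qed.

Let eta4 : eta <= 1 / 4.
Proof.
have e0 := eta0; have eK := etaK; have : 0 <= eta * (K * KB) by rewrite mulr_ge0 // mulr_ge0.
by lra.
Qed.

Let nu_near1 j f : (j <= M)%N -> S f -> nu f = 1 -> N f <= KB ->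
  cabs (nu (iter j B f) - 1) <= drift j * tau * KB.
Proof.
move=> jM Sf f1 NK; rewrite -f1; apply: le_trans (nu_drift _ _ Sf) _.
by rewrite ler_wpM2l // mulr_ge0.
Qed.

Let nu_gt_half j f : (j <= M)%N -> S f -> nu f = 1 -> N f <= KB ->
  1 / 2 <= cabs (nu (iter j B f)).
Proof.
move=> jM Sf f1 NK; have := nu_near1 j f jM Sf f1 NK.
have := lerB_cabs 1 (1 - nu (iter j B f)); rewrite cabs1 subKr cabsBC.
have : drift j * tau * KB <= drift M * tau * KB.
  by rewrite ler_wpM2r // ler_wpM2r // drift_homo.
by have := tau_drift; lra.
Qed.

Let nz (z : C) : 1 / 2 <= cabs z -> z != 0.
Proof. by move=> h; rewrite -cabs_gt0; lra. Qed.

Let v_shift n m : a n != 0 ->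
  u (n + m)%N = a n \*o iter m B (v n) /\
  a (n + m)%N = a n * nu (iter m B (v n)).
Proof.
move=> an0; have uE : u (n + m)%N = a n \*o iter m B (v n).
  rewrite -linZ //; last exact: lin_iter.
  rewrite /v (_ : a n \*o _ = u n); first by rewrite /u addnC iterD.
  by apply/funext => x /=; rewrite mulVKf.
by split => //; rewrite /a uE nuZ //; exact: SBn.
Qed.

Let nu_v n : a n != 0 -> nu (v n) = 1.
Proof. by move=> an; rewrite nuZ // mulVf. Qed.

(** Both claims are proved together. The bound at [n] places [nu (B^M (v n))] within 1/2 of 1, so
    [a] does not vanish at [n + M]; the bound at [n + M] follows by splitting [v n] into [1] and an
    element of the kernel of [nu], which [B^M] contracts by [eta]. *)
Let v_bound n : a n != 0 /\ N (v n) <= KB.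
Proof.
have one_KB : N one <= KB.
  by apply: le_trans N1_KB; rewrite lerDr !mulr_ge0 //; apply: le_trans C1_ge1.
have a0 : a 0%N = 1 by rewrite /a /u.
have v0 : v 0%N = one by rewrite /v a0 invr1; apply/funext => x /=; rewrite mul1r.
have inv2 z : 1 / 2 <= cabs z -> cabs z^-1 <= 2.
  move=> h; rewrite cabsV -[leRHS]invrK lef_pV2 ?posrE; lra.
elim/ltn_ind: n => n IH; have [nM|Mn] := ltnP n M.
  have h : 1 / 2 <= cabs (a n) by apply: nu_gt_half => //; exact: ltnW.
  split; first exact: nz.
  rewrite /v Nn.2.2 //; apply: (@le_trans _ _ (2 * (C1 * N one))).
    by apply: ler_pM; rewrite ?cabs_ge0 //; [exact: Nn.1|exact: inv2|exact: iter_bounded].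
  have := N1_KB; have : 0 <= C1 * N one by rewrite mulr_ge0 //; apply: le_trans C1_ge1.
  by have := N1_ge0; lra.
have [|am Nm] := IH (n - M)%N; first by rewrite ltn_subrL M0 (leq_trans M0 Mn).
rewrite -(subnK Mn); set m := (n - M)%N in am Nm *.
have [uE aE] := v_shift m M am.
have am1 : nu (v m) = 1 by exact: nu_v.
have cM : 1 / 2 <= cabs (nu (iter M B (v m))) by apply: nu_gt_half => //; exact: nu_v.
have an : a (m + M)%N != 0 by rewrite aE mulf_neq0 // nz.
split => //.
have SM : S (iter M B (v m)) by exact: SBn.
have -> : v (m + M)%N = (nu (iter M B (v m)))^-1 \*o iter M B (v m).
  rewrite /v uE aE; apply/funext => x /=.
  by rewrite invfM mulrACA mulVf // mul1r.
rewrite Nn.2.2 //; apply: (@le_trans _ _ (2 * N (iter M B (v m)))).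
  by rewrite ler_wpM2r ?inv2 //; exact: Nn.1.
have -> : iter M B (v m) = iter M B one \+ iter M B (v m \- one).
  rewrite linB //; last exact: lin_iter.
  by apply/funext => x /=; rewrite addrC subrK.
have Sd : S (v m \- one) by exact: SB.
have h1 : N (iter M B one \+ iter M B (v m \- one)) <= _ := Nn.2.1 _ _ (SBn _ _ S1) (SBn M _ Sd).
have h2 := iter_bounded M one S1.
have h3 : N (iter M B (v m \- one)) <= eta * N (v m \- one).
  by apply: ker_eta => //; rewrite nuB // nu1 nu_v // subrr.
have h4 : N (v m \- one) <= KB + N one.
  by apply: le_trans (pB _ _ _ Nn _ _) _ => //; rewrite lerD2r.
have h5 : eta * N (v m \- one) <= 1 / 4 * (KB + N one).
  by apply: ler_pM => //; exact: Nn.1.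
by have := N1_KB; lra.
Qed.

Let vE n m : v (n + m)%N = (nu (iter m B (v n)))^-1 \*o iter m B (v n).
Proof.
have [an _] := v_bound n; have [uE aE] := v_shift n m an.
by rewrite /v uE aE; apply/funext => x /=; rewrite invfM mulrACA mulVf // mul1r.
Qed.

Let nu_vM n j : (j <= M)%N -> 1 / 2 <= cabs (nu (iter j B (v n))).
Proof.
by move=> jM; have [an Nv] := v_bound n; apply: nu_gt_half => //; exact: nu_v.
Qed.

Let cabs_inv2 (z : C) : 1 / 2 <= cabs z -> cabs z^-1 <= 2.
Proof. by move=> h; rewrite cabsV -[leRHS]invrK lef_pV2 ?posrE; lra. Qed.

(** Up to the factor [c1^-1], the new difference is [B^M D] brought back into the kernel of [nu] by
    subtracting a multiple of [v (n + M)]. The costs are 2 for [c1^-1] and [1 + K * KB] for the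
    correction; [etaK] then leaves 1/2. *)
Let d_contr n :
  N (v (n + M).+1 \- v (n + M)%N) <= N (v n.+1 \- v n) / 2.
Proof.
set D := v n.+1 \- v n.
have SD' : S D by exact: SB.
have D0 : nu D = 0 by rewrite nuB // !nu_v ?subrr //; have [] := v_bound n; have [] := v_bound n.+1.
set c0 := nu (iter M B (v n)); set c1 := nu (iter M B (v n.+1)).
have c0h : 1 / 2 <= cabs c0 by exact: nu_vM.
have c1h : 1 / 2 <= cabs c1 by exact: nu_vM.
have BD : iter M B D = iter M B (v n.+1) \- iter M B (v n).
  by rewrite linB //; exact: lin_iter.
have nBD : nu (iter M B D) = c1 - c0 by rewrite BD nuB //; exact: SBn.
have SBD : S (iter M B D) by exact: SBn.
have SZv : S (nu (iter M B D) \*o v (n + M)%N) by exact: SZ.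
have -> : v (n + M).+1 \- v (n + M)%N =
    c1^-1 \*o (iter M B D \- (nu (iter M B D) \*o v (n + M)%N)).
  rewrite nBD BD -addSn !vE -/c0 -/c1; apply/funext => x /=.
  by field; rewrite !nz.
rewrite Nn.2.2; last exact: SB.
have h1 : N (iter M B D) <= eta * N D by exact: ker_eta.
have h2 := nuN _ SBD; have [_ h3] := v_bound (n + M)%N.
have h4 : cabs (nu (iter M B D)) * N (v (n + M)%N) <= K * N (iter M B D) * KB.
  by apply: ler_pM; rewrite ?cabs_ge0 //; exact: Nn.1.
have h5 : N (iter M B D \- (nu (iter M B D) \*o v (n + M)%N)) <=
    (1 + K * KB) * (eta * N D).
  apply: le_trans (pB _ _ _ Nn _ _) _ => //; rewrite Nn.2.2 //.
  have : 0 <= (1 + K * KB) * (eta * N D - N (iter M B D)).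
    by rewrite mulr_ge0 ?subr_ge0 // addr_ge0 // mulr_ge0.
  by lra.
apply: le_trans (ler_pM (cabs_ge0 _) _ (cabs_inv2 _ c1h) h5) _.
  by apply: Nn.1; exact: SB.
have ND : 0 <= N D by exact: Nn.1.
have : 0 <= (1 / 4 - eta * (1 + K * KB)) * N D.
  by rewrite mulr_ge0 // subr_ge0.
by lra.
Qed.

Let th01 : 0 < th < 1.
Proof.
have M1 : 1 <= M%:R :> R by rewrite ler1n.
have i0 : 0 < (4 * M%:R : R)^-1 by rewrite invr_gt0; lra.
have : (4 * M%:R : R)^-1 <= 1 / 4.
  by rewrite div1r lef_pV2 ?posrE; lra.
by lra.
Qed.

Let d_geo n : N (v n.+1 \- v n) <= 8 * KB * th ^+ n.
Proof.
have t0 := th01.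
have := @geom_halving R M (fun n => N (v n.+1 \- v n)) (2 * KB) M0.
rewrite (_ : 4 * (2 * KB) = 8 * KB); last by lra.
apply => [|j _|k]; first by rewrite mulr_ge0.
  apply: le_trans (pB _ _ _ Nn _ _) _ => //.
  by have [_ h1] := v_bound j; have [_ h2] := v_bound j.+1; lra.
apply: le_trans (d_contr k) _.
have KB0 := KB_ge0; rewrite lerDl; apply: mulr_ge0; first by lra.
by apply: exprn_ge0; lra.
Qed.

Let v_cauchy n k : N (v (n + k)%N \- v n) <= 8 * KB / (1 - th) * th ^+ n.
Proof.
have t01 := th01; set c := 8 * KB / (1 - th).
have KB0 := KB_ge0; have c0 : 0 <= c by apply: divr_ge0; lra.
(* The exact partial sum of the geometric series is carried along, since the final bound alone is
   not inductive in [k]. *)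
suff : N (v (n + k)%N \- v n) <= c * (th ^+ n - th ^+ (n + k)).
  have : 0 <= c * th ^+ (n + k) by rewrite mulr_ge0 ?exprn_ge0 //; lra.
  by lra.
elim: k => [|k IH].
  rewrite addn0 (_ : v n \- v n = 0 \*o v n); last first.
    by apply/funext => x /=; rewrite subrr mul0r.
  by rewrite Nn.2.2 // cabs0 mul0r subrr mulr0.
rewrite addnS (_ : _ \- _ = (v (n + k).+1 \- v (n + k)%N) \+ (v (n + k)%N \- v n)).
  apply: le_trans (Nn.2.1 _ _ _ _) _; [exact: SB|exact: SB|].
  apply: le_trans (lerD (d_geo (n + k)) IH) _.
  rewrite (_ : 8 * KB = c * (1 - th)); last by rewrite /c mulfVK //; lra.
  by rewrite exprS; lra.
by apply/funext => x /=; rewrite addrA subrK.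
Qed.

Lemma eigen_ex : exists h, S h /\ N h <= KB /\ nu h = 1 /\
  B h = nu (B h) \*o h.
Proof.
have t01 := th01.
have [|h [Sh vh]] := Ncompl v Sv.
  move=> e e0.
  have e2 : 0 < e / 2 by lra.
  have t01' : 0 <= th < 1 by lra.
  have [m0 Hm] := @expr_eventually_lt R th (8 * KB / (1 - th)) (e / 2) t01' e2.
  have near m : (m0 <= m)%N -> N (v m \- v m0) < e / 2.
    move=> hm; rewrite -(subnKC hm).
    by apply: le_lt_trans (v_cauchy _ _) (Hm _ _).
  exists m0 => m n hm hn.
  rewrite (_ : v m \- v n = (v m \- v m0) \- (v n \- v m0)).
    apply: le_lt_trans (pB _ _ _ Nn _ _) _; [exact: SB|exact: SB|].
    by have := near m hm; have := near n hn; lra.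
  by apply/funext => x /=; rewrite opprB addrA subrK.
have Sd n : S (v n \- h) by exact: SB.
have Nh : N h <= KB.
  apply: ler_small => e e0; have [n /(_ n (leqnn _)) hn] := vh e e0.
  rewrite (_ : h = v n \- (v n \- h)); last first.
    by apply/funext => x /=; rewrite subKr.
  apply: le_trans (pB _ _ _ Nn _ _) _ => //.
  by have [_] := v_bound n; lra.
have h1 : nu h = 1.
  apply/eqP; rewrite -subr_eq0; apply/eqP/cabs_eq0/le_anti.
  rewrite cabs_ge0 andbT; apply: (ler_small_mul _ K) => // e e0.
  have [n /(_ n (leqnn _)) hn] := vh e e0.
  have [an _] := v_bound n.
  rewrite cabsBC -(nu_v n an) -nuB //; apply: le_trans (nuN _ _) _ => //.
  by rewrite ler_wpM2l // ltW.
exists h; do 3 (split => //).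
set la := nu (B h).
have SBh : S (B h) by exact: BL.1.
have Sla : S (la \*o h) by exact: SZ.
suff : N (B h \- (la \*o h)) = 0.
  move/N_eq0 => H; apply/funext => x /=.
  by have /(congr1 (fun f => f x)) /= := H (SB _ _ SBh Sla) => /eqP; rewrite subr_eq0 => /eqP.
apply/le_anti; rewrite Nn.1 ?andbT; last exact: SB.
have BN f : S f -> N (B f) <= C1 * N f by move=> Sf; exact: (iter_bounded 1).
have C10 : 0 <= C1 by apply: le_trans C1_ge1.
apply: (ler_small_mul _ (C1 + K * C1 * KB + cabs la)).
  by rewrite !addr_ge0 ?cabs_ge0 // mulr_ge0 // mulr_ge0.
move=> e e0; have [n hn] := vh e e0.
have hn0 := hn n (leqnn _); have hn1 := hn n.+1 (leqnSn _).
have SBv : S (B (v n)) by exact: BL.1.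
set ln := nu (B (v n)).
have M1 : (1 <= M)%N by [].
have lnh : 1 / 2 <= cabs ln := nu_vM n 1 M1.
(* The eigenvalue equation is the limit of this identity: [v n] tends to [h] in [N], and [B] and
   [nu] are continuous for [N]. *)
have Bv : B (v n) = ln \*o v n.+1.
  rewrite -addn1 vE /= -/ln; apply/funext => x /=.
  by rewrite mulVKf // nz.
rewrite (_ : B h \- (la \*o h) = (B (h \- v n) \+ ((ln - la) \*o v n.+1)) \+
   (la \*o (v n.+1 \- h))); last first.
  by rewrite linB // Bv; apply/funext => x /=; ring.
have S1' : S (B (h \- v n)) by apply: BL.1; exact: SB.
have S2' : S ((ln - la) \*o v n.+1) by exact: SZ.
have S3' : S (la \*o (v n.+1 \- h)) by exact: SZ.
apply: le_trans (Nn.2.1 _ _ (SD _ _ S1' S2') S3') _.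
rewrite (Nn.2.2 la) //; have hA := Nn.2.1 _ _ S1' S2'.
rewrite (Nn.2.2 (ln - la)) // in hA.
have hB1 : N (B (h \- v n)) <= C1 * e.
  apply: le_trans (BN _ _) _; first exact: SB.
  by rewrite ler_wpM2l // (pBC _ _ _ Nn) // ltW.
have hB2 : cabs (ln - la) * N (v n.+1) <= K * C1 * e * KB.
  apply: ler_pM; rewrite ?cabs_ge0 //; [exact: Nn.1| |by have [] := v_bound n.+1].
  rewrite /ln /la -nuB // -linB //; apply: le_trans (nuN _ _) _; first exact: BL.1.
  rewrite -mulrA ler_wpM2l //; apply: le_trans (BN _ _) _ => //.
  by rewrite ler_wpM2l // ltW.
have hB3 : cabs la * N (v n.+1 \- h) <= cabs la * e.
  by rewrite ler_wpM2l ?cabs_ge0 // ltW.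
apply: le_trans (lerD hA hB3) _.
by apply: le_trans (lerD (lerD hB1 hB2) (lexx _)) _; lra.
Qed.

Local Notation L := (drift M).
Local Notation n2 := (N2 one).
(** In [C2], the factor [K / (1 - ka)] sums the powers of [A] on the kernel of [nu] and [L * KB]
    measures how far [h] is from being fixed by [A]. [D1] bounds [N (g j)] for [j < M], where [a j]
    has modulus at most 2. [D2] dominates, up to [tau], both the initial values and the source term
    in the recursion for [N2 (g n)]. [Kfin] has one summand each for [la], [h], [q] and [g]. *)
Definition C2 : R := K / (1 - ka) * L * KB.
Definition D1 : R := C1 * N one + 2 * KB.
Definition D2 : R := L * (2 * n2 + 2) * (4 * D1 + N one) + 2 * C2 * (n2 + 1).
Definition Kfin : R :=
  L * KB + 2 * C2 * (n2 + 1) + 8 * (L * D1) / (1 - th) + 4 * D2.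

Hypothesis tau2 : C2 * tau <= 1 / 2.
Hypothesis tau3 : L * tau * KB <= (1 - th) / 2.

(** * Decomposition of the orbit of [1] along the eigenvector [h] *)

Section Eigen.
Variable h : fn.
Hypothesis Sh : S h.
Hypothesis Nh : N h <= KB.
Hypothesis h1 : nu h = 1.
Hypothesis Bh : B h = nu (B h) \*o h.
Let la := nu (B h).
Let g n := u n \- (a n \*o h).

Let L0 : 0 <= L. Proof. exact: drift_ge0. Qed.
Let n20 : 0 <= n2. Proof. exact: N2n.1. Qed.
Let C20 : 0 <= C2.
Proof.
have k := ka01; apply: mulr_ge0 => //; apply: mulr_ge0 => //.
by apply: divr_ge0 => //; lra.
Qed.
Let D10 : 0 <= D1.
Proof.
by apply: addr_ge0; apply: mulr_ge0 => //; exact: le_trans C1_ge1.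
Qed.

Let LtN j f c : (j <= M)%N -> N f <= c -> 0 <= N f -> drift j * tau * N f <= L * tau * c.
Proof.
move=> jM fc f0; apply: ler_pM => //; first by apply: mulr_ge0.
by rewrite ler_wpM2r // drift_homo.
Qed.

Let la_near : cabs (la - 1) <= L * tau * KB.
Proof.
rewrite -h1; apply: le_trans (nu_drift 1 h Sh) _.
by apply: LtN => //; exact: Nn.1.
Qed.

(** Since [A^n h] tends to [1], [h - 1] is the sum of [A^n r] with [r = h - A h], and
    [r = (1 - la) h + (B - A) h] is of size [tau]. The bound on [N2 r] involves [N2 h], which is not
    compared with [N h]; so one gets a self-bounding inequality for [x = N2 (h - 1)], and
    [C2 * tau <= 1 / 2] absorbs [x]. *)
Let h_near : N2 (h \- one) <= 2 * C2 * (n2 + 1) * tau /\ N2 h <= 2 * n2 + 1.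
Proof.
have k := ka01; have SAh : S (A h) by exact: AL.1.
have SBh : S (B h) by exact: BL.1.
set r := h \- A h; have Sr : S r by exact: SB.
have r0 : nu r = 0 by rewrite nuB // Anu // subrr.
have Shone : S (h \- one) by exact: SB.
have Nr : N2 r <= L * tau * KB * (N2 h + 1).
  rewrite (_ : r = ((1 - la) \*o h) \+ (B h \- A h)); last first.
    by rewrite Bh -/la; apply/funext => x /=; rewrite /r /=; ring.
  apply: le_trans (N2n.2.1 _ _ _ _) _; [exact: SZ|exact: SB|].
  rewrite N2n.2.2 // mulrDr mulr1 lerD //.
    by rewrite ler_wpM2r ?N2n.1 // cabsBC.
  by apply: le_trans (N2_drift 1 h Sh) _; apply: LtN => //; exact: Nn.1.
have Nsum n : N2 (h \- iter n A h) <= K / (1 - ka) * (1 - ka ^+ n) * N2 r.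
  elim: n => [|n IH].
    rewrite (_ : h \- _ = 0 \*o h); last by apply/funext => x /=; rewrite subrr mul0r.
    by rewrite N2n.2.2 // cabs0 mul0r subrr mulr0 mul0r.
  rewrite iterSr (_ : _ \- _ = (h \- iter n A h) \+ iter n A r); last first.
    rewrite linB //; last exact: lin_iter.
    by apply/funext => x /=; rewrite addrA subrK.
  apply: le_trans (N2n.2.1 _ _ _ _) _; [by apply: SB => //; exact: SAn|exact: SAn|].
  apply: le_trans (lerD IH (AnN2 n r Sr r0)) _.
  rewrite le_eqVlt; apply/orP; left; apply/eqP; rewrite exprS; field.
  lra.
have xr : N2 (h \- one) <= K / (1 - ka) * N2 r.
  apply: ler_small => e e0.
  have ka01' : 0 <= ka < 1 by lra.
  have [n /(_ n (leqnn _)) Hn] := @expr_eventually_lt R ka (K * N2 (h \- one)) e ka01' e0.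
  rewrite (_ : h \- one = (h \- iter n A h) \+ iter n A (h \- one)); last first.
    rewrite linB //; last exact: lin_iter.
    by rewrite A1n; apply/funext => x /=; rewrite addrA subrK.
  apply: le_trans (N2n.2.1 _ _ _ _) _; [by apply: SB => //; exact: SAn|exact: SAn|].
  apply: lerD.
    apply: le_trans (Nsum n) _; rewrite ler_wpM2r ?N2n.1 // ler_piMr //.
      by apply: divr_ge0 => //; lra.
    by rewrite lerBlDr lerDl exprn_ge0 //; lra.
  have := AnN2 n _ Shone; rewrite nuB // h1 nu1 subrr => /(_ erefl).
  by lra.
have hx : N2 h <= N2 (h \- one) + n2.
  rewrite {1}(_ : h = (h \- one) \+ one); first exact: N2n.2.1.
  by apply/funext => x /=; rewrite subrK.
set x := N2 (h \- one) in xr hx *.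
have x0 : 0 <= x by exact: N2n.1.
have xC : x <= C2 * tau * (x + n2 + 1).
  apply: le_trans xr _.
  rewrite (_ : C2 * tau * _ = K / (1 - ka) * (L * tau * KB * (x + n2 + 1))).
    apply: ler_wpM2l; first by apply: divr_ge0 => //; lra.
    apply: le_trans Nr _; apply: ler_wpM2l; last by rewrite lerD2r.
    by apply: mulr_ge0 => //; apply: mulr_ge0.
  by rewrite /C2; ring.
have t2 := tau2; have n2' := n20; have c2' := C20; have tau' := tau0.
have x1 : x <= n2 + 1.
  have : 0 <= (1 / 2 - C2 * tau) * (x + n2 + 1) by rewrite mulr_ge0 ?subr_ge0 //; lra.
  by lra.
split; last lra.
have : 0 <= C2 * tau * (n2 + 1 - x) by apply: mulr_ge0; [exact: mulr_ge0|lra].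
by lra.
Qed.

Let Sg n : S (g n). Proof. by apply: SB => //; exact: SZ. Qed.
Let nug n : nu (g n) = 0.
Proof. by rewrite nuB ?nuZ ?h1 ?mulr1 ?subrr //; exact: SZ. Qed.

Let iterBh m : iter m B h = la ^+ m \*o h.
Proof.
elim: m => [|m IH] /=; first by apply/funext => x /=; rewrite expr0 mul1r.
by rewrite IH linZ // Bh; apply/funext => x /=; rewrite exprSr mulrA.
Qed.

Let uS n m : u (n + m)%N = (a n * la ^+ m) \*o h \+ iter m B (g n).
Proof.
have -> : u (n + m)%N = iter m B (u n) by rewrite /u addnC iterD.
rewrite {1}(_ : u n = (a n \*o h) \+ g n); last first.
  by rewrite /g; apply/funext => x /=; rewrite addrC subrK.
have lB := lin_iter _ m BL.
rewrite linD //; last exact: SZ.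
by rewrite linZ // iterBh; apply/funext => x /=; rewrite mulrA.
Qed.

Let aS n m : a (n + m)%N = a n * la ^+ m + nu (iter m B (g n)).
Proof. by rewrite {1}/a uS nuL // ?h1 ?mulr1 //; exact: SBn. Qed.

Let gS n m : g (n + m)%N = iter m B (g n) \- (nu (iter m B (g n)) \*o h).
Proof. by rewrite {1}/g uS aS; apply/funext => x /=; ring. Qed.

Let a_near j : (j <= M)%N -> cabs (a j - 1) <= L * tau * N one.
Proof.
move=> jM; rewrite -[X in _ - X]nu1; apply: le_trans (nu_drift j one S1) _.
by apply: LtN => //; exact: Nn.1.
Qed.

(** [g (k + M)] is [B^M (g k)] projected along [h] onto the kernel of [nu], so [ker_eta] applies to
    every block. Geometric decay is obtained, but no factor [tau]. *)
Let Ng n : N (g n) <= 4 * D1 * th ^+ n.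
Proof.
have t01 := th01; have KB0 := KB_ge0; have d1 := D10.
apply: (@geom_halving R M (fun n => N (g n)) D1 M0) => // [j jM|k].
  have Sah : S (a j \*o h) by exact: SZ.
  apply: le_trans (pB _ _ _ Nn _ _) _ => //.
  apply: lerD; first exact: iter_bounded.
  rewrite Nn.2.2 //; apply: ler_pM; [exact: cabs_ge0|exact: Nn.1| |exact: Nh].
  have := a_near j (ltnW jM); have := lerB_cabs (a j) 1; rewrite cabs1.
  have : L * tau * N one <= L * tau * KB.
    apply: ler_wpM2l; first exact: mulr_ge0.
    by apply: le_trans N1_KB; rewrite lerDr !mulr_ge0 //; apply: le_trans C1_ge1.
  by have := tau_drift; lra.
have SBg : S (iter M B (g k)) by exact: SBn.
have SZh : S (nu (iter M B (g k)) \*o h) by exact: SZ.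
rewrite gS; apply: le_trans (pB _ _ _ Nn _ _) _ => //.
rewrite Nn.2.2 //.
have e1 := ker_eta _ (Sg k) (nug k).
have e2 : cabs (nu (iter M B (g k))) * N h <= K * N (iter M B (g k)) * KB.
  by apply: ler_pM; [exact: cabs_ge0|exact: Nn.1|exact: nuN|done].
have Ngk : 0 <= N (g k) by exact: Nn.1.
have : 0 <= (1 + K * KB) * (eta * N (g k) - N (iter M B (g k))).
  apply: mulr_ge0; last by rewrite subr_ge0.
  by apply: addr_ge0 => //; apply: mulr_ge0.
have : 0 <= (1 / 4 - eta * (1 + K * KB)) * N (g k).
  by apply: mulr_ge0 => //; rewrite subr_ge0.
have : 0 <= D1 * th ^+ k by apply: mulr_ge0 => //; apply: exprn_ge0; lra.
by lra.
Qed.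

Let nuBg j n : (j <= M)%N -> cabs (nu (iter j B (g n))) <= L * tau * (4 * D1 * th ^+ n).
Proof.
move=> jM; rewrite -[X in cabs X]subr0 -(nug n).
by apply: le_trans (nu_drift j _ (Sg n)) _; apply: LtN => //; exact: Nn.1.
Qed.

(** Here every source term carries [tau]: at times below [M] because [A] fixes [1] and [h] is close
    to [1], later because [B^M - A^M] and [nu (B^M g)] are of size [tau] times the decaying
    [N (g k)]. The main term is halved by [A^M] on the kernel of [nu]. *)
Let N2g n : N2 (g n) <= 4 * D2 * tau * th ^+ n.
Proof.
have t01 := th01; have d1 := D10; have [hn hH] := h_near; have l0 := L0; have t0 := tau0.
have nn := n20; have N10 := N1_ge0; have c2 := C20.
have E0 : 0 <= L * (2 * n2 + 2) * (4 * D1 + N one).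
  by rewrite !mulr_ge0 //; lra.
have E1 : 0 <= 2 * C2 * (n2 + 1).
  by apply: mulr_ge0; [apply: mulr_ge0|lra].
rewrite -[4 * D2 * tau]mulrA.
apply: (@geom_halving R M (fun n => N2 (g n)) (D2 * tau) M0).
- by apply: mulr_ge0 => //; rewrite /D2; lra.
- move=> j jM.
  have Sa : S ((1 - a j) \*o h) by exact: SZ.
  have Sd : S (u j \- iter j A one) by apply: SB => //; exact: SAn.
  have So : S (one \- h) by exact: SB.
  rewrite /g (_ : _ \- _ = (u j \- iter j A one) \+ (one \- h) \+ ((1 - a j) \*o h)); last first.
    by rewrite A1n; apply/funext => x /=; ring.
  apply: le_trans (N2n.2.1 _ _ _ _) _ => //; first exact: SD.
  rewrite N2n.2.2 //; have e0 := N2n.2.1 _ _ Sd So.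
  have e1 : N2 (u j \- iter j A one) <= L * tau * N one.
    apply: le_trans (N2_drift j one S1) _.
    by apply: LtN => //; exact: ltnW.
  have e2 : N2 (one \- h) <= 2 * C2 * (n2 + 1) * tau by rewrite (pBC _ _ _ N2n).
  have e3 : cabs (1 - a j) * N2 h <= L * tau * N one * (2 * n2 + 1).
    by rewrite cabsBC; apply: ler_pM; [exact: cabs_ge0|exact: N2n.1|apply: a_near; exact: ltnW|done].
  have e4 : 0 <= L * tau * ((2 * n2 + 2) * (4 * D1)) by rewrite !mulr_ge0 //; lra.
  by rewrite /D2; lra.
move=> k; have SBg : S (iter M B (g k)) by exact: SBn.
have SAg : S (iter M A (g k)) by exact: SAn.
have SZh : S (nu (iter M B (g k)) \*o h) by exact: SZ.
have Sd : S (iter M B (g k) \- iter M A (g k)) by exact: SB.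
rewrite gS; apply: le_trans (pB _ _ _ N2n _ _) _ => //.
rewrite N2n.2.2 //.
have e1 : N2 (iter M B (g k)) <= N2 (iter M A (g k)) + N2 (iter M B (g k) \- iter M A (g k)).
  rewrite {1}(_ : iter M B (g k) = iter M A (g k) \+ (iter M B (g k) \- iter M A (g k))).
    exact: N2n.2.1.
  by apply/funext => x /=; rewrite addrC subrK.
have e2 : N2 (iter M A (g k)) <= 1 / 2 * N2 (g k).
  by apply: le_trans (AnN2 _ _ (Sg k) (nug k)) _; rewrite ler_wpM2r // N2n.1.
have e3 : N2 (iter M B (g k) \- iter M A (g k)) <= L * tau * (4 * D1 * th ^+ k).
  apply: le_trans (N2_drift M _ (Sg k)) _.
  by apply: LtN; [done|exact: Ng|exact: Nn.1].
have e4 : cabs (nu (iter M B (g k))) * N2 h <= L * tau * (4 * D1 * th ^+ k) * (2 * n2 + 1).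
  by apply: ler_pM; [exact: cabs_ge0|exact: N2n.1|exact: nuBg|done].
have tk : 0 <= th ^+ k by apply: exprn_ge0; lra.
have : 0 <= (L * (2 * n2 + 2) * N one + 2 * C2 * (n2 + 1)) * (tau * th ^+ k).
  apply: mulr_ge0; last exact: mulr_ge0.
  by apply: addr_ge0 => //; apply: mulr_ge0 => //; apply: mulr_ge0 => //; lra.
by rewrite /D2; lra.
Qed.

Let la_gt : (1 + th) / 2 <= cabs la.
Proof.
have := lerB_cabs 1 (1 - la); rewrite cabs1 subKr cabsBC.
by have := la_near; have := tau3; lra.
Qed.

(** From [a (n + 1) = la * a n + nu (B (g n))], the increments of [a n / la ^+ n] are
    [nu (B (g n)) / la ^+ n.+1]. They are summable because [la] has modulus at least [rho], the
    midpoint of [th] and 1, whereas [nu (B (g n))] decays like [th ^+ n]. *)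
Let q_near n : cabs (a n / la ^+ n - 1) <= 8 * (L * D1) / (1 - th) * tau.
Proof.
have t01 := th01; have lg := la_gt; set t := th in t01 lg *.
set rho := (1 + t) / 2.
have la0 : la != 0 by rewrite -cabs_gt0; lra.
have rho0 : 0 < rho by rewrite /rho; lra.
have d1 := D10; have c0 : 0 <= L * tau * (4 * D1).
  by apply: mulr_ge0; [apply: mulr_ge0|lra].
have rt : rho - t = (1 - t) / 2 by rewrite /rho; field.
suff : cabs (a n / la ^+ n - 1) <= L * tau * (4 * D1) / (rho - t) * (1 - (t / rho) ^+ n).
  move=> /le_trans; apply.
  rewrite (_ : 8 * (L * D1) / (1 - t) * tau = L * tau * (4 * D1) / (rho - t)).
    apply: ler_piMr; first by apply: divr_ge0 => //; rewrite rt; lra.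
    by rewrite lerBlDr lerDl exprn_ge0 // divr_ge0 //; lra.
  by rewrite rt; field; lra.
elim: n => [|n IH].
  by rewrite /a /u /= nu1 expr0 divr1 subrr cabs0 subrr mulr0.
rewrite (_ : _ - 1 = nu (B (g n)) / la ^+ n.+1 + (a n / la ^+ n - 1)); last first.
  have := aS n 1; rewrite addn1 expr1 /= => ->; rewrite exprS; field.
  by rewrite la0 expf_neq0.
apply: le_trans (cabsD _ _) _.
have e1 : cabs (nu (B (g n)) / la ^+ n.+1) <= L * tau * (4 * D1) * t ^+ n / rho ^+ n.+1.
  rewrite cabsM cabsV cabsX; apply: ler_pM; rewrite ?cabs_ge0 ?invr_ge0 ?exprn_ge0 ?cabs_ge0 //.
    by rewrite -mulrA; exact: (nuBg 1).
  by rewrite lef_pV2 ?posrE ?exprn_gt0 //; [apply: lerXn2r; rewrite ?nnegrE ?cabs_ge0 //; lra|lra].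
apply: le_trans (lerD e1 IH) _.
rewrite le_eqVlt; apply/orP; left; apply/eqP.
rewrite !exprS (expr_div_n t rho); field.
have r1 : rho != 0 by rewrite gt_eqF.
have r2 : rho - t != 0 by rewrite rt gt_eqF //; lra.
by rewrite ?r1 ?r2 ?(expf_neq0 n r1).
Qed.

Lemma eigen_decomposition : exists la' : C, exists h' : fn,
  S h' /\ nu h' = 1 /\ cabs (la' - 1) <= Kfin * tau /\ N2 (h' \- one) <= Kfin * tau /\
  forall n, exists (q : C) (g' : fn), S g' /\ nu g' = 0 /\
    iter n B one = ((la' ^+ n * q) \*o h') \+ g' /\
    cabs (q - 1) <= Kfin * tau /\ N2 g' <= Kfin * tau * th ^+ n.
Proof.
have t01 := th01; have d1 := D10; have [hn hH] := h_near; have l0 := L0; have t0 := tau0.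
have nn := n20; have N10 := N1_ge0; have c2 := C20; have KB0 := KB_ge0; have ln := la_near.
have E0 : 0 <= L * (2 * n2 + 2) * (4 * D1 + N one).
  by rewrite !mulr_ge0 //; lra.
have E1 : 0 <= 2 * C2 * (n2 + 1).
  by apply: mulr_ge0; [apply: mulr_ge0|lra].
have E2 : 0 <= D2 by rewrite /D2; lra.
have E3 : 0 <= L * KB by apply: mulr_ge0.
have E4 : 0 <= 8 * (L * D1) / (1 - th).
  by apply: divr_ge0; [apply: mulr_ge0 => //; exact: mulr_ge0|lra].
have le_fin c : 0 <= Kfin - c -> c * tau <= Kfin * tau.
  by move=> cf; rewrite ler_wpM2r // -subr_ge0.
have la0 : la != 0 by rewrite -cabs_gt0; have := la_gt; lra.
exists la, h; split => //; split => //; split.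
  by apply: le_trans ln _; rewrite mulrAC le_fin // /Kfin; lra.
split; first by apply: le_trans hn _; rewrite le_fin // /Kfin; lra.
move=> n; exists (a n / la ^+ n), (g n); split => //; split => //; split.
  by rewrite /g mulrCA divff ?expf_neq0 // mulr1; apply/funext => x /=; rewrite addrC subrK.
split; first by apply: le_trans (q_near n) _; rewrite le_fin // /Kfin; lra.
apply: le_trans (N2g n) _; rewrite ler_wpM2r ?exprn_ge0 ?le_fin //; first lra.
by rewrite /Kfin; lra.
Qed.
End Eigen.

End OnePerturbation.

(** The order of choices matters: [eta] depends only on [KB], then [m] makes the powers of [ka]
    small against [eta], which fixes [M] and [th], and only then is [dlt] taken small against the
    drift constants at times [m] and [M]. All constants are thus independent of [B]. *)
Theorem spectral_perturbation : exists K' dlt th : R,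
  0 < dlt /\ 0 < th < 1 /\ 0 <= K' /\
  forall B tau, 0 <= tau < dlt -> perturbed B tau ->
  exists (la : C) (h : fn), S h /\ nu h = 1 /\ cabs (la - 1) <= K' * tau /\
    N2 (h \- one) <= K' * tau /\
  forall n, exists (q : C) (g : fn), S g /\ nu g = 0 /\
    iter n B one = ((la ^+ n * q) \*o h) \+ g /\
    cabs (q - 1) <= K' * tau /\ N2 g <= K' * tau * th ^+ n.
Proof.
have k01 := ka01; have k1 := K1; have k0 := K0; have c1 := C1_ge1.
have N10 : 0 <= N one by exact: Nn.1.
have KB0 : 0 <= KB by apply: mulr_ge0 => //; lra.
have c0 : 0 < 1 + K * KB by apply: ltr_wpDr => //; exact: mulr_ge0.
pose eta := 1 / 4 / (1 + K * KB).
have eta0 : 0 < eta by apply: divr_gt0 => //; lra.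
have etaK : eta * (1 + K * KB) <= 1 / 4 by rewrite /eta mulfVK // gt_eqF.
have ka01' : 0 <= ka < 1 by lra.
have eta2 : 0 < eta / 2 by lra.
have [m1 Hm1] := expr_eventually_lt _ (K * C1 + K * K * K) _ ka01' eta2.
have half0 : 0 < 1 / 2 :> R by lra.
have [m2 Hm2] := expr_eventually_lt _ K _ ka01' half0.
(* [m1] serves the contraction on the kernel of [nu] in [N], [m2] the halving by [A^M]; the
   successor makes [M] positive. *)
pose m := (m1 + m2).+1.
have {}Hm1 := Hm1 m (leq_trans (leq_addr _ _) (leqnSn _)).
have {}Hm2 := Hm2 m (leq_trans (leq_addl _ _) (leqnSn _)).
pose M := (m + m)%N; have M0 : (0 < M)%N by [].
set th : R := 1 - (4 * M%:R)^-1.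
have th01 : 0 < th < 1.
  have M1 : 1 <= M%:R :> R by rewrite ler1n.
  have i0 : 0 < (4 * M%:R : R)^-1 by rewrite invr_gt0; lra.
  have : (4 * M%:R : R)^-1 <= 1 / 4.
    by rewrite div1r lef_pV2 ?posrE; lra.
  by rewrite /th; lra.
have dM0 : 0 <= drift M * KB by apply: mulr_ge0 => //; exact: drift_ge0.
have dm0 : 0 <= K * drift m by apply: mulr_ge0 => //; exact: drift_ge0.
have C20 : 0 <= C2 M.
  apply: mulr_ge0 => //; apply: mulr_ge0; last exact: drift_ge0.
  by apply: divr_ge0 => //; lra.
have D10 : 0 <= D1 by apply: addr_ge0; apply: mulr_ge0 => //; lra.
have n20 : 0 <= N2 one by exact: N2n.1.
have E0 : 0 <= drift M * (2 * N2 one + 2) * (4 * D1 + N one).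
  by apply: mulr_ge0; [apply: mulr_ge0; [exact: drift_ge0|lra]|lra].
have E1 : 0 <= 2 * C2 M * (N2 one + 1).
  by apply: mulr_ge0; [apply: mulr_ge0|lra].
have E2 : 0 <= D2 M by rewrite /D2; lra.
have E4 : 0 <= 8 * (drift M * D1) / (1 - th).
  apply: divr_ge0; last lra.
  by apply: mulr_ge0 => //; apply: mulr_ge0 => //; exact: drift_ge0.
pose tot := drift M * KB + K * drift m + C2 M + 1.
pose e0 := Num.min (eta / 2) ((1 - th) / 2).
have e00 : 0 < e0 by rewrite lt_min; apply/andP; split; lra.
have e1 : e0 <= eta / 2 by rewrite ge_min lexx.
have e2 : e0 <= (1 - th) / 2 by rewrite ge_min lexx orbT.
have tot0 : 0 < tot by rewrite /tot; lra.
exists (Kfin M), (e0 / tot), th; split; first exact: divr_gt0.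
split => //; split.
  by rewrite /Kfin -/th; lra.
move=> B tau /andP[t0 td] hB.
have tot_tau : tot * tau <= e0 by rewrite mulrC -ler_pdivlMr // ltW.
have le_e0 c : 0 <= c -> c <= tot -> c * tau <= e0.
  by move=> c0' ct; apply: le_trans tot_tau; rewrite ler_wpM2r.
have b1 : K * drift m * tau <= e0 by apply: le_e0 => //; rewrite /tot; lra.
have b2 : drift M * tau * KB <= e0.
  by rewrite mulrAC; apply: le_e0 => //; rewrite /tot; lra.
have b3 : C2 M * tau <= e0 by apply: le_e0 => //; rewrite /tot; lra.
have hker g : S g -> nu g = 0 -> N (iter M B g) <= eta * N g.
  move=> Sg g0; apply: le_trans (contraction_ker B tau hB t0 m g Sg g0) _.
  by apply: ler_wpM2r; [exact: Nn.1|lra].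
have hkM : K * ka ^+ M <= 1 / 2.
  apply: le_trans (ltW Hm2); rewrite ler_wpM2l //.
  by apply: ler_wiXn2l; [lra|lra|rewrite /M leq_addr].
have hd : drift M * tau * KB <= 1 / 2 by lra.
have [h [Sh [Nh [h1 Bh]]]] := eigen_ex B tau hB t0 M eta M0 (ltW eta0) etaK hker hd.
have h2 : C2 M * tau <= 1 / 2 by lra.
have h3 : drift M * tau * KB <= (1 - th) / 2 by lra.
exact: (eigen_decomposition B tau hB t0 M eta M0 etaK hker hkM hd h2 h3 h Sh Nh h1 Bh).
Qed.

End Perturbation.

(** * Martingale approximation *)

Section MartingaleOperator.
Context {R : realType} {d : measure_display} {E : measurableType d}.
Context (Q : R.-pker E ~> E) (nu : probability E R).
Hypothesis nu_inv : forall A, measurable A -> nu A = (\int[nu]_x Q x A)%E.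
Implicit Types (F H : E -> R[i]).

(* The kernel integral of [Z x] may be junk for [x] in a [nu]-null set. *)
Lemma eL1_kernel_bound (V : E -> R[i]) (Z : E -> E -> R[i]) (f1 f2 : E -> R) :
  cmeas V -> (forall x, cmeas (Z x)) ->
  measurable_fun setT f1 -> measurable_fun setT f2 ->
  (forall y, 0 <= f1 y) -> (forall x, 0 <= f2 x) ->
  (forall x y, cabs (Z x y) <= f1 y + f2 x) ->
  {ae nu, forall x, V x = cint (Q x) (Z x)} ->
  (eL1 nu V <= \int[nu]_x (f1 x)%:E + \int[nu]_x (f2 x)%:E)%E.
Proof.
move=> mV mZ mf1 mf2 f10 f20 Zf VZ.
have Ef1 : measurable_fun setT (EFin \o f1) by exact/measurable_EFinP.
have Ef2 : measurable_fun setT (EFin \o f2) by exact/measurable_EFinP.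
have g1 : (forall y, 0 <= (EFin \o f1) y)%E by move=> y; rewrite lee_fin.
have mQ : measurable_fun setT (fun x => \int[Q x]_y (f1 y)%:E)%E.
  exact: measurable_kernel_integral g1 Ef1.
have Q0 x : (0 <= \int[Q x]_y (f1 y)%:E)%E by apply: integral_ge0 => y _; exact: g1.
rewrite (integral_invariant _ _ nu_inv _ g1 Ef1) -ge0_integralD //; last first.
  by move=> x _; rewrite lee_fin.
apply: ae_ge0_le_integral => //.
- by move=> x _; rewrite lee_fin cabs_ge0.
- exact: measurable_ecabs.
- by move=> x _; rewrite adde_ge0 // lee_fin.
- exact: emeasurable_funD.
apply: filterS VZ => x -> _; apply: le_trans (le_cabs_cint _ _ (mZ x)) _.
rewrite (_ : (f2 x)%:E = \int[Q x]_y (cst (f2 x)%:E) y)%E; last first.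
  by rewrite integral_cst // prob_kernel mule1.
rewrite -ge0_integralD //; last by move=> y _; rewrite lee_fin.
apply: ge0_le_integral => //.
- by move=> y _; rewrite lee_fin cabs_ge0.
- exact: measurable_ecabs.
- by apply: emeasurable_funD => //; exact: measurable_cst.
- by move=> y _; rewrite lee_fin.
Qed.

Variables (G w : E -> R) (t : R).
Hypothesis mG : measurable_fun setT G.
Hypothesis mw : measurable_fun setT w.

(* Transition operator twisted by the martingale increment [G y - w x]. *)
Definition Qh F : E -> R[i] :=
  fun x => expi (- (t * w x)) * Qop Q (fun y => expi (t * G y) * F y) x.

Let mtG : measurable_fun setT (fun y => t * G y).
Proof. by apply: measurable_funM => //; exact: measurable_cst. Qed.
Let mtw : measurable_fun setT (fun y => - (t * w y)).
Proof. by apply: measurableT_comp => //; apply: measurable_funM => //; exact: measurable_cst. Qed.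

Lemma cmeas_Qh F : cmeas F -> cmeas (Qh F).
Proof.
move=> mF; apply: cmeasM; first exact: cmeas_expi.
by apply: cmeas_Qop; apply: cmeasM => //; exact: cmeas_expi.
Qed.

Lemma cmeas_iter_Qh n F : cmeas F -> cmeas (iter n Qh F).
Proof. by move=> mF; elim: n => //= n; exact: cmeas_Qh. Qed.

Lemma cintegrable_expiM mu (h : E -> R) F : measurable_fun setT h -> cmeas F ->
  cintegrable mu F -> cintegrable mu (fun y => expi (h y) * F y).
Proof.
move=> mh mF iF; apply/cintegrableP.
  by apply: cmeasM => //; exact: cmeas_expi.
rewrite /eL1; under eq_integral do rewrite cabsM cabs_expi mul1r.
exact/cintegrableP.
Qed.

(** Contraction of [Qh] in [L^1(nu)]. The kernel integral is additive only where all integrands are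
    integrable, that is [nu]-almost everywhere, so the linear combination is part of the statement;
    three terms are what the expansion of [Qh 1] into [1] and [psi] calls for. *)
Lemma eL1_Qh_comb (a b : R[i]) F F1 F2 : cmeas F -> cmeas F1 -> cmeas F2 ->
  (eL1 nu F < +oo)%E -> (eL1 nu F1 < +oo)%E -> (eL1 nu F2 < +oo)%E ->
  (eL1 nu (fun x => Qh F x - a * Qh F1 x - b * Qh F2 x)%R <=
   eL1 nu (fun x => F x - a * F1 x - b * F2 x)%R)%E.
Proof.
move=> mF mF1 mF2 oF oF1 oF2.
have mc F3 c : cmeas F3 -> cmeas (fun x => c * F3 x).
  by move=> m3; apply: cmeasM => //; exact: cmeas_cst.
have mD : cmeas (fun x => F x - a * F1 x - b * F2 x).
  by apply: cmeasB; [apply: cmeasB => //|]; exact: mc.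
apply: le_trans (eL1_kernel_bound _ (fun x y => expi (- (t * w x)) *
    (expi (t * G y) * (F y - a * F1 y - b * F2 y)))
    (fun y => cabs (F y - a * F1 y - b * F2 y)) (fun=> 0) _ _ _ _ _ _ _ _) _.
- by apply: cmeasB; [apply: cmeasB => //|]; try apply: mc; exact: cmeas_Qh.
- move=> x; apply: mc; apply: cmeasM => //; exact: cmeas_expi.
- exact: measurable_cabs.
- exact: measurable_cst.
- by move=> y; rewrite cabs_ge0.
- by [].
- by move=> x y; rewrite !cabsM !cabs_expi !mul1r addr0.
- have := ae_cintegrable _ _ nu_inv _ mF oF; have := ae_cintegrable _ _ nu_inv _ mF1 oF1.
  have := ae_cintegrable _ _ nu_inv _ mF2 oF2.
  apply: filterS3 => x i2 i1 i0.
  have j0 := cintegrable_expiM _ _ _ mtG mF i0.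
  have j1 := cintegrable_expiM _ _ _ mtG mF1 i1.
  have j2 := cintegrable_expiM _ _ _ mtG mF2 i2.
  have m1 : cmeas (fun y => expi (t * G y) * F1 y) by apply: cmeasM => //; exact: cmeas_expi.
  have m2 : cmeas (fun y => expi (t * G y) * F2 y) by apply: cmeasM => //; exact: cmeas_expi.
  have k1 := cintegrableZ _ a _ m1 j1; have k2 := cintegrableZ _ b _ m2 j2.
  have j01 := cintegrableB _ _ _ j0 k1.
  have j012 := cintegrableB _ _ _ j01 k2.
  rewrite (_ : (fun y => _) = (fun y => expi (- (t * w x)) *
     (expi (t * G y) * F y - a * (expi (t * G y) * F1 y) - b * (expi (t * G y) * F2 y)))); last first.
    by apply/funext => y; ring.
  rewrite cintZ // cintB // cintB // cintZ // cintZ //.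
  by rewrite /Qh /Qop; ring.
by rewrite integral0 adde0.
Qed.

Local Notation zf := (fun _ : E => 0 : R[i]).

Lemma cmeas0 : cmeas zf. Proof. exact: cmeas_cst. Qed.

Lemma eL1_0 mu : eL1 mu zf = 0%E.
Proof. by rewrite /eL1; under eq_integral do rewrite cabs0; rewrite integral0. Qed.

Lemma eL1_Qh_lty F : cmeas F -> (eL1 nu F < +oo)%E -> (eL1 nu (Qh F) < +oo)%E.
Proof.
move=> mF oF; have o0 : (eL1 nu zf < +oo)%E by rewrite eL1_0.
have := eL1_Qh_comb 0 0 F _ _ mF cmeas0 cmeas0 oF o0 o0.
under eq_fun do rewrite !mul0r !subr0.
under [X in (_ <= eL1 _ X)%E]eq_fun do rewrite !mul0r !subr0.
by move=> /le_lt_trans; apply.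
Qed.

Lemma eL1_iter_Qh_lty n F : cmeas F -> (eL1 nu F < +oo)%E ->
  (eL1 nu (iter n Qh F) < +oo)%E.
Proof.
by move=> mF oF; elim: n => //= n; apply: eL1_Qh_lty; exact: cmeas_iter_Qh.
Qed.

Lemma eL1_iter_Qh_comb n (a b : R[i]) F F1 F2 : cmeas F -> cmeas F1 -> cmeas F2 ->
  (eL1 nu F < +oo)%E -> (eL1 nu F1 < +oo)%E -> (eL1 nu F2 < +oo)%E ->
  (eL1 nu (fun x => iter n Qh F x - a * iter n Qh F1 x - b * iter n Qh F2 x)%R <=
   eL1 nu (fun x => F x - a * F1 x - b * F2 x)%R)%E.
Proof.
move=> mF mF1 mF2 oF oF1 oF2; elim: n => // n; apply: le_trans.
by apply: eL1_Qh_comb; try exact: cmeas_iter_Qh; exact: eL1_iter_Qh_lty.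
Qed.

Lemma eL1_iter_QhB n F F1 : cmeas F -> cmeas F1 ->
  (eL1 nu F < +oo)%E -> (eL1 nu F1 < +oo)%E ->
  (eL1 nu (fun x => iter n Qh F x - iter n Qh F1 x)%R <=
   eL1 nu (fun x => F x - F1 x)%R)%E.
Proof.
move=> mF mF1 oF oF1; have o0 : (eL1 nu zf < +oo)%E by rewrite eL1_0.
have := eL1_iter_Qh_comb n 1 0 F F1 _ mF mF1 cmeas0 oF oF1 o0.
under eq_fun do rewrite mul1r mul0r subr0.
by under [X in (_ <= eL1 _ X)%E]eq_fun do rewrite mul1r mul0r subr0.
Qed.

(** Since [xi] is [G - w], [Q(t)] is conjugate to [Qh] by multiplication by [expi (t * w x)], and
    inside a power the conjugating factors cancel. *)
Lemma iter_Qt_Qh (xi : E -> R) n : (forall x, xi x = G x - w x) ->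
  iter n (Qt Q xi t) cst1 =
  (fun x => expi (t * w x) * iter n Qh (fun y => expi (- (t * w y))) x).
Proof.
move=> xiE; elim: n => [|n IH].
  by apply/funext => x; rewrite /= mulrC expiNM.
apply/funext => x; rewrite /= IH /Qt /Qh mulrA [expi (t * w x) * _]mulrC expiNM mul1r.
congr (Qop Q _ x); apply/funext => y.
by rewrite mulrA -expiD xiE mulrBr subrK.
Qed.

Lemma le_integral_comb (mu : {measure set E -> \bar R}) (f g : E -> R) (c1 c2 a b : R) :
  measurable_fun setT f -> measurable_fun setT g ->
  (forall x, 0 <= f x) -> (forall x, 0 <= g x) -> 0 <= c1 -> 0 <= c2 ->
  (\int[mu]_x (f x)%:E <= a%:E)%E -> (\int[mu]_x (g x)%:E <= b%:E)%E ->
  (\int[mu]_x (c1 * f x + c2 * g x)%:E <= (c1 * a + c2 * b)%:E)%E.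
Proof.
move=> mf mg f0 g0 c10 c20 fa gb.
have Ef : measurable_fun setT (EFin \o f) by exact/measurable_EFinP.
have Eg : measurable_fun setT (EFin \o g) by exact/measurable_EFinP.
under eq_integral do rewrite EFinD !EFinM.
rewrite ge0_integralD //; last 4 first.
- by move=> x _; rewrite mule_ge0 ?lee_fin.
- exact: measurable_funeM.
- by move=> x _; rewrite mule_ge0 ?lee_fin.
- exact: measurable_funeM.
rewrite !ge0_integralZl //; try (by move=> x _; rewrite lee_fin).
by rewrite EFinD !EFinM leeD // lee_wpmul2l ?lee_fin.
Qed.

Variables (cG cw : R).
Hypothesis hcG : (\int[nu]_x (`|G x| ^+ 3)%:E <= cG%:E)%E.
Hypothesis hcw : (\int[nu]_x (`|w x| ^+ 3)%:E <= cw%:E)%E.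

Let mG3 : measurable_fun setT (fun x => `|G x| ^+ 3).
Proof. by apply: measurable_funX; exact: measurableT_comp. Qed.
Let mw3 : measurable_fun setT (fun x => `|w x| ^+ 3).
Proof. by apply: measurable_funX; exact: measurableT_comp. Qed.

Lemma young_three_halves (a b : R) : 0 <= a -> 0 <= b ->
  a * b <= a ^+ 3 / 3 + 2 / 3 * powR b (3 / 2).
Proof.
move=> a0 b0; have h : (3 : R)^-1 + (3 / 2)^-1 = 1 by field.
have p3 : 0 < 3 :> R by lra.
have p32 : 0 < 3 / 2 :> R by lra.
have := conjugate_powR a0 b0 p3 p32 h.
rewrite powR_mulrn // => /le_trans; apply.
by rewrite lerD2l mulrC ler_wpM2r ?powR_ge0 // invf_div.
Qed.

(** Outcome of two uses of Young's inequality with exponents 3 and 3/2, one for [G] and one for [w],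
    each contributing 2/3. *)
Definition Kc : R := (cG + cw) / 3 + 4 / 3.

(** The twist differs from 1 by at most [|t| (|G y| + |w x|)], and the third moments of [G] and [w]
    are paired with the [3/2]-norm of [F], bounded by [m]. *)
Lemma eL1_Qh_sub m F : 0 < m -> cmeas F -> (eL1 nu F < +oo)%E ->
  (\int[nu]_x (powR (cabs (F x)) (3 / 2))%:E <= (powR m (3 / 2))%:E)%E ->
  (eL1 nu (fun x => Qh F x - Qop Q F x)%R <= (`|t| * (m * Kc))%:E)%E.
Proof.
move=> m0 mF oF Fm; set pm := powR m (3 / 2).
have pm0 : 0 < pm by exact: powR_gt0.
have pmK (a c : R) : a / pm * (pm * c) = a * c by rewrite mulrA divfK ?gt_eqF.
have mpw : measurable_fun setT (fun x => powR (cabs (F x)) (3 / 2)).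
  by apply: (@measurableT_comp _ _ _ _ _ _ (fun x : R => powR x (3 / 2))); [exact: measurable_powR|exact: measurable_cabs].
have tm0 : 0 <= `|t| * m by rewrite mulr_ge0 // ltW.
apply: le_trans (eL1_kernel_bound _ (fun x y =>
    expi (- (t * w x)) * (expi (t * G y) * F y) - F y)
  (fun y => `|t| * m / 3 * `|G y| ^+ 3 + `|t| * m * (4 / 3) / pm * powR (cabs (F y)) (3 / 2))
  (* The null summand only gives the bound the two-term shape expected by [le_integral_comb]. *)
  (fun x => `|t| * m / 3 * `|w x| ^+ 3 + 0 * `|w x| ^+ 3) _ _ _ _ _ _ _ _) _.
- by apply: cmeasB; [exact: cmeas_Qh|exact: cmeas_Qop].
- move=> x; apply: cmeasB => //; apply: cmeasM; first exact: cmeas_cst.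
  by apply: cmeasM => //; exact: cmeas_expi.
- by apply: measurable_funD; apply: measurable_funM => //; exact: measurable_cst.
- by apply: measurable_funD; apply: measurable_funM => //; exact: measurable_cst.
- move=> y; apply: addr_ge0; apply: mulr_ge0; rewrite ?powR_ge0 ?exprn_ge0 //.
  + by rewrite divr_ge0.
  + by rewrite divr_ge0 ?(ltW pm0) // mulr_ge0 //; lra.
- by move=> x; rewrite mul0r addr0 mulr_ge0 ?exprn_ge0 // divr_ge0.
- move=> x y; rewrite mul0r addr0.
  rewrite (_ : _ - F y = (expi (t * (G y - w x)) - 1) * F y); last first.
    by rewrite mulrBr addrC expiD; ring.
  rewrite cabsM; apply: (@le_trans _ _ (`|t| * (`|G y| + `|w x|) * cabs (F y))).
    rewrite ler_wpM2r ?cabs_ge0 //; apply: le_trans (cabs_expiB1 _) _.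
    by rewrite normrM ler_wpM2l // ler_normB.
  (* Young's inequality is applied to the normalised [F / m], which makes the final bound linear in
     [m]. *)
  set b := cabs (F y) / m.
  have b0 : 0 <= b by rewrite divr_ge0 ?cabs_ge0 // ltW.
  have -> : cabs (F y) = m * b by rewrite /b mulrC divfK // gt_eqF.
  have -> : powR (m * b) (3 / 2) = pm * powR b (3 / 2) by rewrite powRM // ltW.
  have y1 := young_three_halves `|G y| b (normr_ge0 _) b0.
  have y2 := young_three_halves `|w x| b (normr_ge0 _) b0.
  rewrite pmK.
  have : 0 <= `|t| * m * (`|G y| ^+ 3 / 3 + 2 / 3 * powR b (3 / 2) - `|G y| * b).
    by rewrite mulr_ge0 // subr_ge0.
  have : 0 <= `|t| * m * (`|w x| ^+ 3 / 3 + 2 / 3 * powR b (3 / 2) - `|w x| * b).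
    by rewrite mulr_ge0 // subr_ge0.
  by lra.
- have := ae_cintegrable _ _ nu_inv _ mF oF; apply: filterS => x iF.
  have mE : cmeas (fun y => expi (t * G y) * F y).
    by apply: cmeasM => //; exact: cmeas_expi.
  have j0 := cintegrable_expiM _ _ _ mtG mF iF.
  by rewrite cintB ?cintZ //; exact: cintegrableZ.
have n1 : 0 <= `|t| * m / 3 by rewrite divr_ge0.
have n2 : 0 <= `|t| * m * (4 / 3) / pm.
  by rewrite divr_ge0 ?(ltW pm0) // mulr_ge0 //; lra.
have e3 (h : E -> R) x : 0 <= `|h x| ^+ 3 by exact: exprn_ge0.
have h1 := le_integral_comb nu _ _ _ _ _ _ mG3 mpw (e3 G)
  (fun x => powR_ge0 _ _) n1 n2 hcG Fm.
have h2 := le_integral_comb nu _ _ _ _ _ _ mw3 mw3 (e3 w) (e3 w) n1 (lexx 0) hcw hcw.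
apply: le_trans (leeD h1 h2) _; rewrite -EFinD lee_fin -/pm.
rewrite divfK ?gt_eqF // /Kc; lra.
Qed.

(** Hölder's inequality against the constant 1 under a probability, again through Young's inequality
    for [F / m]. *)
Lemma eL1_le_three_halves m F : 0 < m -> cmeas F ->
  (\int[nu]_x (powR (cabs (F x)) (3 / 2))%:E <= (powR m (3 / 2))%:E)%E ->
  (eL1 nu F <= m%:E)%E.
Proof.
move=> m0 mF Fm; set pm := powR m (3 / 2).
have pm0 : 0 < pm by exact: powR_gt0.
have pmK (a c : R) : a / pm * (pm * c) = a * c by rewrite mulrA divfK ?gt_eqF.
have mpw : measurable_fun setT (fun x => powR (cabs (F x)) (3 / 2)).
  by apply: (@measurableT_comp _ _ _ _ _ _ (fun x : R => powR x (3 / 2))); [exact: measurable_powR|exact: measurable_cabs].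
have n1 : 0 <= m / 3 by rewrite divr_ge0 // ltW.
have n2 : 0 <= m * (2 / 3) / pm by rewrite divr_ge0 ?(ltW pm0) // mulr_ge0 ?(ltW m0) //; lra.
have i1 : (\int[nu]_x (cst 1 x)%:E <= 1%:E)%E.
  by rewrite /= integral_cst // mul1e; exact: probability_le1.
have m1 : measurable_fun setT (cst (1 : R) : E -> R) by exact: measurable_cst.
have h := le_integral_comb nu _ _ _ _ _ _ m1 mpw (fun=> ler01)
  (fun x => powR_ge0 _ _) n1 n2 i1 Fm.
have -> : m = m / 3 * 1 + m * (2 / 3) / pm * pm.
  by rewrite divfK ?gt_eqF //; lra.
apply: le_trans h; apply: ge0_le_integral => //.
- by move=> x _; rewrite lee_fin cabs_ge0.
- exact: measurable_ecabs.
- apply/measurable_EFinP; apply: measurable_funD; apply: measurable_funM => //;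
  exact: measurable_cst.
move=> x _; rewrite lee_fin.
set b := cabs (F x) / m.
have b0 : 0 <= b by rewrite divr_ge0 ?cabs_ge0 // ltW.
have -> : cabs (F x) = m * b by rewrite /b mulrC divfK // gt_eqF.
have -> : powR (m * b) (3 / 2) = pm * powR b (3 / 2) by rewrite powRM // ltW.
have := young_three_halves 1 b ler01 b0; rewrite expr1n mul1r => y1.
rewrite pmK.
have : 0 <= m * (1 / 3 + 2 / 3 * powR b (3 / 2) - b) by rewrite mulr_ge0 ?subr_ge0 // ltW.
by rewrite /cst; lra.
Qed.

Hypothesis wE : forall x, w x = Rintegral (Q x) setT G.
Hypothesis iG : forall x, (Q x).-integrable setT (EFin \o G).
Variables (psi : E -> R) (s2 : R).
Hypothesis psiE : forall x,
  psi x = Rintegral (Q x) setT (fun y => G y ^+ 2) - w x ^+ 2 - s2.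

Local Notation rho := (1 - s2 * t ^+ 2 / 2).

Lemma measurable_psi : measurable_fun setT psi.
Proof.
rewrite (_ : psi = fun x => Rintegral (Q x) setT (fun y => G y ^+ 2) - w x ^+ 2 - s2).
  apply: measurable_funB; last exact: measurable_cst.
  apply: measurable_funB; last exact: measurable_funX.
  by apply: measurable_kernel_Rintegral; exact: measurable_funX.
by apply/funext.
Qed.

Let EG3 : measurable_fun setT (fun y => (`|G y| ^+ 3)%:E).
Proof. exact/measurable_EFinP. Qed.

(** Pointwise [G ^+ 2 <= 1 + |G| ^+ 3], and invariance of [nu] passes the third moment on to almost
    every [Q x]. *)
Lemma ae_integrable_sqr : {ae nu, forall x, (Q x).-integrable setT (fun y => (G y ^+ 2)%:E)}.
Proof.
have G30 y : (0 <= (`|G y| ^+ 3)%:E)%E by rewrite lee_fin exprn_ge0.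
have := ae_lty_Q _ _ nu_inv _ G30 EG3 (le_lt_trans hcG (ltry _)).
apply: filterS => x hx.
have h1 : (\int[Q x]_y (cst 1%:E y + (`|G y| ^+ 3)%:E) < +oo)%E.
  rewrite ge0_integralD //.
  apply: lte_add_pinfty => //.
  by rewrite integral_cst // mul1e prob_kernel ltry.
apply/integrableP; split.
  by apply/measurable_EFinP; exact: measurable_funX.
apply: le_lt_trans h1; apply: ge0_le_integral => //.
- by apply: measurableT_comp => //; apply/measurable_EFinP; exact: measurable_funX.
- by apply: emeasurable_funD => //; exact: measurable_cst.
move=> y _; rewrite /= lee_fin normrX.
have [h2|h2] := leP `|G y| 1.
  by rewrite -[leLHS]addr0 lerD ?exprn_ge0 // exprn_ile1.
by rewrite -[leLHS]add0r lerD // ler_weXn2l // ltW.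
Qed.

(** [G] has mean [w x] under [Q x], so the linear term of the expansion in [t (G y - w x)]
    integrates to 0, and the quadratic one yields [s2 + psi x]. The factor 4 comes from
    [(a + b)^3 <= 4 (a^3 + b^3)] for nonnegative [a] and [b]. *)
Lemma eL1_Qh_taylor :
  (eL1 nu (fun x => Qh cst1 x - rho%:C%C * cst1 x + (t ^+ 2 / 2)%:C%C * (psi x)%:C%C)%R
   <= (`|t| ^+ 3 * (4 * (cG + cw)))%:E)%E.
Proof.
have mc (c : R[i]) H : cmeas H -> cmeas (fun x => c * H x).
  by move=> mH; apply: cmeasM => //; exact: cmeas_cst.
pose c0 x : R[i] := expi (- (t * w x)).
(* [c1], [c2], [c3] are the coefficients of [1], [G y] and [G y ^+ 2] in [- 1 - i D + D^2 / 2] with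
   [D = t (G y - w x)]. *)
pose c1 x : R[i] := -1 + Complex 0 (t * w x) + (t ^+ 2 * w x ^+ 2 / 2)%:C%C.
pose c2 x : R[i] := Complex (- (t ^+ 2 * w x)) (- t).
pose c3 : R[i] := (t ^+ 2 / 2)%:C%C.
have cG1 : cmeas (fun y => (G y)%:C%C) by exact: cmeas_real.
have cG2 : cmeas (fun y => (G y ^+ 2)%:C%C) by apply: cmeas_real; exact: measurable_funX.
have c11 : cmeas (cst1 : E -> R[i]) by exact: cmeas_cst.
apply: le_trans (eL1_kernel_bound _ (fun x y =>
    c0 x * (expi (t * G y) * cst1 y) + (c1 x * cst1 y + (c2 x * (G y)%:C%C + c3 * (G y ^+ 2)%:C%C)))
  (fun y => `|t| ^+ 3 * 4 * `|G y| ^+ 3 + 0 * `|G y| ^+ 3)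
  (fun x => `|t| ^+ 3 * 4 * `|w x| ^+ 3 + 0 * `|w x| ^+ 3) _ _ _ _ _ _ _ _) _.
- apply: cmeasD; last by apply: mc; apply: cmeas_real; exact: measurable_psi.
  by apply: cmeasB; [exact: cmeas_Qh|exact: mc].
- move=> x; apply: cmeasD; first by apply: mc; apply: cmeasM => //; exact: cmeas_expi.
  by apply: cmeasD; [exact: mc|apply: cmeasD; exact: mc].
- by apply: measurable_funD; apply: measurable_funM => //; exact: measurable_cst.
- by apply: measurable_funD; apply: measurable_funM => //; exact: measurable_cst.
- by move=> y; rewrite mul0r addr0 !mulr_ge0 ?exprn_ge0.
- by move=> x; rewrite mul0r addr0 !mulr_ge0 ?exprn_ge0.
- move=> x y; rewrite !mul0r !addr0; set D := t * (G y - w x).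
  rewrite (_ : c0 x * _ + _ = expi D - 1 - Complex 0 D + (D ^+ 2 / 2)%:C%C).
    apply: le_trans (expi_taylor2 D) _.
    have main : `|G y - w x| ^+ 3 <= 4 * (`|G y| ^+ 3 + `|w x| ^+ 3).
      apply: (@le_trans _ _ ((`|G y| + `|w x|) ^+ 3)).
        by apply: lerXn2r; rewrite ?nnegrE ?addr_ge0 // ler_normB.
      have : 0 <= 3 * (`|G y| + `|w x|) * (`|G y| - `|w x|) ^+ 2.
        by rewrite mulr_ge0 ?sqr_ge0 // mulr_ge0 // addr_ge0.
      by lra.
    have := ler_wpM2l (exprn_ge0 3 (normr_ge0 t)) main.
    by rewrite /D normrM exprMn; lra.
  rewrite /c0 (_ : expi D = expi (- (t * w x)) * expi (t * G y)); last first.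
    by rewrite -expiD; congr expi; rewrite /D; ring.
  rewrite /c1 /c2 /c3 /cst1 /D !mulr1; set e := expi (t * G y); set e' := expi _.
  by apply: complex_ext; rewrite ?cReD ?cImD ?cReM ?cImM /=; field.
- have := ae_integrable_sqr; apply: filterS => x iG2.
  have j11 : cintegrable (Q x) cst1.
    by apply/(cintegrableP _ _ c11); rewrite /eL1 /cst1; under eq_integral do rewrite cabs1;
      rewrite integral_cst // prob_kernel mule1 ltry.
  have jG : cintegrable (Q x) (fun y => (G y)%:C%C).
    by split => /=; [exact: iG|exact: integrable0].
  have jG2 : cintegrable (Q x) (fun y => (G y ^+ 2)%:C%C).
    by split => /=; [exact: iG2|exact: integrable0].
  have je := cintegrable_expiM _ _ _ mtG c11 j11.
  have me : cmeas (fun y => expi (t * G y) * cst1 y) by apply: cmeasM => //; exact: cmeas_expi.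
  have k0 := cintegrableZ _ (c0 x) _ me je.
  have k1 := cintegrableZ _ (c1 x) _ c11 j11.
  have k2 := cintegrableZ _ (c2 x) _ cG1 jG.
  have k3 := cintegrableZ _ c3 _ cG2 jG2.
  have k23 := cintegrableD _ _ _ k2 k3.
  have k123 := cintegrableD _ _ _ k1 k23.
  rewrite !cintD // !cintZ // !cint_real -wE -/(c0 x).
  rewrite Rintegral_cst // prob_kernel mulr1.
  rewrite psiE /Qh /Qop -/(c0 x) /c1 /c2 /c3 /cst1.
  set u := Rintegral _ _ _; set v := c0 x * _.
  by apply: complex_ext; rewrite ?cReD ?cImD ?cReN ?cImN ?cReD ?cImD ?cReM ?cImM /=; field.
have t3 : 0 <= `|t| ^+ 3 * 4 by rewrite mulr_ge0 // exprn_ge0.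
have e3 (h : E -> R) x : 0 <= `|h x| ^+ 3 by exact: exprn_ge0.
have h1 := le_integral_comb nu _ _ _ _ _ _ mG3 mG3 (e3 G) (e3 G) t3 (lexx 0) hcG hcG.
have h2 := le_integral_comb nu _ _ _ _ _ _ mw3 mw3 (e3 w) (e3 w) t3 (lexx 0) hcw hcw.
apply: le_trans (leeD h1 h2) _; rewrite -EFinD lee_fin; lra.
Qed.

End MartingaleOperator.

(** * Characteristic function under [nu] up to times of order [t^-2] *)

Section MartingaleEstimate.
Context {R : realType} {d : measure_display} {E : measurableType d}.
Context (Q : R.-pker E ~> E) (nu : probability E R).
Hypothesis nu_inv : forall A, measurable A -> nu A = (\int[nu]_x Q x A)%E.
Variables (xi G w : E -> R).
Hypothesis mG : measurable_fun setT G.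
Hypothesis mw : measurable_fun setT w.
Variables (cG cw : R).
Hypothesis hcG : (\int[nu]_x (`|G x| ^+ 3)%:E <= cG%:E)%E.
Hypothesis hcw : (\int[nu]_x (`|w x| ^+ 3)%:E <= cw%:E)%E.
Hypothesis wE : forall x, w x = Rintegral (Q x) setT G.
Hypothesis iG : forall x, (Q x).-integrable setT (EFin \o G).
Hypothesis xiE : forall x, xi x = G x - w x.
Variables (psi : E -> R) (s2 : R).
Hypothesis psiE : forall x,
  psi x = Rintegral (Q x) setT (fun y => G y ^+ 2) - w x ^+ 2 - s2.
Hypothesis s20 : 0 <= s2.
(** [m k] dominates the [L^{3/2}(nu)] norm of [Q^k psi]; positivity permits the normalisation by
    [m k], and [Bm] expresses (H2). *)
Variables (m : nat -> R) (Bm : R).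
Hypothesis m0 : forall k, 0 < m k.
Hypothesis hm : forall k,
  (\int[nu]_x (powR `|iter k (Qr Q) psi x| (3 / 2))%:E <= (powR (m k) (3 / 2))%:E)%E.
Hypothesis hBm : forall n, \sum_(k < n) m k <= Bm.

Let fk k : E -> R[i] := fun x => (iter k (Qr Q) psi x)%:C%C.

Let mfk k : cmeas (fk k).
Proof.
apply: cmeas_real; elim: k => [|k IH] /=; last exact: measurable_kernel_Rintegral.
exact: measurable_psi mG mw _ _ psiE.
Qed.

Let hfk k : (\int[nu]_x (powR (cabs (fk k x)) (3 / 2))%:E <= (powR (m k) (3 / 2))%:E)%E.
Proof. by under eq_integral do rewrite /fk cabs_real; exact: hm. Qed.

Let Qfk k : Qop Q (fk k) = fk k.+1.
Proof. by apply/funext => x; rewrite /Qop cint_real. Qed.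

Let eL1_fk k : (eL1 nu (fk k) <= (m k)%:E)%E.
Proof. by apply: eL1_le_three_halves. Qed.

Let fk_lty k : (eL1 nu (fk k) < +oo)%E.
Proof. exact: le_lt_trans (eL1_fk k) (ltry _). Qed.

Let cG0 : 0 <= cG.
Proof.
by rewrite -lee_fin; apply: le_trans hcG; apply: integral_ge0 => x _; rewrite lee_fin exprn_ge0.
Qed.
Let cw0 : 0 <= cw.
Proof.
by rewrite -lee_fin; apply: le_trans hcw; apply: integral_ge0 => x _; rewrite lee_fin exprn_ge0.
Qed.
Let Kc0 : 0 <= Kc cG cw.
Proof. by have h1 := cG0; have h2 := cw0; rewrite /Kc; lra. Qed.
Let Bm0 : 0 <= Bm.
Proof. by have := hBm 0; rewrite big_ord0. Qed.

Section FixedT.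
Variable t : R.
Local Notation rho := (1 - s2 * t ^+ 2 / 2).
Local Notation Qh := (Qh Q G w t).
Hypothesis t1 : `|t| <= 1.
Hypothesis ts2 : s2 * t ^+ 2 / 2 <= 1.

Let mit n F : cmeas F -> cmeas (iter n Qh F).
Proof. exact: cmeas_iter_Qh. Qed.

Let mc (c : R[i]) (H : E -> R[i]) : cmeas H -> cmeas (fun x => c * H x).
Proof. by move=> mH; apply: cmeasM => //; exact: cmeas_cst. Qed.

Let c11 : cmeas (cst1 : E -> R[i]). Proof. exact: cmeas_cst. Qed.

Let o11 : (eL1 nu cst1 < +oo)%E.
Proof.
rewrite /eL1 /cst1; under eq_integral do rewrite cabs1.
by rewrite integral_cst // mul1e (le_lt_trans (probability_le1 _ _)) ?ltry.
Qed.

Let rho01 : 0 <= rho <= 1.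
Proof.
have : 0 <= s2 * t ^+ 2 / 2 by rewrite divr_ge0 // mulr_ge0 // sqr_ge0.
by have := ts2; lra.
Qed.

(** The factors [Qh] are exchanged for [Q] one at a time. Each exchange acts on some [Q^(p+i) psi]
    and costs [|t| * Kc * m (p + i)], the remaining factors [Qh] being contractions; after all
    exchanges [Q^(p+k) psi] is left. *)
Let eL1_iter_fk k p : (eL1 nu (iter k Qh (fk p)) <=
  (m (p + k)%N + `|t| * Kc cG cw * \sum_(i < k) m (p + i)%N)%:E)%E.
Proof.
elim: k p => [|k IH] p; first by rewrite big_ord0 mulr0 addr0 addn0; exact: eL1_fk.
rewrite iterSr; have oQ : (eL1 nu (Qh (fk p)) < +oo)%E by exact: eL1_Qh_lty.
have mQ : cmeas (Qh (fk p)) by exact: cmeas_Qh.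
have h1 := eL1_iter_QhB _ _ nu_inv _ _ t mG mw k _ _ mQ (mfk p.+1) oQ (fk_lty p.+1).
have h2 := eL1_Qh_sub Q nu nu_inv G w t mG mw cG cw hcG hcw _ _ (m0 p) (mfk p) (fk_lty p) (hfk p).
rewrite Qfk in h2.
rewrite (_ : iter k Qh (Qh (fk p)) = (fun x =>
    (iter k Qh (Qh (fk p)) x - iter k Qh (fk p.+1) x) + iter k Qh (fk p.+1) x)); last first.
  by apply/funext => x; rewrite subrK.
apply: le_trans (eL1D _ _ _ _ _) _; [|exact: mit|].
  by apply: cmeasB; apply: mit.
apply: le_trans (leeD (le_trans h1 h2) (IH p.+1)) _.
rewrite -EFinD lee_fin big_ord_recl addn0 addSnnS.
under [X in _ <= _ + _ * (_ + X)]eq_bigr do rewrite lift0 -addSnnS.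
by lra.
Qed.

Let iter_fk0 k : (eL1 nu (iter k Qh (fk 0)) <= (m k + `|t| * Kc cG cw * Bm)%:E)%E.
Proof.
apply: le_trans (eL1_iter_fk k 0) _; rewrite lee_fin add0n lerD2l.
by rewrite ler_wpM2l ?hBm // mulr_ge0.
Qed.

(** The error at [n + 1] splits into [Qh^n] applied to the Taylor remainder of [Qh 1], the term
    [b Qh^n psi] handled by [iter_fk0], and [rho] times the error at [n]. *)
Let iter_one n : (eL1 nu (fun x => iter n Qh cst1 x - (rho ^+ n)%:C%C * cst1 x)%R <=
  (n%:R * (`|t| ^+ 3 * (4 * (cG + cw))) +
   t ^+ 2 / 2 * (\sum_(k < n) m k + n%:R * (`|t| * Kc cG cw * Bm)))%:E)%E.
Proof.
elim: n => [|n IH].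
  rewrite big_ord0 !mul0r !addr0 mulr0 /=.
  rewrite (_ : (fun x => _) = (fun=> 0)); first by rewrite eL1_0.
  by apply/funext => x; rewrite expr0 mul1r subrr.
set b : R[i] := (- (t ^+ 2 / 2))%:C%C.
have mQ1 : cmeas (Qh cst1) by exact: cmeas_Qh.
have oQ1 : (eL1 nu (Qh cst1) < +oo)%E by exact: eL1_Qh_lty.
have h1 := eL1_iter_Qh_comb Q nu nu_inv G w t mG mw n rho%:C%C b _ _ _ mQ1 c11 (mfk 0) oQ1 o11 (fk_lty 0).
have h2 := eL1_Qh_taylor Q nu nu_inv G w t mG mw cG cw hcG hcw wE iG psi s2 psiE.
rewrite (_ : (fun x => _ + _) = (fun x => Qh cst1 x - rho%:C%C * cst1 x - b * fk 0 x)) in h2; last first.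
  by apply/funext => x; rewrite /b rmorphN mulNr opprK.
rewrite (_ : (fun x => _) = (fun x =>
   (iter n Qh (Qh cst1) x - rho%:C%C * iter n Qh cst1 x - b * iter n Qh (fk 0) x)
   + (b * iter n Qh (fk 0) x
   + rho%:C%C * (iter n Qh cst1 x - (rho ^+ n)%:C%C * cst1 x)))); last first.
  by apply/funext => x; rewrite -iterSr exprS rmorphM /=; ring.
have mA : cmeas (fun x => b * iter n Qh (fk 0) x) by apply: mc; exact: mit.
have mB : cmeas (fun x => rho%:C%C * (iter n Qh cst1 x - (rho ^+ n)%:C%C * cst1 x)).
  by apply: mc; apply: cmeasB; [exact: mit|exact: mc].
apply: le_trans (eL1D _ _ _ _ _) _; [|exact: cmeasD|].
  by apply: cmeasB => //; apply: cmeasB; [exact: mit|apply: mc; exact: mit].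
apply: le_trans (leeD (le_trans h1 h2) (eL1D _ _ _ mA mB)) _.
rewrite !eL1Z; [|by apply: cmeasB; [exact: mit|exact: mc]|exact: mit].
rewrite !cabs_real normrN.
have n1 : 0 <= `|t ^+ 2 / 2| by [].
have n2 : 0 <= `|rho| by [].
have h3 := lee_wpmul2l (n1 : (0 <= `|t ^+ 2 / 2|%:E)%E) (iter_fk0 n).
have h4 := lee_wpmul2l (n2 : (0 <= `|rho|%:E)%E) IH.
apply: le_trans (leeD (lexx _) (leeD h3 h4)) _.
rewrite -!EFinM -!EFinD lee_fin big_ord_recr /= -[n.+1%:R]natr1.
have [r0 r1] := andP rho01.
have t20 : 0 <= t ^+ 2 / 2 by rewrite divr_ge0 ?sqr_ge0.
rewrite (ger0_norm r0) (ger0_norm t20).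
set Y := n%:R * _ + _.
have Y0 : 0 <= Y.
  apply: addr_ge0.
    apply: mulr_ge0 => //; apply: mulr_ge0; first exact: exprn_ge0.
    by apply: mulr_ge0 => //; exact: addr_ge0.
  apply: mulr_ge0; first by rewrite divr_ge0 ?sqr_ge0.
  apply: addr_ge0; first by apply: sumr_ge0 => i _; exact: ltW.
  by apply: mulr_ge0 => //; apply: mulr_ge0 => //; exact: mulr_ge0.
have : 0 <= (1 - rho) * Y by rewrite mulr_ge0 // subr_ge0.
by rewrite /Y; lra.
Qed.

Let eL1_expiB1 (h : E -> R) : measurable_fun setT h -> (forall x, `|h x| <= `|t| * `|w x|) ->
  (eL1 nu (fun x => expi (h x) - 1)%R <= (`|t| * (1 + cw))%:E)%E.
Proof.
move=> mh hw.
have mw3 : measurable_fun setT (fun x => `|w x| ^+ 3).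
  by apply: measurable_funX; exact: measurableT_comp.
have i1 : (\int[nu]_x (cst 1 x)%:E <= 1%:E)%E.
  by rewrite /= integral_cst // mul1e; exact: probability_le1.
have m1 : measurable_fun setT (cst (1 : R) : E -> R) by exact: measurable_cst.
have t0 : 0 <= `|t| by [].
have e3 x : 0 <= `|w x| ^+ 3 by exact: exprn_ge0.
have := le_integral_comb nu _ _ _ _ _ _ m1 mw3 (fun=> ler01) e3 t0 t0 i1 hcw.
rewrite (_ : `|t| * 1 + `|t| * cw = `|t| * (1 + cw)); last by ring.
apply: le_trans; apply: ge0_le_integral => //.
- by move=> x _; rewrite lee_fin cabs_ge0.
- by apply: measurable_ecabs; apply: cmeasB; [exact: cmeas_expi|exact: cmeas_cst].
- apply/measurable_EFinP; apply: measurable_funD; apply: measurable_funM => //;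
  exact: measurable_cst.
move=> x _; rewrite lee_fin; apply: le_trans (cabs_expiB1 _) _.
apply: le_trans (hw x) _; rewrite -mulrDr ler_wpM2l // /cst.
have [h1|h1] := leP `|w x| 1.
  by rewrite -[leLHS]addr0 lerD ?exprn_ge0.
by rewrite -[leLHS]add0r lerD // -[leLHS]expr1 ler_weXn2l // ltW.
Qed.

Definition Cmart : R := 2 * (1 + cw) + 4 * (cG + cw) + Bm / 2 + Kc cG cw * Bm / 2.

(** Removing each of the two conjugating factors [expi (t * w)] and [expi (- (t * w))] costs
    [|t| * (1 + cw)]. The rest is [iter_one], in which [n t^2 <= 1] turns [n |t|^3] into [|t|];
    [Cmart] collects these contributions. *)
Lemma martingale_charfun n : n%:R * t ^+ 2 <= 1 ->
  cabs (cint nu (iter n (Qt Q xi t) cst1) - (rho ^+ n)%:C%C) <= Cmart * `|t|.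
Proof.
move=> nt; rewrite (iter_Qt_Qh Q G w t xi n xiE).
set em : E -> R[i] := fun y => expi (- (t * w y)).
have mtw : measurable_fun setT (fun x => t * w x).
  by apply: measurable_funM => //; exact: measurable_cst.
have mem : cmeas em by apply: cmeas_expi; exact: measurableT_comp.
have oem : (eL1 nu em < +oo)%E.
  by rewrite /eL1; under eq_integral do rewrite cabs_expi;
    rewrite integral_cst // mul1e (le_lt_trans (probability_le1 _ _)) ?ltry.
have mep : cmeas (fun x => expi (t * w x)) by exact: cmeas_expi.
have mU := mit n _ mem.
have oU : (eL1 nu (iter n Qh em) < +oo)%E by exact: eL1_iter_Qh_lty.
have iU := cintegrable_expiM nu _ _ mtw mU ((cintegrableP nu _ mU).2 oU).
have m1 := mc (rho ^+ n)%:C%C _ c11.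
have i1 : cintegrable nu (fun x => (rho ^+ n)%:C%C * cst1 x).
  by apply: cintegrableZ => //; apply/cintegrableP.
have -> : (rho ^+ n)%:C%C = cint nu (fun x => (rho ^+ n)%:C%C * cst1 x).
  rewrite (_ : (fun x => _) = (fun=> (rho ^+ n)%:C%C)).
    by rewrite cint_cst //; exact: probability_setT.
  by apply/funext => x; rewrite /cst1 mulr1.
rewrite -cintB // -lee_fin; apply: le_trans (le_cabs_cint _ _ _) _.
  by apply: cmeasB => //; exact: cmeasM.
rewrite (_ : (fun x => _) = (fun x => expi (t * w x) *
   ((iter n Qh em x - iter n Qh cst1 x) +
    (iter n Qh cst1 x - (rho ^+ n)%:C%C * cst1 x)) +
    (rho ^+ n)%:C%C * (expi (t * w x) - 1))); last first.
  by apply/funext => x; rewrite /cst1; ring.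
have mA : cmeas (fun x => iter n Qh em x - iter n Qh cst1 x).
  by apply: cmeasB => //; exact: mit.
have mB : cmeas (fun x => iter n Qh cst1 x - (rho ^+ n)%:C%C * cst1 x).
  by apply: cmeasB => //; exact: mit.
have mC : cmeas (fun x => expi (t * w x) - 1) by apply: cmeasB => //; exact: cmeas_cst.
apply: le_trans (eL1D _ _ _ _ (mc _ _ mC)) _; first by apply: cmeasM => //; exact: cmeasD.
rewrite eL1Z // cabs_real.
have hC : (eL1 nu (fun x => expi (t * w x) - 1)%R <= (`|t| * (1 + cw))%:E)%E.
  by apply: eL1_expiB1 => // x; rewrite normrM.
have hA : (eL1 nu (fun x => iter n Qh em x - iter n Qh cst1 x)%R <= (`|t| * (1 + cw))%:E)%E.
  apply: le_trans (eL1_iter_QhB _ _ nu_inv _ _ t mG mw n _ _ mem c11 oem o11) _.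
  apply: eL1_expiB1; first exact: measurableT_comp.
  by move=> x; rewrite normrN normrM.
have hAB : (eL1 nu (fun x => expi (t * w x) * ((iter n Qh em x - iter n Qh cst1 x) +
    (iter n Qh cst1 x - (rho ^+ n)%:C%C * cst1 x)))%R <=
    eL1 nu (fun x => iter n Qh em x - iter n Qh cst1 x)%R +
    eL1 nu (fun x => iter n Qh cst1 x - (rho ^+ n)%:C%C * cst1 x)%R)%E.
  apply: le_trans (eL1D _ _ _ mA mB).
  by rewrite /eL1; under eq_integral do rewrite cabsM cabs_expi mul1r.
have rn0 : 0 <= `|rho ^+ n| by [].
have hC' := lee_wpmul2l (rn0 : (0 <= `|rho ^+ n|%:E)%E) hC.
apply: le_trans (leeD (le_trans hAB (leeD hA (iter_one n))) hC') _.
rewrite -!EFinM -!EFinD lee_fin.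
have [r0 r1] := andP rho01.
have rn1 : `|rho ^+ n| <= 1 by rewrite ger0_norm ?exprn_ge0 // exprn_ile1.
have a0 : 0 <= `|t| by [].
have E1 : `|rho ^+ n| * (`|t| * (1 + cw)) <= `|t| * (1 + cw).
  by rewrite ler_piMl // mulr_ge0 // addr_ge0.
have tt : t ^+ 2 = `|t| ^+ 2 by rewrite real_normK ?num_real.
rewrite tt in nt E1 *.
have E2 : n%:R * (`|t| ^+ 3 * (4 * (cG + cw))) <= `|t| * (4 * (cG + cw)).
  have := ler_wpM2r (mulr_ge0 a0 (mulr_ge0 (ler0n R 4) (addr_ge0 cG0 cw0))) nt.
  by rewrite mul1r; lra.
have E3 : `|t| ^+ 2 * \sum_(k < n) m k <= `|t| * Bm.
  apply: ler_pM; rewrite ?sqr_ge0 ?sumr_ge0 //; first by move=> i _; exact: ltW.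
  by rewrite expr2 ler_piMl.
have E4 : `|t| ^+ 2 * (n%:R * (`|t| * Kc cG cw * Bm)) <= `|t| * Kc cG cw * Bm.
  have := ler_wpM2r (mulr_ge0 (mulr_ge0 a0 Kc0) Bm0) nt.
  by rewrite mul1r; lra.
by rewrite /Cmart; lra.
Qed.

End FixedT.
End MartingaleEstimate.

(** * Characteristic function of the chain *)

Section BoundedFunctions.
Context {R : realType} {d : measure_display} {E : measurableType d}.
Local Notation cind A := (fun x : E => (\1_A x)%:C%C : R[i]).

(** The sum counts the thresholds not exceeding [u], so it is the integer part of [u / dlt]. *)
Lemma threshold_sum (u dlt : R) N : 0 < dlt -> 0 <= u < N.+1%:R * dlt ->
  `|u - dlt * \sum_(i < N) (i.+1%:R * dlt <= u)%R%:R| <= dlt.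
Proof.
move=> d0; elim: N => [|N IH] /andP[u0 uN].
  by rewrite big_ord0 mulr0 subr0 ger0_norm // ltW // -[ltRHS]mul1r.
rewrite big_ord_recr /=; have [h|h] := leP (N.+1%:R * dlt) u.
  rewrite (eq_bigr (fun=> 1)) => [|i _].
    rewrite sumr_const card_ord /= natr1 ler_norml.
    move: uN; rewrite -[N.+2%:R]natr1 => uN.
    by apply/andP; split; lra.
  rewrite (_ : (_ <= u) = true) //; apply/idP; apply: le_trans h.
  by rewrite ler_wpM2r ?ler_nat ?(ltW d0) // ltnW // ltnS.
by rewrite addr0; apply: IH; rewrite u0.
Qed.

Lemma cmeas_cind (A : set E) : measurable A -> cmeas (cind A).
Proof. by move=> mA; apply: cmeas_real; exact: measurable_indic. Qed.

Lemma cabs_cind (A : set E) x : cabs (cind A x) <= 1.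
Proof. by rewrite cabs_real indicE; case: (_ \in _); rewrite ?normr1 ?normr0. Qed.

Definition bmeas (F : E -> R[i]) := cmeas F /\ exists c, forall x, cabs (F x) <= c.

Lemma bmeasD (a : R[i]) F G : bmeas F -> bmeas G -> bmeas (fun x => a * F x + G x).
Proof.
move=> [mF [c hc]] [mG [c' hc']]; split.
  by apply: cmeasD => //; apply: cmeasM => //; exact: cmeas_cst.
exists (cabs a * c + c') => x; apply: le_trans (cabsD _ _) _.
by rewrite lerD // cabsM ler_wpM2l ?cabs_ge0.
Qed.

Lemma bmeas_cst (c : R[i]) : bmeas (fun=> c).
Proof. by split; [exact: cmeas_cst|exists (cabs c)]. Qed.

Lemma bmeas_cind (A : set E) : measurable A -> bmeas (cind A).
Proof. by move=> mA; split; [exact: cmeas_cind|exists 1 => x; exact: cabs_cind]. Qed.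

(* A linear functional continuous for the sup norm is determined by indicators:
   [u] is within [dlt] of the simple function [dlt * #{i | (i+1) dlt <= u}]. *)
Lemma bounded_functional_eq0 (L : (E -> R[i]) -> R[i]) (K : R) :
  (forall a F G, bmeas F -> bmeas G -> L (fun x => a * F x + G x) = a * L F + L G) ->
  (forall c F, bmeas F -> (forall x, cabs (F x) <= c) -> cabs (L F) <= K * c) ->
  (forall A, measurable A -> L (cind A) = 0) ->
  forall F, bmeas F -> L F = 0.
Proof.
move=> LD LK LA.
have L0 : L (fun=> 0) = 0.
  transitivity (L (cind (set0 : set E))); last exact: LA.
  by congr L; apply/funext => x; rewrite indic0.
have LZ a F : bmeas F -> L (fun x => a * F x) = a * L F.
  move=> bF; have := LD a F (fun=> 0) bF (bmeas_cst 0).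
  by rewrite L0 addr0 => <-; congr L; apply/funext => x; rewrite addr0.
have Lreal (h : E -> R) : bmeas (fun x => (h x)%:C%C) -> L (fun x => (h x)%:C%C) = 0.
  move=> bh; have [[mh _] [b hb]] := bh; rewrite /= in mh.
  apply/cabs_eq0/le_anti; rewrite cabs_ge0 andbT.
  have K0 : 0 <= K.
    have := LK 1 _ (bmeas_cst 0); rewrite L0 mulr1 cabs0; apply=> x.
    by rewrite ?cabs0 ler01.
  have K1 : 0 < K + 1 by lra.
  apply/ler_addgt0Pr => e e0; rewrite add0r.
  set dlt := e / (K + 1); have d0 : 0 < dlt by exact: divr_gt0.
  have hb' x : `|h x| <= b by rewrite -cabs_real.
  pose N := Num.truncn (2 * `|b| / dlt).
  have hN : 2 * `|b| / dlt < N.+1%:R.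
    by have := truncnS_gt (2 * `|b| / dlt).
  pose A i := [set x | i.+1%:R * dlt <= h x + `|b|].
  have mA i : measurable (A i).
    have mhb : measurable_fun setT (fun x => h x + `|b|).
      by apply: measurable_funD => //; exact: measurable_cst.
    have := mhb measurableT `[i.+1%:R * dlt, +oo[%classic (measurable_itv _).
    rewrite setTI; congr measurable; apply/seteqP; split => x /=;
      by rewrite in_itv /= andbT.
  pose s n x : R[i] := (\sum_(i < n) (i.+1%:R * dlt <= h x + `|b|)%R%:R)%:C%C.
  have s0 : s 0%N = fun=> 0 by apply/funext => x; rewrite /s big_ord0.
  have sS n : s n.+1 = fun x => 1 * s n x + cind (A n) x.
    apply/funext => x; rewrite /s big_ord_recr mul1r.
    apply: complex_ext; rewrite /= ?addr0 //; congr (_ + _).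
    by rewrite indicE /A; congr ((nat_of_bool _)%:R); apply/idP/idP; rewrite inE.
  have bs n : bmeas (s n).
    elim: n => [|n IH]; first by rewrite s0; exact: bmeas_cst.
    by rewrite sS; apply: bmeasD => //; exact: bmeas_cind.
  have Ls n : L (s n) = 0.
    elim: n => [|n IH]; first by rewrite s0.
    by rewrite sS LD // ?IH ?mulr0 ?add0r ?LA //; exact: bmeas_cind.
  have bb : bmeas (fun x => `|b|%:C%C + (h x)%:C%C).
    have := bmeasD 1 _ _ (bmeas_cst `|b|%:C%C) bh.
    by under eq_fun do rewrite mul1r.
  (* The shift by [|b|] makes the function nonnegative and is invisible to [L], which kills
     constants because it kills the indicator of the whole space. *)
  have Lb : L (fun x => `|b|%:C%C + (h x)%:C%C) = L (fun x => (h x)%:C%C).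
    have := LD `|b|%:C%C _ _ (bmeas_cind _ measurableT) bh.
    rewrite LA // mulr0 add0r => <-; congr L; apply/funext => x.
    by rewrite indicT mulr1.
  have bf := bmeasD (- dlt%:C%C) _ _ (bs N) bb.
  have <- : L (fun x => - dlt%:C%C * s N x + (`|b|%:C%C + (h x)%:C%C)) = L (fun x => (h x)%:C%C).
    by rewrite LD // Ls mulr0 add0r.
  apply: le_trans (LK dlt _ bf _) _; last first.
    rewrite /dlt mulrCA ler_piMr ?(ltW e0) // ler_pdivrMr // mul1r; lra.
  move=> x.
  rewrite (_ : _ + _ = ((h x + `|b|) - dlt * \sum_(i < N) (i.+1%:R * dlt <= h x + `|b|)%R%:R)%:C%C).
    rewrite cabs_real; apply: threshold_sum => //; apply/andP; split.
      by have := hb' x; have := ler_norm b; rewrite ler_norml => ? /andP[]; lra.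
    move: hN; rewrite ltr_pdivrMr //; apply: le_lt_trans.
    by have := hb' x; have := ler_norm b; rewrite ler_norml => ? /andP[]; lra.
  rewrite /s; apply: complex_ext; rewrite /= ?mulr0 ?mul0r ?subr0; ring.
move=> F [mF [c hc]].
have bR : bmeas (fun x => (complex.Re (F x))%:C%C).
  split; first by apply: cmeas_real; exact: mF.1.
  by exists c => x; rewrite cabs_real; apply: le_trans (Re_le_cabs _) (hc x).
have bI : bmeas (fun x => (complex.Im (F x))%:C%C).
  split; first by apply: cmeas_real; exact: mF.2.
  by exists c => x; rewrite cabs_real; apply: le_trans (Im_le_cabs _) (hc x).
rewrite (_ : F = fun x => 'i%C * (complex.Im (F x))%:C%C + (complex.Re (F x))%:C%C).
  by rewrite LD // !Lreal // mulr0 addr0.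
by apply/funext => x; rewrite [LHS]complexE addrC.
Qed.

End BoundedFunctions.

(** * From finite-dimensional distributions to products of bounded functions *)

Section ChainLaw.
Context {R : realType} {d : measure_display} {E : measurableType d}.
Context (Q : R.-pker E ~> E).
Local Notation cind A := (fun x : E => (\1_A x)%:C%C : R[i]).
Implicit Types (f : nat -> E -> R[i]).

(** Functional counterpart of [fdd]: conditional expectation, given the present state [x], of the
    product of [f k], [f k.+1], ... over the next [n] states. *)
Fixpoint cfdd f (k n : nat) (x : E) : R[i] :=
  match n with
  | 0 => 1
  | n'.+1 => Qop Q (fun y => f k y * cfdd f k.+1 n' y) x
  end.

Definition cfddm (mu : {measure set E -> \bar R}) f k n : R[i] :=
  cint mu (fun y => f k y * cfdd f k.+1 n y).

Definition upd f j (phi : E -> R[i]) k := if k == j then phi else f k.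

Lemma cint_bound {d'} {T : measurableType d'} (mu : {measure set T -> \bar R})
  (F : T -> R[i]) (c : R) : mu setT = 1%E ->
  cmeas F -> (forall x, cabs (F x) <= c) -> cabs (cint mu F) <= c.
Proof.
move=> mu1 mF Fc; rewrite -lee_fin; apply: le_trans (le_cabs_cint _ _ mF) _.
rewrite (_ : c%:E = \int[mu]_x (cst c%:E) x)%E; last first.
  by rewrite integral_cst // mu1 mule1.
apply: ge0_le_integral => //.
- by move=> x _; rewrite lee_fin cabs_ge0.
- exact: measurable_ecabs.
- by move=> x _; rewrite lee_fin.
Qed.

Lemma bmeas_integrable {d'} {T : measurableType d'} (mu : {measure set T -> \bar R})
  (F : T -> R[i]) : mu setT = 1%E -> bmeas F -> cintegrable mu F.
Proof.
move=> mu1 [mF [c Fc]]; apply/cintegrableP => //.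
apply: (@le_lt_trans _ _ (\int[mu]_x (cst `|c|%:E) x)%E).
  apply: ge0_le_integral => //.
  - by move=> x _; rewrite lee_fin cabs_ge0.
  - exact: measurable_ecabs.
  - by move=> x _; rewrite lee_fin; apply: le_trans (Fc x) (ler_norm _).
by rewrite integral_cst // mu1 mule1 ltry.
Qed.

Lemma bmeasM {d'} {T : measurableType d'} (F G : T -> R[i]) :
  bmeas F -> bmeas G -> bmeas (fun x => F x * G x).
Proof.
move=> [mF [c Fc]] [mG [c' Gc]]; split; first exact: cmeasM.
by exists (c * c') => x; rewrite cabsM ler_pM ?cabs_ge0.
Qed.

Lemma bmeas_Qop F : bmeas F -> bmeas (Qop Q F).
Proof.
move=> [mF [c Fc]]; split; first exact: cmeas_Qop.
by exists c => x; apply: cint_bound => //; exact: prob_kernel.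
Qed.

Lemma bmeas_cfdd f k n : (forall i, bmeas (f i)) -> bmeas (cfdd f k n).
Proof.
move=> bf; elim: n k => [|n IH] k /=; first exact: bmeas_cst.
by apply: bmeas_Qop; exact: bmeasM.
Qed.

Lemma bmeas_upd f j phi : (forall i, bmeas (f i)) -> bmeas phi ->
  forall i, bmeas (upd f j phi i).
Proof. by move=> bf bp i; rewrite /upd; case: ifP. Qed.

Lemma eq_cfdd f g k n : (forall i, (k <= i < k + n)%N -> f i = g i) ->
  cfdd f k n = cfdd g k n.
Proof.
elim: n k => [|n IH] k fg //=; apply/funext => x.
rewrite (IH k.+1) => [|i /andP[ki ik]]; last by apply: fg; rewrite (ltnW ki) -addSnnS.
by rewrite fg // leqnn -[ltnLHS]addn0 ltn_add2l.
Qed.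

Lemma cfdd_upd_lt f j phi k n : (j < k)%N -> cfdd (upd f j phi) k n = cfdd f k n.
Proof.
move=> jk; apply: eq_cfdd => i /andP[ki _]; rewrite /upd gtn_eqF //.
exact: leq_trans ki.
Qed.

(** Boundedness of all factors makes every integral in the recursion finite at every point, so
    linearity in the coordinate [j] propagates without exceptional sets. *)
Lemma cfddm_linear (mu : {measure set E -> \bar R}) f j (a : R[i]) F G k n : mu setT = 1%E ->
  (forall i, bmeas (f i)) -> bmeas F -> bmeas G -> (k <= j <= k + n)%N ->
  cfddm mu (upd f j (fun x => a * F x + G x)) k n =
  a * cfddm mu (upd f j F) k n + cfddm mu (upd f j G) k n.
Proof.
move=> mu1 bf bF bG; have bFG := bmeasD a _ _ bF bG.
have bi H g l m : bmeas H -> (forall i, bmeas (g i)) ->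
    bmeas (fun y => H y * cfdd g l m y).
  by move=> bH bg; apply: bmeasM => //; exact: bmeas_cfdd.
have bu H := bmeas_upd f j H bf.
elim: n k mu mu1 => [|n IH] k mu mu1 /andP[kj jk].
  have -> : j = k by apply/eqP; rewrite eqn_leq kj andbT -[leqRHS]addn0.
  rewrite /cfddm /= /upd eqxx -cintZ; last first.
    by apply: bmeas_integrable => //; apply: bmeasM => //; exact: bmeas_cst.
  rewrite -cintD.
  - by congr cint; apply/funext => x; ring.
  - apply: bmeas_integrable => //; apply: bmeasM; first exact: bmeas_cst.
    by apply: bmeasM => //; exact: bmeas_cst.
  - by apply: bmeas_integrable => //; apply: bmeasM => //; exact: bmeas_cst.
have [jk'|jk'] := eqVneq j k.
  rewrite /cfddm jk' !cfdd_upd_lt // /upd eqxx -cintZ; last first.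
    by apply: bmeas_integrable => //; exact: bi.
  rewrite -cintD.
  - by congr cint; apply/funext => x; ring.
  - by apply: bmeas_integrable => //; apply: bmeasM; [exact: bmeas_cst|exact: bi].
  - by apply: bmeas_integrable => //; exact: bi.
have kj' : (k.+1 <= j <= k.+1 + n)%N by rewrite ltn_neqAle eq_sym jk' kj addSnnS.
have bk H := bi (f k) (upd f j H) k.+1 n.+1 (bf k).
have updk H : upd f j H k = f k by rewrite /upd eq_sym (negbTE jk').
rewrite /cfddm !updk -cintZ; last by apply: bmeas_integrable => //; exact/bk/bu.
rewrite -cintD.
- congr cint; apply/funext => x /=.
  have := IH k.+1 (Q x) (prob_kernel _) kj'; rewrite /cfddm /Qop => ->.
  by ring.
- by apply: bmeas_integrable => //; apply: bmeasM; [exact: bmeas_cst|exact/bk/bu].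
- by apply: bmeas_integrable => //; exact/bk/bu.
Qed.

Lemma cfdd_bound f (b : nat -> R) k n : (forall i, bmeas (f i)) ->
  (forall i x, cabs (f i x) <= b i) ->
  forall x, cabs (cfdd f k n x) <= \prod_(i < n) b (k + i)%N.
Proof.
move=> bf fb; elim: n k => [|n IH] k x; first by rewrite big_ord0 [cfdd _ _ _ _]/(1 : R[i]) cabs1.
apply: cint_bound => [| |y]; first exact: prob_kernel.
  by have [] := bmeasM _ _ (bf k) (bmeas_cfdd f k.+1 n bf).
rewrite big_ord_recl addn0 cabsM ler_pM ?cabs_ge0 //.
by apply: le_trans (IH k.+1 y) _; under [leRHS]eq_bigr do rewrite lift0 -addSnnS.
Qed.

Lemma cfddm_bound (mu : {measure set E -> \bar R}) f (b : nat -> R) k n : mu setT = 1%E -> (forall i, bmeas (f i)) ->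
  (forall i x, cabs (f i x) <= b i) ->
  cabs (cfddm mu f k n) <= \prod_(i < n.+1) b (k + i)%N.
Proof.
move=> mu1 bf fb; apply: cint_bound => // [|y].
  by have [] := bmeasM _ _ (bf k) (bmeas_cfdd f k.+1 n bf).
rewrite big_ord_recl addn0 cabsM ler_pM ?cabs_ge0 //.
apply: le_trans (cfdd_bound f b k.+1 n bf fb y) _.
by under [leRHS]eq_bigr do rewrite lift0 -addSnnS.
Qed.

(** The three facts must be proved together: the bound by 1 makes [fdd] finite, so that [fine] loses
    nothing and the extended real and complex recursions match. *)
Lemma fdd_spec (A : nat -> set E) k n : (forall i, measurable (A i)) ->
  measurable_fun setT (fdd Q A k n) /\
  (forall x, 0 <= fdd Q A k n x <= 1)%E /\
  forall x, cfdd (fun i => cind (A i)) k n x = (fine (fdd Q A k n x))%:C%C.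
Proof.
move=> mA; elim: n k => [|n IH] k /=.
  by split; [exact: measurable_cst|split => // x; rewrite lee01 lexx].
have [mf [f01 fE]] := IH k.+1.
have f0 x : (0 <= fdd Q A k.+1 n x)%E by have /andP[] := f01 x.
have r0 x : (0 <= (fdd Q A k.+1 n \_ (A k)) x)%E by rewrite patchE; case: ifP.
have mr : measurable_fun setT (fdd Q A k.+1 n \_ (A k)).
  by apply/(measurable_restrictT _ (mA k)); exact: measurable_funTS.
split.
  under eq_fun do rewrite integral_mkcond.
  exact: measurable_kernel_integral.
split.
  move=> x; rewrite integral_mkcond integral_ge0 //=.
  rewrite -(@prob_kernel _ _ _ _ _ Q x) -[leRHS]mul1e -integral_cst //.
  apply: ge0_le_integral => //.
  by move=> y _; rewrite patchE; case: ifP => // _; have /andP[] := f01 y.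
move=> x; rewrite integral_mkcond /Qop.
transitivity (cint (Q x) (fun y => (fine ((fdd Q A k.+1 n \_ (A k)) y))%:C%C)); last first.
  rewrite cint_real; congr (fine _)%:C%C; apply: eq_integral => y _.
  rewrite fineK // ge0_fin_numE // patchE; case: ifP => _; last exact: (ltry 0).
  by have /andP[_] := f01 y; move=> /le_lt_trans; apply; exact: ltry.
congr cint; apply/funext => y; rewrite fE indicE patchE; case: ifP => _ /=.
  by rewrite mul1r.
by rewrite mul0r.
Qed.

Context {dO : measure_display} {Omega : measurableType dO}.
Context (P : probability Omega R) (X : nat -> Omega -> E).
Context (mu0 : probability E R).
Hypothesis hX : markov_chain P X Q mu0.

Let mX k : measurable_fun setT (X k). Proof. exact: hX.1. Qed.

Lemma bmeas_prod f n : (forall i, bmeas (f i)) ->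
  bmeas (fun w => \prod_(i < n) f i (X i w)).
Proof.
move=> bf; elim: n => [|n IH].
  rewrite (_ : (fun w => _) = fun=> 1); first exact: bmeas_cst.
  by apply/funext => w; rewrite big_ord0.
rewrite (_ : (fun w => _) = (fun w => (\prod_(i < n) f i (X i w)) * f n (X n w))).
  apply: bmeasM => //; have [[m1 m2] [c hc]] := bf n; split.
    by split; [exact: (measurableT_comp m1)|exact: (measurableT_comp m2)].
  by exists c => w.
by apply/funext => w; rewrite big_ord_recr.
Qed.

Lemma chain_product_indicator (A : nat -> set E) n : (forall i, measurable (A i)) ->
  cint P (fun w => \prod_(i < n.+1) cind (A i) (X i w)) =
  cfddm mu0 (fun i => cind (A i)) 0 n.
Proof.
move=> mA; have [mf [f01 fE]] := fdd_spec A 1 n mA.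
have -> : cfddm mu0 (fun i => cind (A i)) 0 n =
    (fine (\int[mu0]_(x in A 0%N) fdd Q A 1 n x)%E)%:C%C.
  rewrite integral_mkcond /cfddm.
  transitivity (cint mu0 (fun y => (fine ((fdd Q A 1 n \_ (A 0%N)) y))%:C%C)); last first.
    rewrite cint_real; congr (fine _)%:C%C; apply: eq_integral => y _.
    have /andP[h0 h1] := f01 y.
    rewrite fineK // patchE; case: ifP => // _.
    by rewrite ge0_fin_numE //; apply: le_lt_trans h1 _; exact: ltry.
  congr cint; apply/funext => y; rewrite fE indicE patchE; case: ifP => _ /=.
    by rewrite mul1r.
  by rewrite mul0r.
rewrite -(hX.2 n A mA); set B := [set w | _].
have mB : measurable B.
  rewrite (_ : B = \bigcap_(k in [set k | (k <= n)%N]) (X k @^-1` A k)).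
    apply: bigcap_measurableType => k _; rewrite -[X in measurable X]setTI.
    exact: mX.
  by apply/seteqP; split => w /= h k kn; exact: h.
transitivity (cint P (fun w => (\1_B w)%:C%C)); last first.
  rewrite cint_real; congr (_%:C%C).
  by rewrite /Rintegral integral_indic // setIT.
congr cint; apply/funext => w; rewrite indicE; have [|] := boolP (w \in B).
  rewrite inE => wB; rewrite big1 // => i _.
  by rewrite indicE mem_set //; apply: wB; rewrite -ltnS.
rewrite notin_setE => /existsNP[k] /not_implyP[kn nA].
have kn' : (k < n.+1)%N by rewrite ltnS.
by rewrite (bigD1 (Ordinal kn')) //= indicE memNset // mul0r.
Qed.

(* Indicators are replaced by bounded functions one coordinate at a time. *)
Lemma chain_product f n : (forall i, cmeas (f i)) -> (forall i x, cabs (f i x) <= 1) ->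
  (forall i, (n < i)%N -> f i = fun=> 1) ->
  cint P (fun w => \prod_(i < n.+1) f i (X i w)) = cfddm mu0 f 0 n.
Proof.
move=> mf f1 fn.
suff H j : (j <= n.+1)%N -> forall f, (forall i, cmeas (f i)) ->
    (forall i x, cabs (f i x) <= 1) ->
    (forall i, (j <= i)%N -> exists2 A, measurable A & f i = cind A) ->
    cint P (fun w => \prod_(i < n.+1) f i (X i w)) - cfddm mu0 f 0 n = 0.
  apply/eqP; rewrite -subr_eq0; apply/eqP/(H n.+1) => // i ni.
  exists setT => //; rewrite fn //; apply/funext => x.
  by rewrite indicT.
elim: j => [_|j IH jn] {mf f1 fn} {}f mf f1 fA.
  have /choice[A hA] : forall i, exists A, measurable A /\ f i = cind A.
    by move=> i; have [A mA fiA] := fA i (leq0n i); exists A.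
  have -> : f = fun i => cind (A i) by apply/funext => i; have [] := hA i.
  by rewrite chain_product_indicator ?subrr // => i; have [] := hA i.
have bf i : bmeas (f i) by split => //; exists 1.
have jn' : (j < n.+1)%N by [].
pose L phi := cint P (fun w => \prod_(i < n.+1) upd f j phi i (X i w)) -
  cfddm mu0 (upd f j phi) 0 n.
have updj : upd f j (f j) = f.
  by apply/funext => i; rewrite /upd; case: eqP => // ->.
suff : L (f j) = 0 by rewrite /L updj.
have prodE phi w : \prod_(i < n.+1) upd f j phi i (X i w) =
    phi (X j w) * \prod_(i < n.+1 | i != Ordinal jn') f i (X i w).
  rewrite (bigD1 (Ordinal jn')) //= {1}/upd eqxx; congr (_ * _).
  apply: eq_bigr => i ij; rewrite /upd ifN //.
have P1 : P setT = 1%E by exact: probability_setT.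
have M1 : mu0 setT = 1%E by exact: probability_setT.
(* Each of the two terms whose difference is [L] is bounded by the sup norm of its argument, hence
   the constant 2. *)
apply: (@bounded_functional_eq0 _ _ _ L 2) => //.
- move=> a F G bF bG; rewrite /L cfddm_linear ?add0n //.
  have iP H : bmeas H -> cintegrable P (fun w => \prod_(i < n.+1) upd f j H i (X i w)).
    by move=> bH; apply: bmeas_integrable => //; apply: bmeas_prod; exact: bmeas_upd.
  rewrite (_ : (fun w => _) = (fun w => a * (\prod_(i < n.+1) upd f j F i (X i w)) +
     \prod_(i < n.+1) upd f j G i (X i w))).
    rewrite cintD ?cintZ; [by ring|exact: iP| |exact: iP].
    by apply: cintegrableZ; [have [] := bmeas_prod _ n.+1 (bmeas_upd f j F bf bF)|exact: iP].
  by apply/funext => w; rewrite !prodE; ring.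
- move=> c F bF Fc.
  have c0 : 0 <= c.
    have [x0|E0] := pselect (inhabited E).
      by case: x0 => x0; exact: le_trans (cabs_ge0 _) (Fc x0).
    suff : (mu0 setT = 0)%E by rewrite M1 => /eqP; rewrite eqe oner_eq0.
    rewrite (_ : setT = set0) ?measure0 //.
    by apply/seteqP; split => // x _; apply: E0; exists.
  pose b i := if i == j then c else 1.
  have ub i x : cabs (upd f j F i x) <= b i by rewrite /upd /b; case: eqP.
  have bu := bmeas_upd f j F bf bF.
  have b0 i : 0 <= b i by rewrite /b; case: ifP.
  have prodb : \prod_(i < n.+1) b i = c.
    rewrite (bigD1 (Ordinal jn')) //= {1}/b eqxx big1 ?mulr1 // => i ij.
    by rewrite /b ifN.
  apply: le_trans (cabsB _ _) _; rewrite (_ : 2 * c = c + c); last by ring.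
  rewrite lerD //; last by rewrite -prodb; exact: (cfddm_bound mu0 _ b 0 n M1 bu ub).
  apply: cint_bound => // [|w]; first by have [] := bmeas_prod _ n.+1 bu.
  rewrite -prodb; elim: (n.+1) => [|k IHk]; first by rewrite !big_ord0 cabs1.
  by rewrite !big_ord_recr /= cabsM ler_pM ?cabs_ge0.
- move=> A mA; apply: IH; first exact: ltnW.
  + by move=> i; rewrite /upd; case: eqP => // _; exact: cmeas_cind.
  + by move=> i x; rewrite /upd; case: eqP => // _; exact: cabs_cind.
  move=> i ji; rewrite /upd; case: eqP => [_|/eqP ij]; first by exists A.
  by apply: fA; rewrite ltn_neqAle eq_sym ij.
Qed.

Lemma cfdd_iter f (xi : E -> R) (t : R) k n :
  (forall i, (k <= i < k + n)%N -> f i = fun y => expi (t * xi y)) ->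
  cfdd f k n = iter n (Qt Q xi t) cst1.
Proof.
elim: n k => [|n IH] k fE //; apply/funext => x.
rewrite /= fE ?leqnn ?addnS ?ltnS ?leq_addr // IH // => i /andP[ki ik].
by apply: fE; rewrite (ltnW ki) addnS -addSn.
Qed.

Lemma chain_charfun (xi : E -> R) (t : R) n : measurable_fun setT xi ->
  cint P (fun w => expi (t * \sum_(1 <= k < n.+1) xi (X k w))) =
  cint mu0 (iter n (Qt Q xi t) cst1).
Proof.
(* Coordinate 0 carries the constant 1 because the sum starts at [X 1]; coordinates beyond [n] carry
   1 as [chain_product] requires. *)
move=> mxi; pose f i : E -> R[i] :=
  if (0 < i <= n)%N then (fun y => expi (t * xi y)) else (fun=> 1).
have fE i : (0 < i <= n)%N -> f i = fun y => expi (t * xi y) by rewrite /f => ->.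
have f1 i : ~~ (0 < i <= n)%N -> f i = fun=> 1 by rewrite /f => /negbTE ->.
have mt : measurable_fun setT (fun y => t * xi y).
  by apply: measurable_funM => //; exact: measurable_cst.
have := chain_product f n; rewrite /cfddm.
rewrite (cfdd_iter f xi t 1 n) => [|i /andP[i0 il]]; last first.
  by apply: fE; rewrite i0 -ltnS.
rewrite f1 // => H.
transitivity (cint P (fun w => \prod_(i < n.+1) f i (X i w))).
  congr cint; apply/funext => w; rewrite big_ord_recl f1 // mul1r.
  rewrite big_add1 /= big_mkord mulr_sumr.
  rewrite (big_morph expi expiD expi0); apply: eq_bigr => i _.
  by rewrite [RHS](_ : _ = f i.+1 (X i.+1 w)) // fE // ltn_ord.
rewrite H.
- by congr cint; apply/funext => y; rewrite mul1r.
- by move=> i; rewrite /f; case: ifP => _; [exact: cmeas_expi|exact: cmeas_cst].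
- by move=> i x; rewrite /f; case: ifP => _; rewrite ?cabs_expi ?cabs1.
- by move=> i ni; rewrite f1 // [(i <= n)%N]leqNgt ni andbF.
Qed.

End ChainLaw.

(** * Esseen smoothing *)

Section FubiniBounded.
Context {R : realType} {d1 d2 : measure_display}.
Context {T1 : measurableType d1} {T2 : measurableType d2}.

(** The rectangle is moved into the integrand as a product of indicators; boundedness and finite
    measure then give integrability on the product, and Fubini's theorem applies on the full
    spaces. *)
Lemma Rintegral_swap (m1 : {sigma_finite_measure set T1 -> \bar R})
    (m2 : {sigma_finite_measure set T2 -> \bar R}) (D1 : set T1) (D2 : set T2)
    (f : T1 * T2 -> R) (c : R) : measurable D1 -> measurable D2 ->
  (m1 D1 < +oo)%E -> (m2 D2 < +oo)%E -> measurable_fun setT f ->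
  (forall x y, D1 x -> D2 y -> `|f (x, y)| <= c) ->
  \int[m1]_(x in D1) (\int[m2]_(y in D2) f (x, y)) =
  \int[m2]_(y in D2) (\int[m1]_(x in D1) f (x, y)).
Proof.
move=> mD1 mD2 f1 f2 mf fc.
pose g (z : T1 * T2) : R := \1_D1 z.1 * (\1_D2 z.2 * f z).
have mg : measurable_fun setT g.
  apply: measurable_funM.
    by apply: measurableT_comp; [exact: measurable_indic|exact: measurable_fst].
  apply: measurable_funM => //.
  by apply: measurableT_comp; [exact: measurable_indic|exact: measurable_snd].
have i0 (T : Type) (D : set T) x : 0 <= \1_D x :> R by rewrite indicE.
have gc x y : `|g (x, y)| <= `|c| * (\1_D1 x * \1_D2 y).
  rewrite /g /= !indicE; have [h1|h1] := boolP (x \in D1); have [h2|h2] := boolP (y \in D2);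
   rewrite ?mul1r ?mulr1 ?mul0r ?mulr0 ?normr0 //.
  by rewrite inE in h1; rewrite inE in h2; apply: le_trans (fc x y h1 h2) (ler_norm _).
have cc : 0 <= `|c| by [].
have mi1 : measurable_fun setT (fun x => (\1_D1 x : R)%:E).
  by apply/measurable_EFinP; exact: measurable_indic.
have mi2 : measurable_fun setT (fun y => (\1_D2 y : R)%:E).
  by apply/measurable_EFinP; exact: measurable_indic.
have ni1 x : (0 <= (\1_D1 x : R)%:E)%E by rewrite lee_fin.
have ni2 y : (0 <= (\1_D2 y : R)%:E)%E by rewrite lee_fin.
have ci1 x : (0 <= (`|c| * \1_D1 x)%:E)%E by rewrite lee_fin mulr_ge0.
have ci2 y : (0 <= (`|c| * \1_D2 y)%:E)%E by rewrite lee_fin mulr_ge0.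
have b2 x : (\int[m2]_y `|g (x, y)|%:E <= (`|c| * \1_D1 x)%:E * m2 D2)%E.
  rewrite -(setIT D2) -integral_indic // -ge0_integralZl //.
  apply: ge0_le_integral => //.
  - apply/measurable_EFinP; apply: measurableT_comp => //.
    exact: (measurableT_comp mg (measurable_pair1 _)).
  - apply: measurable_funeM; apply/measurable_EFinP; exact: measurable_indic.
  - by move=> y _; rewrite -EFinM lee_fin -mulrA; exact: gc.
have b1 y : (\int[m1]_x `|g (x, y)|%:E <= (`|c| * \1_D2 y)%:E * m1 D1)%E.
  rewrite -(setIT D1) -integral_indic // -ge0_integralZl //.
  apply: ge0_le_integral => //.
  - apply/measurable_EFinP; apply: measurableT_comp => //.
    exact: (measurableT_comp mg (measurable_pair2 _)).
  - apply: measurable_funeM; apply/measurable_EFinP; exact: measurable_indic.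
  - by move=> x _; rewrite -EFinM lee_fin -mulrA [X in _ * X]mulrC; exact: gc.
have mg1 x : measurable_fun setT (fun y => g (x, y)).
  exact: (measurableT_comp mg (measurable_pair1 _)).
have mg2 y : measurable_fun setT (fun x => g (x, y)).
  exact: (measurableT_comp mg (measurable_pair2 _)).
have int1 x : m2.-integrable setT (fun y => (g (x, y))%:E).
  apply/integrableP; split; first exact/measurable_EFinP.
  apply: le_lt_trans (b2 x) _; exact: lte_mul_pinfty.
have int2 y : m1.-integrable setT (fun x => (g (x, y))%:E).
  apply/integrableP; split; first exact/measurable_EFinP.
  apply: le_lt_trans (b1 y) _; exact: lte_mul_pinfty.
have int : (m1 \x m2)%E.-integrable setT (EFin \o g).
  apply/integrable12ltyP; first exact/measurable_EFinP.
  apply: (@le_lt_trans _ _ (\int[m1]_x ((`|c|%:E * m2 D2) * (\1_D1 x)%:E))%E).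
    apply: ge0_le_integral => //.
    - by move=> x _; apply: integral_ge0.
    - apply: (measurable_fun_fubini_tonelli_F (fun z => `|g z|%:E)) => //.
      by apply/measurable_EFinP; exact: measurableT_comp.
    - by apply: measurable_funeM; apply/measurable_EFinP; exact: measurable_indic.
    - by move=> x _; apply: le_trans (b2 x) _; rewrite EFinM -muleA [X in (_ * X)%E]muleC muleA.
  have cm0 : (0 <= `|c|%:E * m2 D2)%E by rewrite mule_ge0 ?lee_fin.
  rewrite ge0_integralZl //.
  rewrite integral_indic // setIT.
  have fin2 : m2 D2 \is a fin_num by rewrite ge0_fin_numE.
  by apply: lte_mul_pinfty => //; rewrite fin_numM.
have patchI (T : Type) (D : set T) (h : T -> R) : h \_ D = (fun x => \1_D x * h x).
  by rewrite patch_indic; apply/funext => x /=; rewrite mulrC.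
have E1 : \int[m1]_(x in D1) (\int[m2]_(y in D2) f (x, y)) =
    fine (\int[m1]_x \int[m2]_y (g (x, y))%:E)%E.
  rewrite Rintegral_mkcond patchI /Rintegral; congr fine; apply: eq_integral => x _.
  rewrite -[RHS]fineK; last exact: integrable_fin_num.
  congr EFin; rewrite -[RHS]/(Rintegral m2 setT (fun y => g (x, y))).
  rewrite [X in _ * X]Rintegral_mkcond patchI /g /= indicE; case: (_ \in _).
    by rewrite mul1r; apply: eq_Rintegral => y _; rewrite mul1r.
  rewrite mul0r; under eq_Rintegral do rewrite mul0r.
  by rewrite /Rintegral integral0.
have E2 : \int[m2]_(y in D2) (\int[m1]_(x in D1) f (x, y)) =
    fine (\int[m2]_y \int[m1]_x (g (x, y))%:E)%E.
  rewrite Rintegral_mkcond patchI /Rintegral; congr fine; apply: eq_integral => y _.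
  rewrite -[RHS]fineK; last exact: integrable_fin_num.
  congr EFin; rewrite -[RHS]/(Rintegral m1 setT (fun x => g (x, y))).
  rewrite [X in _ * X]Rintegral_mkcond patchI /g /= indicE; case: (_ \in _).
    by rewrite mul1r; apply: eq_Rintegral => x _; rewrite mul1r.
  rewrite mul0r; under eq_Rintegral do rewrite mul0r mulr0.
  by rewrite /Rintegral integral0.
by rewrite E1 E2; congr fine; exact: (Fubini int).
Qed.

End FubiniBounded.

(** * The Fejer kernel: size, mass, tails, primitive *)

Section FejerKernel.
Context {R : realType}.
Local Notation leb := (@lebesgue_measure R).
Local Notation I01 := (`]0 : R, 1]%classic).

(* Up to a factor 2 this is Fejer's kernel; its Fourier transform is the
   triangle function, supported in [-1, 1]. *)
Definition fejer (y : R) : R := \int[leb]_(t in I01) ((1 - t) * cos (t * y)).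

Lemma Rintegral_FTC2 (f F : R -> R) (a b : R) : a < b ->
  (forall x : R, is_derive x (1 : R) F (f x)) -> continuous f ->
  \int[leb]_(x in `]a, b]) f x = F b - F a.
Proof.
move=> ab dF cf.
have cF : continuous F.
  by move=> x; apply/differentiable_continuous/derivable1_diffP; have [] := dF x.
have wcf : {within `[a, b], continuous f} by exact: continuous_subspaceT.
rewrite Rintegral_itv_obnd_cbnd; last first.
  apply: integrableS (continuous_compact_integrable _ wcf) => //; last exact: segment_compact.
  by apply: subset_itv; rewrite bnd_simp.
rewrite /Rintegral (@continuous_FTC2 _ _ F) //.
- split; first by move=> x _; have [] := dF x.
  + by apply: cvg_at_right_filter; exact: cF.
  + by apply: cvg_at_left_filter; exact: cF.
- by move=> x _; rewrite derive1E; have -> := @derive_val _ _ _ _ _ _ _ (dF x).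
Qed.

Lemma continuous_cosM (y : R) : continuous (fun t : R => cos (t * y)).
Proof.
by move=> t; apply/differentiable_continuous/derivable1_diffP; apply: ex_derive.
Qed.

Let lebI : (leb I01 < +oo)%E.
Proof. by rewrite lebesgue_measure_itv /= lte_fin ltr01 -EFinD ltry. Qed.

Let bounded_I01 (f : R -> R) (c : R) : measurable_fun setT f ->
  (forall t, I01 t -> `|f t| <= c) -> leb.-integrable I01 (EFin \o f).
Proof.
move=> mf fc; apply: measurable_bounded_integrable => //; first exact: measurable_funTS.
exists c; split; first exact: num_real.
by move=> x cx t It; apply: le_trans (fc t It) (ltW cx).
Qed.

Let kernel_bound (y t : R) : I01 t -> `|(1 - t) * cos (t * y)| <= 1.
Proof.
rewrite /= in_itv /= => /andP[t0 t1]; rewrite normrM.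
have := cos_max (t * y); have : `|1 - t| <= 1 by rewrite ger0_norm; lra.
move=> h1 h2; rewrite -[leRHS]mul1r; exact: ler_pM.
Qed.

Let measurable_kernel_t (y : R) : measurable_fun setT (fun t : R => (1 - t) * cos (t * y)).
Proof.
apply: measurable_funM; first by apply: measurable_funB => //; exact: measurable_cst.
by apply: continuous_measurable_fun; exact: continuous_cosM.
Qed.

Let int_kernel y : leb.-integrable I01 (EFin \o (fun t : R => (1 - t) * cos (t * y))).
Proof. exact: bounded_I01 (measurable_kernel_t y) (kernel_bound y). Qed.

Lemma fejer_le1 y : `|fejer y| <= 1.
Proof.
apply: le_trans (le_normr_Rintegral _ (int_kernel y)) _ => //.
have i1 : leb.-integrable I01 (EFin \o (fun t : R => `|(1 - t) * cos (t * y)|)).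
  exact: integrable_norm (int_kernel y).
have i2 : leb.-integrable I01 (EFin \o (cst 1 : R -> R)).
  by apply: (bounded_I01 _ 1) => // t _; rewrite normr1.
apply: le_trans (le_Rintegral _ i1 i2 _) _ => //.
  by move=> t It; exact: kernel_bound.
rewrite /cst Rintegral_cst //= lebesgue_measure_itv /= lte_fin ltr01 /=; lra.
Qed.

Lemma fejerE y : y != 0 -> fejer y = (1 - cos y) / y ^+ 2.
Proof.
move=> y0.
have D t : is_derive t (1 : R)
    (fun t : R => (1 - t) * sin (t * y) / y - cos (t * y) / y ^+ 2)
    ((1 - t) * cos (t * y)).
  by apply: is_derive_eq; rewrite /GRing.scale /=; field.
rewrite /fejer (@Rintegral_FTC2 _ _ 0 1 _ D) //.
  by rewrite !mul0r mul1r cos0 sin0; field.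
move=> t; apply: cvgM; first by apply: cvgB; [exact: cvg_cst|exact: cvg_id].
exact: continuous_cosM.
Qed.

Lemma fejer_ge0 y : 0 <= fejer y.
Proof.
have [->|y0] := eqVneq y 0.
  apply: Rintegral_ge0 => t; rewrite /= in_itv /= => /andP[t0 t1].
  by rewrite mulr0 cos0; lra.
by rewrite fejerE // divr_ge0 ?sqr_ge0 // subr_ge0 cos_le1.
Qed.

Lemma fejer_le y : fejer y <= 4 * (oneDsqr y)^-1.
Proof.
have o1 : 0 < oneDsqr y by apply: lt_le_trans (oneDsqr_ge1 y).
rewrite ler_pdivlMr // /oneDsqr.
have := sqr_ge0 y => y20.
have [h|h] := leP `|y| 1.
  have y1 : y ^+ 2 <= 1 by rewrite -real_normK ?num_real // exprn_ile1.
  have := fejer_ge0 y; have := le_trans (ler_norm _) (fejer_le1 y) => f1 f0.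
  have : 0 <= (1 - fejer y) * (1 + y ^+ 2) by rewrite mulr_ge0 //; lra.
  by lra.
have y0 : y != 0 by apply: contraTN h => /eqP ->; rewrite normr0; lra.
have y1 : 1 <= y ^+ 2 by rewrite -real_normK ?num_real // exprn_ege1 // ltW.
rewrite fejerE // mulrAC ler_pdivrMr; last by lra.
have := cos_geN1 y => hc.
have : 0 <= (1 + cos y) * (1 + y ^+ 2) by rewrite mulr_ge0 //; lra.
by lra.
Qed.

Lemma fejer_lower y : 0 < y <= 1 -> 1 / 3 <= fejer y.
Proof.
move=> /andP[y0 y1]; rewrite fejerE ?gt_eqF //.
rewrite ler_pdivlMr ?exprn_gt0 //.
have := cos_le_cubic y (ltW y0).
have : 0 <= y ^+ 2 * (1 - y) by rewrite mulr_ge0 ?sqr_ge0 // subr_ge0.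
by lra.
Qed.

(** The inverse square is written with [powR], a measurable function. At 0 the first term vanishes,
    as [1 - cos 0 = 0], and the indicator restores the value. *)
Lemma measurable_fejer : measurable_fun setT fejer.
Proof.
rewrite (_ : fejer = fun y => (1 - cos y) * powR (y ^+ 2) (-1) + fejer 0 * \1_[set 0] y).
  apply: measurable_funD.
    apply: measurable_funM.
      apply: measurable_funB; first exact: measurable_cst.
      by apply: continuous_measurable_fun; exact: continuous_cos.
    apply: (@measurableT_comp _ _ _ _ _ _ (fun x : R => powR x (-1)) _ (fun y : R => y ^+ 2)) => //.
  apply: measurable_funM; first exact: measurable_cst.
  by apply: measurable_indic.
apply/funext => y; have [->|y0] := eqVneq y 0.
  by rewrite cos0 subrr mul0r add0r indicE mem_set // mulr1.
rewrite fejerE // powR_inv1 ?sqr_ge0 // indicE memNset ?mulr0 ?addr0 //.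
by move=> /eqP; rewrite (negbTE y0).
Qed.

Lemma integrable_oneDsqrV : leb.-integrable setT (EFin \o (fun y : R => (oneDsqr y)^-1)).
Proof.
have o1 y : 0 <= (oneDsqr y)^-1 :> R.
  by rewrite invr_ge0; apply: le_trans (oneDsqr_ge1 y).
have co : continuous (fun y : R => (oneDsqr y)^-1) by exact: continuous_oneDsqrV.
apply/integrableP; split.
  by apply/measurable_EFinP; exact: continuous_measurable_fun.
under eq_integral do rewrite /= ger0_norm //.
rewrite ge0_symfun_integralT //; last by move=> y /=; rewrite /oneDsqr sqrrN.
rewrite (_ : [set x | 0 <= x] = `[0, +oo[%classic); last first.
  by apply/seteqP; split => x /=; rewrite in_itv /= andbT.
by rewrite integral0y_oneDsqr -EFinM ltry.
Qed.

Lemma integrable_fejer : leb.-integrable setT (EFin \o fejer).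
Proof.
have := @integrableZl _ _ _ _ _ measurableT 4 _ integrable_oneDsqrV.
apply: le_integrable => //; first by apply/measurable_EFinP; exact: measurable_fejer.
move=> y _ /=; rewrite lee_fin ger0_norm ?fejer_ge0 // ger0_norm ?fejer_le //.
Qed.

Definition fejer_mass : R := Rintegral leb setT fejer.

Lemma fejer_mass_gt0 : 0 < fejer_mass.
Proof.
apply: (@lt_le_trans _ _ (1 / 3)); first lra.
rewrite -lee_fin /fejer_mass /Rintegral fineK; last exact: integrable_fin_num integrable_fejer.
have mI : measurable I01 by exact: measurable_itv.
have Emf : measurable_fun setT (EFin \o fejer) by apply/measurable_EFinP; exact: measurable_fejer.
apply: (@le_trans _ _ (\int[leb]_(y in I01) (fejer y)%:E)%E); last first.
  apply: ge0_subset_integral => //; last by move=> y _; rewrite lee_fin fejer_ge0.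
apply: (@le_trans _ _ (\int[leb]_(y in I01) (cst (1 / 3)%:E) y)%E).
  by rewrite integral_cst //= lebesgue_measure_itv /= lte_fin ltr01 -EFinD -EFinM lee_fin; lra.
apply: ge0_le_integral => //.
- by move=> y _; rewrite lee_fin; lra.
- exact: measurable_funTS.
- by move=> y; rewrite /= in_itv /= => yI; rewrite lee_fin fejer_lower.
Qed.

Lemma fejer_tail (e : R) : 0 < e -> exists2 h0 : R, 0 < h0 &
  Rintegral leb setT (fun y => fejer y * \1_[set z : R | h0 < `|z|] y) <= e.
Proof.
move=> e0.
pose A (n : nat) := [set z : R | n.+1%:R < `|z|].
pose f_ (n : nat) (y : R) := (fejer y * \1_(A n) y)%:E.
have mA n : measurable (A n).
  have := @normr_measurable R setT measurableT `]n.+1%:R, +oo[%classic (measurable_itv _).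
  rewrite setTI; congr measurable; apply/seteqP; split => y /=;
    by rewrite in_itv /= andbT.
have i01 n y : 0 <= (\1_(A n) y : R) <= 1.
  by rewrite indicE; case: (_ \in _); rewrite /= ?lexx ?ler01.
have mf n : measurable_fun setT (f_ n).
  apply/measurable_EFinP; apply: measurable_funM; first exact: measurable_fejer.
  exact: measurable_indic.
have ff (y : R) : setT y -> f_ ^~ y @ \oo --> (cst 0%E : R -> \bar R) y.
  move=> _; apply: cvg_near_cst; exists (Num.truncn `|y|) => // n /= yn.
  rewrite /f_ indicE memNset ?mulr0 //= /A /=; apply/negP; rewrite -leNgt ltW //.
  by apply: lt_le_trans (truncnS_gt _) _; rewrite ler_nat ltnS.
have absf n (y : R) : setT y -> (`|f_ n y| <= (fejer y)%:E)%E.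
  move=> _; rewrite /f_ /= lee_fin normrM ger0_norm ?fejer_ge0 //.
  have /andP[a b] := i01 n y.
  by rewrite ger0_norm // ler_piMr // fejer_ge0.
have fing (y : R) : setT y -> (EFin \o fejer) y \is a fin_num by [].
have := @dominated_cvg _ _ _ leb setT measurableT f_ (cst 0%E) (EFin \o fejer)
  mf ff fing integrable_fejer absf.
rewrite integral0 => /fine_cvg /cvgrPdist_lt /(_ e e0) [n _ /(_ n (leqnn n))] /= hn.
exists n.+1%:R => //; apply: le_trans (ltW hn).
by rewrite sub0r normrN; exact: ler_norm.
Qed.

Lemma integrable_Mfejer (H : R -> R) (c : R) : measurable_fun setT H ->
  (forall y, `|H y| <= c) -> leb.-integrable setT (EFin \o (fun y => H y * fejer y)).
Proof.
move=> mH Hc; have := @integrableZl _ _ _ _ _ measurableT c _ integrable_fejer.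
apply: le_integrable => //.
  by apply/measurable_EFinP; apply: measurable_funM => //; exact: measurable_fejer.
move=> y _ /=; rewrite lee_fin !normrM ler_wpM2r //.
by apply: le_trans (Hc y) (ler_norm _).
Qed.

(** The lower bound [a] is used for [|y| <= h0] and only [- eta] beyond, so the loss is [a + eta]
    times the tail of the kernel. *)
Lemma smoothing_lower (H : R -> R) (a eta h0 : R) : measurable_fun setT H ->
  (forall y, `|H y| <= eta) -> (forall y, `|y| <= h0 -> a <= H y) ->
  a * fejer_mass - (a + eta) *
    Rintegral leb setT (fun y => fejer y * \1_[set z : R | h0 < `|z|] y)
  <= Rintegral leb setT (fun y => H y * fejer y).
Proof.
move=> mH He Ha; set A := [set z : R | h0 < `|z|].
have mA : measurable A.
  have := @normr_measurable R setT measurableT `]h0, +oo[%classic (measurable_itv _).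
  rewrite setTI; congr measurable; apply/seteqP; split => y /=;
    by rewrite in_itv /= andbT.
have i1 : leb.-integrable setT (EFin \o (fun y => \1_A y * fejer y)).
  apply: (integrable_Mfejer _ 1); first exact: measurable_indic.
  by move=> y; rewrite indicE; case: (_ \in _); rewrite ?normr1 ?normr0.
have i1' : leb.-integrable setT (EFin \o (fun y => fejer y * \1_A y)).
  by move: i1; congr (_.-integrable _ _); apply/funext => y /=; rewrite mulrC.
have i2 := integrable_fejer; have i3 := integrable_Mfejer _ _ mH He.
have i2a := integrable_EFinZl leb a _ i2.
have i1a := integrable_EFinZl leb (a + eta) _ i1'.
rewrite /fejer_mass -!RintegralZl // -RintegralB //.
apply: le_Rintegral => //.
  rewrite (_ : EFin \o _ = (fun y => (a * fejer y)%:E - ((a + eta) * (fejer y * \1_A y))%:E)%E).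
    exact: integrableB.
  by apply/funext => y.
move=> y _; have f0 := fejer_ge0 y.
rewrite indicE; case: (boolP (y \in A)) => yA.
  rewrite mulr1 -mulrBl ler_wpM2r //.
  by have := He y; rewrite ler_norml => /andP[]; lra.
rewrite mulr0 mulr0 subr0 ler_wpM2r //; apply: Ha.
by rewrite notin_setE /A /= in yA; move/negP : yA; rewrite -leNgt.
Qed.

Lemma fejer_increment (a b : R) : a <= b ->
  \int[leb]_(y in `]a, b]) fejer y =
  \int[leb]_(t in I01) ((1 - t) * powR t (-1) * (sin (t * b) - sin (t * a))).
Proof.
rewrite le_eqVlt => /predU1P[<-|ab].
  rewrite set_itv_ge ?Rintegral_set0; last by rewrite bnd_simp ltxx.
  by under eq_Rintegral do rewrite subrr mulr0; rewrite /Rintegral integral0.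
have lab : (leb `]a, b] < +oo)%E.
  by rewrite lebesgue_measure_itv /= lte_fin ab -EFinD ltry.
have mf : measurable_fun setT (fun z : R * R => (1 - z.2) * cos (z.2 * z.1)).
  apply: measurable_funM.
    by apply: measurable_funB; [exact: measurable_cst|exact: measurable_snd].
  apply: (@measurableT_comp _ _ _ _ _ _ (@cos R)).
    by apply: continuous_measurable_fun; exact: continuous_cos.
  by apply: measurable_funM; [exact: measurable_snd|exact: measurable_fst].
rewrite /fejer; have := @Rintegral_swap R _ _ _ _ leb leb `]a, b]%classic I01 _ 1
  (measurable_itv _) (measurable_itv _) lab lebI mf => /= ->; last first.
  by move=> y t _; exact: kernel_bound.
apply: eq_Rintegral => t; rewrite inE /= in_itv /= => /andP[t0 t1].
have D y : is_derive y (1 : R) (fun y : R => (1 - t) / t * sin (t * y))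
    ((1 - t) * cos (t * y)).
  by apply: is_derive_eq; rewrite /GRing.scale /=; field; rewrite gt_eqF.
rewrite (@Rintegral_FTC2 _ _ a b ab D); last first.
  by move=> y; apply/differentiable_continuous/derivable1_diffP; apply: ex_derive.
by rewrite powR_inv1 ?(ltW t0) //; ring.
Qed.

End FejerKernel.

Lemma sinB_le {R : realType} (a b : R) : a <= b -> `|sin b - sin a| <= b - a.
Proof.
move=> ab; have [|c _ ->] := @MVT_segment R sin cos a b ab (fun z _ => is_derive_sin z).
  by apply: continuous_subspaceT => z; exact: continuous_sin.
rewrite normrM (ger0_norm (x := b - a)) ?subr_ge0 // ler_piMl ?subr_ge0 //.
by rewrite ler_norml cos_geN1 cos_le1.
Qed.

Lemma Rintegral_cst_prob {R : realType} {d : measure_display} {T : measurableType d}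
  (m : probability T R) (c : R) : Rintegral m setT (fun=> c) = c.
Proof.
rewrite Rintegral_cst // (_ : fine _ = 1) ?mulr1 //.
by transitivity (fine (1%E : \bar R)) => //; congr fine; exact: probability_setT.
Qed.

Lemma integrable_cst_prob {R : realType} {d : measure_display} {T : measurableType d}
  (m : probability T R) (c : R) : m.-integrable setT (EFin \o (fun=> c)).
Proof.
apply: measurable_bounded_integrable => //.
  by rewrite (le_lt_trans (probability_le1 _ _)) ?ltry.
exists `|c|; split; first exact: num_real.
by move=> M M2 w _ /=; exact: ltW.
Qed.

(** Adding the bound [c] makes the integrand nonnegative, so that Tonelli's theorem provides
    measurability. *)
Lemma measurable_Rintegral_param {R : realType} {d1 d2 : measure_display}
    {T1 : measurableType d1} {T2 : measurableType d2} (m : probability T1 R)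
    (f : T1 * T2 -> R) (c : R) : measurable_fun setT f -> (forall z, `|f z| <= c) ->
  measurable_fun setT (fun y => Rintegral m setT (fun x => f (x, y))).
Proof.
move=> mf fc.
have f0 z : 0 <= f z + c by have := fc z; rewrite ler_norml => /andP[]; lra.
have mg : measurable_fun setT (fun z => (f z + c)%:E).
  by apply/measurable_EFinP; apply: measurable_funD => //; exact: measurable_cst.
have mF := measurable_fun_fubini_tonelli_G (m1 := m) (fun z => (f z + c)%:E) mg
  (fun z => f0 z).
have i1 y : m.-integrable setT (fun x => (f (x, y))%:E).
  apply: measurable_bounded_integrable => //.
  - by rewrite (le_lt_trans (probability_le1 _ _)) ?ltry.
  - exact: (measurableT_comp mf (measurable_pair2 _)).
  exists c; split; first exact: num_real.
  by move=> M M2 w _ /=; apply: le_trans (ltW M2).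
rewrite (_ : (fun y => _) = (fun y =>
   fine (\int[m]_x (f (x, y) + c)%:E)%E - c)).
  apply: measurable_funB; last exact: measurable_cst.
  exact: measurableT_comp.
apply/funext => y.
rewrite -[fine _]/(Rintegral m setT (fun x => f (x, y) + c)) RintegralD //.
  have -> : Rintegral m setT (fun=> c) = c.
    exact: Rintegral_cst_prob.
  by rewrite addrK.
- exact: i1.
- exact: integrable_cst_prob.
Qed.

(** * Fourier formula for increments of a smoothed distribution function *)

Section SmoothedDistribution.
Context {R : realType} {d : measure_display} {T : measurableType d}.
Context (m : probability T R) (X : T -> R).
Hypothesis mX : measurable_fun setT X.
Local Notation leb := (@lebesgue_measure R).
Local Notation I01 := (`]0 : R, 1]%classic).

Definition rcdf (x : R) : R := fine (m [set w | X w <= x]).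

Lemma measurable_le_set (x : R) : measurable [set w | X w <= x].
Proof.
have := mX measurableT `]-oo, x]%classic (measurable_itv _).
by rewrite setTI; congr measurable; apply/seteqP; split => w /=; rewrite in_itv.
Qed.

Lemma rcdf_fin x : m [set w | X w <= x] = (rcdf x)%:E.
Proof. by rewrite /rcdf fineK // fin_num_measure //; exact: measurable_le_set. Qed.

Lemma rcdf01 x : 0 <= rcdf x <= 1.
Proof.
by rewrite -2!lee_fin -rcdf_fin measure_ge0 probability_le1 //; exact: measurable_le_set.
Qed.

Lemma rcdf_le x y : x <= y -> rcdf x <= rcdf y.
Proof.
move=> xy; rewrite -lee_fin -!rcdf_fin le_measure ?inE //; try exact: measurable_le_set.
by move=> w /= /le_trans; apply.
Qed.

Lemma measurable_rcdf : measurable_fun setT rcdf.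
Proof. by apply: nondecreasing_measurable => // x y; exact: rcdf_le. Qed.

Lemma rcdf_cvgNy (e : R) : 0 < e -> exists x, rcdf x <= e.
Proof.
move=> e0.
pose A (n : nat) := [set w | X w <= - n%:R].
have mA n : measurable (A n) by exact: measurable_le_set.
have cA : (m (A n) @[n --> \oo] --> m (\bigcap_n A n))%E.
  apply: nonincreasing_cvg_mu => //.
  - by apply: le_lt_trans (probability_le1 _ _) _; rewrite ?ltry.
  - exact: bigcap_measurable.
  - move=> n k nk; apply/subsetPset => w; rewrite /A /= => /le_trans; apply.
    by rewrite lerN2 ler_nat.
have A0 : \bigcap_n A n = set0.
  apply/seteqP; split => // w /(_ (Num.truncn `|X w|).+1 Logic.I); rewrite /A /= => h.
  have := truncnS_gt `|X w|; have := ler_norm (- X w); rewrite normrN.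
  by move: h; lra.
rewrite A0 measure0 in cA.
move: cA => /fine_cvg /cvgrPdist_le /(_ e e0) [n _ /(_ n (leqnn n))] /=.
rewrite sub0r normrN => h; exists (- n%:R).
exact: le_trans (ler_norm _) h.
Qed.

Definition rphi (t : R) : R[i] := cint m (fun w => expi (t * X w)).

Lemma integrable_trig (f : R -> R) (c t : R) : continuous f -> (forall x, `|f x| <= 1) ->
  m.-integrable setT (EFin \o (fun w => f (t * (c - X w)))).
Proof.
move=> cf f1; apply: measurable_bounded_integrable => //.
- by rewrite (le_lt_trans (probability_le1 _ _)) ?ltry.
- apply: (@measurableT_comp _ _ _ _ _ _ f); first exact: continuous_measurable_fun.
  apply: measurable_funM; first exact: measurable_cst.
  by apply: measurable_funB; first exact: measurable_cst.
exists 1; split; first exact: num_real.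
by move=> M M2 w _ /=; apply: le_trans (ltW M2).
Qed.

Lemma norm_sin_le1 (z : R) : `|sin z| <= 1.
Proof. by rewrite ler_norml sin_geN1 sin_le1. Qed.

Lemma norm_cos_le1 (z : R) : `|cos z| <= 1.
Proof. by rewrite ler_norml cos_geN1 cos_le1. Qed.

Lemma integrable_sin (c t : R) :
  m.-integrable setT (EFin \o (fun w => sin (t * (c - X w)))).
Proof. apply: integrable_trig; [exact: continuous_sin|exact: norm_sin_le1]. Qed.

Lemma integrable_cos (c t : R) :
  m.-integrable setT (EFin \o (fun w => cos (t * (c - X w)))).
Proof. apply: integrable_trig; [exact: continuous_cos|exact: norm_cos_le1]. Qed.

Lemma Rintegral_sin (x t : R) : Rintegral m setT (fun w => sin (t * (x - X w))) =
  sin (t * x) * complex.Re (rphi t) - cos (t * x) * complex.Im (rphi t).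
Proof.
have is0 : m.-integrable setT (EFin \o (fun w => sin (t * X w))).
  have := integrable_sin 0 (- t); congr (_.-integrable _ _).
  by apply/funext => w /=; congr (EFin (sin _)); ring.
have ic0 : m.-integrable setT (EFin \o (fun w => cos (t * X w))).
  have := integrable_cos 0 (- t); congr (_.-integrable _ _).
  by apply/funext => w /=; congr (EFin (cos _)); ring.
rewrite /rphi /= -!RintegralZl // -RintegralB //; try exact: integrable_EFinZl.
by apply: eq_Rintegral => w _; rewrite mulrBr sinB.
Qed.

Lemma measurable_sin_integral (x : R) :
  measurable_fun setT (fun t : R => Rintegral m setT (fun w => sin (t * (x - X w)))).
Proof.
apply: (measurable_Rintegral_param m (fun z : T * R => sin (z.2 * (x - X z.1))) 1).
  apply: (@measurableT_comp _ _ _ _ _ _ (@sin R)).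
    by apply: continuous_measurable_fun; exact: continuous_sin.
  apply: measurable_funM; first exact: measurable_snd.
  apply: measurable_funB; first exact: measurable_cst.
  by apply: measurableT_comp => //; exact: measurable_fst.
by move=> z; exact: norm_sin_le1.
Qed.

Definition sin_incr (x' x t : R) : R := (1 - t) * powR t (-1) *
  (Rintegral m setT (fun w => sin (t * (x - X w))) -
   Rintegral m setT (fun w => sin (t * (x' - X w)))).

Lemma sin_incr_le (x' x t : R) : x' <= x -> 0 < t <= 1 -> `|sin_incr x' x t| <= x - x'.
Proof.
move=> xx' /andP[t0 t1]; rewrite /sin_incr.
rewrite powR_inv1 ?(ltW t0) // !normrM normfV (gtr0_norm t0) ger0_norm ?subr_ge0 //.
rewrite -RintegralB //; try exact: integrable_sin.
have h : `|Rintegral m setT (fun w => sin (t * (x - X w)) - sin (t * (x' - X w)))| <= t * (x - x').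
  have iB := integrableB measurableT (integrable_sin x t) (integrable_sin x' t).
  apply: le_trans (le_normr_Rintegral _ iB) _ => //.
  have -> : t * (x - x') = Rintegral m setT (fun=> t * (x - x')).
    by rewrite Rintegral_cst_prob.
  apply: le_Rintegral => //; first exact: integrable_abse iB.
    exact: integrable_cst_prob.
  move=> w _; have := sinB_le (t * (x' - X w)) (t * (x - X w)).
  by rewrite ler_pM2l // lerD2r => /(_ xx') /le_trans; apply; rewrite -mulrBr; apply: ler_wpM2l; lra.
have -> : x - x' = 1 * (t^-1 * (t * (x - x'))) by field; rewrite gt_eqF.
rewrite -mulrA ler_pM ?mulr_ge0 ?invr_ge0 ?(ltW t0) ?subr_ge0 //; first by lra.
by rewrite ler_wpM2l ?invr_ge0 ?(ltW t0).
Qed.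

Lemma integrable_sin_incr (x' x : R) : x' <= x ->
  leb.-integrable I01 (EFin \o sin_incr x' x).
Proof.
move=> xx'; have lebI : (leb I01 < +oo)%E.
  by rewrite lebesgue_measure_itv /= lte_fin ltr01 -EFinD ltry.
apply: measurable_bounded_integrable => //.
- apply: measurable_funTS; apply: measurable_funM; last first.
    by apply: measurable_funB; exact: measurable_sin_integral.
  by apply: measurable_funM => //; apply: measurable_funB.
exists (x - x'); split; first exact: num_real.
move=> M M2 t; rewrite /= in_itv /= => t01; apply: le_trans (ltW M2).
exact: sin_incr_le.
Qed.

(** Integrate the indicator of [x' - y < X <= x - y] against the kernel in both orders. With
    increments, the integrand [(1 - t) / t] times a difference of sines is at most [x - x']
    uniformly in [X], so the second exchange of integrals needs no moment of [X]. *)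
Lemma smoothed_increment (x' x : R) : x' <= x ->
  Rintegral leb setT (fun y => (rcdf (x - y) - rcdf (x' - y)) * fejer y) =
  \int[leb]_(t in I01) sin_incr x' x t.
Proof.
move=> xx'.
pose A := [set z : T * R | (x' - z.2 < X z.1) && (X z.1 <= x - z.2)].
pose k (z : T * R) := \1_A z * fejer z.2.
have mXz : measurable_fun setT (fun z : T * R => X z.1).
  by apply: measurableT_comp => //; exact: measurable_fst.
have mxz c : measurable_fun setT (fun z : T * R => c - z.2).
  by apply: measurable_funB; [exact: measurable_cst|exact: measurable_snd].
have mA : measurable A.
  have h1 := measurable_fun_ltr (mxz x') mXz; have h2 := measurable_fun_ler mXz (mxz x).
  have := measurable_and h1 h2 => /(_ measurableT [set true] Logic.I).
  by rewrite setTI; congr measurable; apply/seteqP; split => z.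
have mk : measurable_fun setT k.
  apply: measurable_funM; first exact: measurable_indic.
  by apply: measurableT_comp; [exact: measurable_fejer|exact: measurable_snd].
have k0 z : 0 <= k z by rewrite mulr_ge0 ?fejer_ge0 // indicE.
have mf : measurable_fun setT (fun z => (k z)%:E) by exact/measurable_EFinP.
have FT := fubini_tonelli (m1 := m) (m2 := leb) (fun z => (k z)%:E) mf (fun z => k0 z).
have inner1 y : (\int[m]_w (k (w, y))%:E = ((rcdf (x - y) - rcdf (x' - y)) * fejer y)%:E)%E.
  rewrite /k /=; under eq_integral do rewrite mulrC EFinM.
  have AyE : [set w | (x' - y < X w) && (X w <= x - y)] =
      [set w | X w <= x - y] `\` [set w | X w <= x' - y].
    apply/seteqP; split => w /=; first by move=> /andP[h1 h2]; split => //; apply/negP; rewrite -ltNge.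
    by move=> [h1 /negP]; rewrite -ltNge => h2; rewrite h1 h2.
  have mAy : measurable [set w | (x' - y < X w) && (X w <= x - y)].
    by rewrite AyE; apply: measurableD; exact: measurable_le_set.
  rewrite (_ : (fun w => _) = (fun w => (fejer y)%:E *
     (\1_([set w | (x' - y < X w) && (X w <= x - y)]) w)%:E)%E); last first.
    by apply/funext => w; rewrite !indicE.
  have i0 w : (0 <= (\1_([set w | (x' - y < X w) && (X w <= x - y)]) w : R)%:E)%E.
    by rewrite lee_fin indicE.
  have mi : measurable_fun setT (fun w => (\1_([set w | (x' - y < X w) && (X w <= x - y)]) w : R)%:E).
    by apply/measurable_EFinP; exact: measurable_indic.
  rewrite ge0_integralZl ?lee_fin ?fejer_ge0 //.
  rewrite integral_indic // setIT EFinM muleC; congr (_ * _)%E.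
  rewrite EFinB -!rcdf_fin AyE measureD ?setIidr //; try exact: measurable_le_set.
  - by move=> w /= /le_trans; apply; rewrite lerD2r.
  - by rewrite (le_lt_trans (probability_le1 _ _)) ?ltry //; exact: measurable_le_set.
have inner2 w : (\int[leb]_y (k (w, y))%:E =
    (\int[leb]_(y in `]x' - X w, x - X w]) fejer y)%:E)%E.
  have mI : measurable (`]x' - X w, x - X w]%classic : set R) by exact: measurable_itv.
  have iI : leb.-integrable `]x' - X w, x - X w] (EFin \o fejer).
    by apply: (integrableS _ _ _ integrable_fejer).
  rewrite /Rintegral fineK; last by apply: integrable_fin_num.
  rewrite [RHS]integral_mkcond; apply: eq_integral => y _.
  rewrite patchE /k /= indicE.
  have -> : (y \in `]x' - X w, x - X w]%classic) = ((w, y) \in A).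
    apply/idP/idP; rewrite !inE /A /= in_itv /= => /andP[h1 h2]; apply/andP; split; lra.
  by case: ifP => _; rewrite ?mul1r ?mul0r.
have -> : Rintegral leb setT (fun y => (rcdf (x - y) - rcdf (x' - y)) * fejer y) =
    fine (\int[leb]_y \int[m]_w (k (w, y))%:E)%E.
  by rewrite /Rintegral; congr fine; apply: eq_integral => y _; rewrite inner1.
rewrite -FT.
under eq_integral do rewrite inner2 fejer_increment ?lerD2r //.
have mf2 : measurable_fun setT (fun z : T * R =>
    (1 - z.2) * powR z.2 (-1) * (sin (z.2 * (x - X z.1)) - sin (z.2 * (x' - X z.1)))).
  have ms c : measurable_fun setT (fun z : T * R => sin (z.2 * (c - X z.1))).
    apply: (@measurableT_comp _ _ _ _ _ _ (@sin R)).
      by apply: continuous_measurable_fun; exact: continuous_sin.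
    apply: measurable_funM; first exact: measurable_snd.
    by apply: measurable_funB; first exact: measurable_cst.
  apply: measurable_funM; last exact: measurable_funB.
  apply: measurable_funM; first exact: mxz.
  have mp := @measurable_powR R (-1).
  exact: (@measurableT_comp _ _ _ _ _ _ (fun u : R => powR u (-1)) _ (fun z : T * R => z.2) mp measurable_snd).
have lebI : (leb I01 < +oo)%E.
  by rewrite lebesgue_measure_itv /= lte_fin ltr01 -EFinD ltry.
have mT : (m setT < +oo)%E by rewrite (le_lt_trans (probability_le1 _ _)) ?ltry.
rewrite -[LHS]/(Rintegral m setT (fun w => \int[leb]_(t in I01)
   ((1 - t) * powR t (-1) * (sin (t * (x - X w)) - sin (t * (x' - X w)))))).
have := @Rintegral_swap R _ _ _ _ m leb setT I01 _ (x - x') measurableT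
  (measurable_itv _) mT lebI mf2 => /= ->; last first.
  move=> w t _; rewrite /= in_itv /= => /andP[t0 t1].
  rewrite powR_inv1 ?(ltW t0) // !normrM normfV (gtr0_norm t0) ger0_norm ?subr_ge0 //.
  have := sinB_le (t * (x' - X w)) (t * (x - X w)).
  rewrite ler_pM2l // lerD2r => /(_ xx') h.
  have -> : x - x' = t^-1 * (t * (x - X w) - t * (x' - X w)) by field; rewrite gt_eqF.
  rewrite -mulrA -[leRHS]mul1r ler_pM ?mulr_ge0 ?invr_ge0 ?(ltW t0) ?subr_ge0 //; first by lra.
  by rewrite ler_wpM2l ?invr_ge0 ?(ltW t0).
apply: eq_Rintegral => t _.
rewrite /sin_incr -RintegralB //; try exact: integrable_sin.
have iB := integrableB measurableT (integrable_sin x t) (integrable_sin x' t).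
by rewrite RintegralZl.
Qed.

End SmoothedDistribution.

(** * Esseen's inequality with explicit constants *)

Section Esseen.
Context {R : realType}.
Local Notation leb := (@lebesgue_measure R).
Local Notation I01 := (`]0 : R, 1]%classic).

Lemma measurable_rcdf_shift {d} {T : measurableType d} (m : probability T R) (X : T -> R) :
  measurable_fun setT X -> forall x : R, measurable_fun setT (fun y : R => rcdf m X (x - y)).
Proof.
move=> mX x; apply: (@measurableT_comp _ _ _ _ _ _ (rcdf m X)); first exact: measurable_rcdf.
by apply: measurable_funB; first exact: measurable_cst.
Qed.

Lemma rcdf_norm {d} {T : measurableType d} (m : probability T R) (X : T -> R) x :
  measurable_fun setT X -> `|rcdf m X x| <= 1.
Proof. by move=> mX; rewrite ger0_norm; have /andP[] := rcdf01 m X mX x. Qed.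

Lemma rcdfB_norm {d d'} {T : measurableType d} {T' : measurableType d'}
    (m : probability T R) (X : T -> R) (m' : probability T' R) (X' : T' -> R) x y :
  measurable_fun setT X -> measurable_fun setT X' -> `|rcdf m X x - rcdf m' X' y| <= 1.
Proof.
move=> mX mX'; have /andP[] := rcdf01 m X mX x; have /andP[] := rcdf01 m' X' mX' y.
by rewrite ler_norml => *; apply/andP; split; lra.
Qed.

Definition rsmooth {d1 d2} {T1 : measurableType d1} {T2 : measurableType d2}
    (m1 : probability T1 R) X1 (m2 : probability T2 R) X2 (x : R) :=
  Rintegral leb setT (fun y : R => (rcdf m1 X1 (x - y) - rcdf m2 X2 (x - y)) * fejer y).

(** The mean of [sin (t (z - X))] is [- Im (expi (- (t * z)) * phi t)], with [phi] the
    characteristic function. Hence each endpoint contributes at most [t * b t], which gives the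
    factor 2 and cancels the singular [1 / t]. *)
Lemma rsmooth_increment {d1 d2} {T1 : measurableType d1} {T2 : measurableType d2}
    (m1 : probability T1 R) X1 (m2 : probability T2 R) X2 (b : R -> R) (x' x : R) :
  measurable_fun setT X1 -> measurable_fun setT X2 ->
  leb.-integrable I01 (EFin \o b) ->
  (forall t : R, 0 < t <= 1 -> cabs (rphi m1 X1 t - rphi m2 X2 t) <= t * b t) ->
  x' <= x ->
  rsmooth m1 X1 m2 X2 x - rsmooth m1 X1 m2 X2 x' <= 2 * \int[leb]_(t in I01) b t.
Proof.
move=> mX1 mX2 ib Hb xx'.
have iF d (T : measurableType d) (m : probability T R) (X : T -> R) (mX : measurable_fun setT X) z :
  leb.-integrable setT (EFin \o (fun y : R => rcdf m X (z - y) * fejer y)).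
  apply: (integrable_Mfejer _ 1); first exact: measurable_rcdf_shift.
  by move=> y; exact: rcdf_norm.
have rsE z : rsmooth m1 X1 m2 X2 z =
    Rintegral leb setT (fun y : R => rcdf m1 X1 (z - y) * fejer y) -
    Rintegral leb setT (fun y : R => rcdf m2 X2 (z - y) * fejer y).
  rewrite -RintegralB //; [|exact: iF..].
  by apply: eq_Rintegral => y _; rewrite mulrBl.
have incr d (T : measurableType d) (m : probability T R) (X : T -> R) (mX : measurable_fun setT X) :
    Rintegral leb setT (fun y : R => rcdf m X (x - y) * fejer y) -
    Rintegral leb setT (fun y : R => rcdf m X (x' - y) * fejer y) =
    \int[leb]_(t in I01) sin_incr m X x' x t.
  rewrite -smoothed_increment // -RintegralB //; [|exact: iF..].
  by apply: eq_Rintegral => y _; rewrite mulrBl.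
have i1 := integrable_sin_incr m1 X1 mX1 _ _ xx'.
have i2 := integrable_sin_incr m2 X2 mX2 _ _ xx'.
have -> : rsmooth m1 X1 m2 X2 x - rsmooth m1 X1 m2 X2 x' =
    \int[leb]_(t in I01) sin_incr m1 X1 x' x t - \int[leb]_(t in I01) sin_incr m2 X2 x' x t.
  by rewrite -!incr // !rsE; ring.
rewrite -RintegralB // -RintegralZl //.
have i3 : leb.-integrable I01 (EFin \o (fun t => 2 * b t)).
  by have := @integrableZl _ _ _ leb I01 (measurable_itv _) 2 _ ib.
apply: le_Rintegral => //.
  by have := @integrableB _ _ _ leb I01 (measurable_itv _) _ _ i1 i2.
move=> t; rewrite /= in_itv /= => t01; have /andP[t0 t1] := t01.
rewrite /sin_incr -mulrBr !Rintegral_sin //.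
have h z : sin (t * z) * complex.Re (rphi m1 X1 t) - cos (t * z) * complex.Im (rphi m1 X1 t)
    - (sin (t * z) * complex.Re (rphi m2 X2 t) - cos (t * z) * complex.Im (rphi m2 X2 t)) =
    - complex.Im (expi (- (t * z)) * (rphi m1 X1 t - rphi m2 X2 t)).
  rewrite /expi sinN cosN; case: (rphi m1 X1 t) => a1 b1; case: (rphi m2 X2 t) => a2 b2 /=; ring.
have hz z : `|complex.Im (expi (- (t * z)) * (rphi m1 X1 t - rphi m2 X2 t))| <= t * b t.
  apply: le_trans (Im_le_cabs _) _; rewrite cabsM cabs_expi mul1r; exact: Hb.
have h1 := h x; have h2 := h x'; have := hz x; have := hz x'.
rewrite !ler_norml => /andP[g1 g2] /andP[g3 g4].
have -> : 2 * b t = t^-1 * (2 * (t * b t)) by field; rewrite gt_eqF.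
rewrite powR_inv1 ?(ltW t0) // [(1 - t) * _]mulrC -mulrA; apply: ler_wpM2l.
  by rewrite invr_ge0 ltW.
have tb : 0 <= t * b t by apply: le_trans (Hb _ t01); exact: cabs_ge0.
apply: (@le_trans _ _ ((1 - t) * (2 * (t * b t)))).
  apply: ler_wpM2l; first lra.
  by move: h1 h2 g1 g2 g3 g4; set u1 := complex.Im _; set u2 := complex.Im _; lra.
by rewrite ler_piMl //; lra.
Qed.

(** The increment bound does not depend on [x'], so [x'] is sent to minus infinity, where the
    smoothed difference becomes negligible. *)
Lemma rsmooth_le {d1 d2} {T1 : measurableType d1} {T2 : measurableType d2}
    (m1 : probability T1 R) X1 (m2 : probability T2 R) X2 (b : R -> R) (x : R) :
  measurable_fun setT X1 -> measurable_fun setT X2 ->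
  leb.-integrable I01 (EFin \o b) ->
  (forall t : R, 0 < t <= 1 -> cabs (rphi m1 X1 t - rphi m2 X2 t) <= t * b t) ->
  rsmooth m1 X1 m2 X2 x <= 2 * \int[leb]_(t in I01) b t.
Proof.
move=> mX1 mX2 ib Hb; apply/ler_addgt0Pr => e e0.
have M0 := @fejer_mass_gt0 R.
(* [e1] bounds both the distribution function near [x'] and the tail of the kernel; the total error
   is then at most [e1 * (fejer_mass + 1)]. *)
pose e1 := Num.min 1 (e / (fejer_mass + 1)).
have e10 : 0 < e1 by rewrite lt_min ltr01 divr_gt0 // addr_gt0.
have [h0 h00 tl] := fejer_tail e1 e10.
have [x1 F1] := rcdf_cvgNy m1 X1 mX1 e1 e10.
have [x2 F2] := rcdf_cvgNy m2 X2 mX2 e1 e10.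
pose x' := Num.min x (Num.min x1 x2 - h0).
have x'x : x' <= x by rewrite ge_min lexx.
have := rsmooth_increment m1 X1 m2 X2 b x' x mX1 mX2 ib Hb x'x.
suff : rsmooth m1 X1 m2 X2 x' <= e by lra.
have mH : measurable_fun setT (fun y : R => rcdf m2 X2 (x' - y) - rcdf m1 X1 (x' - y)).
  by apply: measurable_funB; exact: measurable_rcdf_shift.
have HB y : `|rcdf m2 X2 (x' - y) - rcdf m1 X1 (x' - y)| <= 1 by exact: rcdfB_norm.
have Hl y : `|y| <= h0 -> - e1 <= rcdf m2 X2 (x' - y) - rcdf m1 X1 (x' - y).
  rewrite ler_norml => /andP[y1 y2].
  have xx1 : x' - y <= x1.
    have : x' <= x1 - h0 by rewrite !ge_min lerD2r ge_min lexx /= orbT.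
    lra.
  have := rcdf_le m1 X1 mX1 _ _ xx1; have /andP[] := rcdf01 m2 X2 mX2 (x' - y); lra.
have := smoothing_lower _ _ _ _ mH HB Hl; set tail := Rintegral _ _ _ in tl *.
have -> : Rintegral leb setT (fun y : R => (rcdf m2 X2 (x' - y) - rcdf m1 X1 (x' - y)) * fejer y) =
   - rsmooth m1 X1 m2 X2 x'.
  rewrite -[RHS]mulN1r -RintegralZl //.
    by apply: eq_Rintegral => y _; ring.
  apply: (integrable_Mfejer (fun y : R => rcdf m1 X1 (x' - y) - rcdf m2 X2 (x' - y)) 1).
    by apply: measurable_funB; exact: measurable_rcdf_shift.
  by move=> y; exact: rcdfB_norm.
have e11 : e1 <= 1 by rewrite ge_min lexx.
have e12 : e1 * (fejer_mass + 1) <= e.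
  by rewrite -ler_pdivlMr ?addr_gt0 // ge_min lexx orbT.
have tl0 : 0 <= tail.
  apply: Rintegral_ge0 => y _; rewrite mulr_ge0 ?fejer_ge0 //.
have : (1 - e1) * tail <= e1 by nra.
move: e12; rewrite mulrDr; lra.
Qed.

(** As [a / 2 + eta <= 3 / 2 * eta], a tail of at most [fejer_mass / 12] costs
    [eta * fejer_mass / 8]; doubling gives the term [eta / 4]. *)
Lemma esseen_core (H : R -> R) (a B eta h0 : R) : measurable_fun setT H ->
  (forall y, `|H y| <= eta) -> (forall y, `|y| <= h0 -> a / 2 <= H y) ->
  0 <= a <= eta ->
  Rintegral leb setT (fun y => fejer y * \1_[set z : R | h0 < `|z|] y) <= fejer_mass / 12 ->
  Rintegral leb setT (fun y => H y * fejer y) <= 2 * B ->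
  a <= 4 * B / fejer_mass + eta / 4.
Proof.
move=> mH He Ha /andP[a0 ae] tl HB.
have M0 := @fejer_mass_gt0 R.
have := le_trans (smoothing_lower _ _ _ _ mH He Ha) HB.
set tail := Rintegral _ _ _ in tl * => h.
rewrite -(ler_pM2r M0) mulrDl divfK ?gt_eqF //.
have : (a / 2 + eta) * tail <= (a / 2 + eta) * (fejer_mass / 12) by apply: ler_wpM2l => //; lra.
have : a * fejer_mass <= eta * fejer_mass by rewrite ler_pM2r.
by move: h; lra.
Qed.

(** If [|D x| > 4 * L * h0], monotonicity of the first distribution function and the Lipschitz bound
    on the second keep [D] beyond half its value on an interval of length [2 * h0] to the right of
    [x] when [D x >= 0], to the left otherwise. Smoothing at the centre of that interval bounds
    [|D x|] up to a quarter of the supremum [eta], whose absorption gives the factor 4/3. *)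
Lemma esseen {d1 d2} {T1 : measurableType d1} {T2 : measurableType d2}
    (m1 : probability T1 R) X1 (m2 : probability T2 R) X2 (b : R -> R) (B L h0 : R) :
  measurable_fun setT X1 -> measurable_fun setT X2 ->
  leb.-integrable I01 (EFin \o b) ->
  (forall t : R, 0 < t <= 1 -> cabs (rphi m1 X1 t - rphi m2 X2 t) <= t * b t) ->
  \int[leb]_(t in I01) b t <= B ->
  0 <= L -> (forall x y, x <= y -> rcdf m2 X2 y - rcdf m2 X2 x <= L * (y - x)) ->
  0 < h0 ->
  Rintegral leb setT (fun y => fejer y * \1_[set z : R | h0 < `|z|] y) <= fejer_mass / 12 ->
  forall x, `|rcdf m1 X1 x - rcdf m2 X2 x| <= 4 / 3 * (4 * B / fejer_mass + 4 * L * h0).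
Proof.
move=> mX1 mX2 ib Hb bB L0 lip h00 tl.
pose D x := rcdf m1 X1 x - rcdf m2 X2 x.
pose eta := sup [set `|D x| | x in setT].
have M0 := @fejer_mass_gt0 R.
have hs : has_sup [set `|D x| | x in setT].
  split; first by exists `|D 0|, 0.
  by exists 1 => _ [x _ <-]; exact: rcdfB_norm.
have De x : `|D x| <= eta by apply: sup_upper_bound => //; exists x.
have Hb' (t : R) : 0 < t <= 1 -> cabs (rphi m2 X2 t - rphi m1 X1 t) <= t * b t.
  by move=> /Hb; rewrite cabsBC.
have B0 : 0 <= B.
  apply: le_trans bB; apply: Rintegral_ge0 => t; rewrite /= in_itv /= => t01.
  have /andP[t0 _] := t01; rewrite -(pmulr_rge0 _ t0).
  by apply: le_trans (Hb _ t01); exact: cabs_ge0.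
have K0 : 0 <= 4 * L * h0 by rewrite !mulr_ge0 ?(ltW h00).
have BM0 : 0 <= 4 * B / fejer_mass by rewrite !mulr_ge0 // invr_ge0 ltW.
have mD1 x : measurable_fun setT (fun y : R => D (x - y)).
  by apply: measurable_funB; exact: measurable_rcdf_shift.
have mD2 x : measurable_fun setT (fun y : R => - D (x - y)) by exact: measurableT_comp.
suff main x : `|D x| <= 4 * B / fejer_mass + 4 * L * h0 + eta / 4.
  have : eta <= 4 * B / fejer_mass + 4 * L * h0 + eta / 4.
    by apply: sup_le_ub; [exists `|D 0|, 0|move=> _ [x _ <-]; exact: main].
  by move=> h x; apply: le_trans (De x) _; lra.
have e0 : 0 <= eta by apply: le_trans (De 0); exact: normr_ge0.
have [small|big] := lerP `|D x| (4 * L * h0); first by lra.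
suff : `|D x| <= 4 * B / fejer_mass + eta / 4 by lra.
have [Dx|Dx] := lerP 0 (D x).
  rewrite ger0_norm // in big *.
  apply: (esseen_core (fun y : R => D (x + h0 - y)) (D x) B eta h0) => //.
  - move=> y; rewrite ler_norml => /andP[y1 y2].
    have xy : x <= x + h0 - y by lra.
    have := lip _ _ xy; have := rcdf_le m1 X1 mX1 _ _ xy.
    have : L * (x + h0 - y - x) <= L * (2 * h0) by apply: ler_wpM2l => //; lra.
    by move: big; rewrite /D; lra.
  - by rewrite Dx; apply: le_trans (De x); exact: ler_norm.
  - by have := rsmooth_le m1 X1 m2 X2 b (x + h0) mX1 mX2 ib Hb; rewrite /rsmooth /D; lra.
rewrite ltr0_norm // in big *.
apply: (esseen_core (fun y : R => - D (x - h0 - y)) (- D x) B eta h0) => //.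
- by move=> y; rewrite normrN.
- move=> y; rewrite ler_norml => /andP[y1 y2].
  have xy : x - h0 - y <= x by lra.
  have := lip _ _ xy; have := rcdf_le m1 X1 mX1 _ _ xy.
  have : L * (x - (x - h0 - y)) <= L * (2 * h0) by apply: ler_wpM2l => //; lra.
  by move: big; rewrite /D; lra.
- by rewrite oppr_ge0 ltW //=; apply: le_trans (De x); rewrite -normrN; exact: ler_norm.
have := rsmooth_le m2 X2 m1 X1 b (x - h0) mX2 mX1 ib Hb'; rewrite /rsmooth => h.
apply: le_trans (_ : 2 * \int[leb]_(t in I01) b t <= _); last lra.
by apply: le_trans h; rewrite /D; under [leRHS]eq_Rintegral do rewrite -opprB.
Qed.

End Esseen.

(** * The normal law *)

Section NormalCharacteristic.
Context {R : realType}.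
Local Notation leb := (@lebesgue_measure R).
Local Notation p := (@normal_pdf R 0 1).
Local Notation mu := (@normal_prob R 0 1).

Let one0 : (1 : R) != 0. Proof. by rewrite oner_eq0. Qed.

(** The explicit density and the Radon-Nikodym derivative have the same integral over every
    measurable set, hence agree almost everywhere. *)
Lemma Rintegral_normal (f : R -> R) : mu.-integrable setT (EFin \o f) ->
  Rintegral mu setT f = Rintegral leb setT (fun x => f x * p x).
Proof.
move=> fi.
have dom := @normal_prob_dominates R 0 1.
have iRN := Radon_Nikodym_integrable (nu := charge_of_finite_measure mu) dom.
have mRN := measurable_int _ iRN.
have ae : ae_eq leb setT (EFin \o p) (Radon_Nikodym (charge_of_finite_measure mu) leb).
  apply: integral_ae_eq => //.
  - exact: integrable_normal_pdf.
  - move=> A AT mA; rewrite -Radon_Nikodym_integral //.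
rewrite /Rintegral; congr fine.
rewrite -(Radon_Nikodym_change_of_variables dom measurableT fi).
apply: ae_eq_integral => //.
- apply: emeasurable_funM; first exact: measurable_int fi.
  exact: mRN.
- have mf : measurable_fun setT f by apply/measurable_EFinP; exact: measurable_int fi.
  by apply/measurable_EFinP; apply: measurable_funM => //; exact: measurable_normal_pdf.
- move: ae; apply: filterS => x h _; by rewrite -h // EFinM.
Qed.

Lemma pdfE x : p x = normal_peak 1 * expR (- x ^+ 2 / 2).
Proof. by rewrite normal_pdfE // /normal_fun subr0 expr1n. Qed.

Lemma is_derive_pdf x : is_derive x (1 : R) p (- x * p x).
Proof.
rewrite (_ : p = fun x => normal_peak 1 * expR (- x ^+ 2 / 2)); last first.
  by apply/funext => y; rewrite pdfE.
by apply: is_derive_eq; rewrite /GRing.scale /=; field.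
Qed.

(** Half of the Gaussian exponent absorbs the factor: [exp (x^2 / 4) >= 1 + x^2 / 4 >= |x|]. The
    other half is the exponent of the normal density of variance 2, and [C] is the ratio of the
    peaks. *)
Lemma xpdf_le : exists C : R, forall x, `|x| * p x <= C * normal_pdf 0 (Num.sqrt 2) x.
Proof.
have s20 : Num.sqrt (2 : R) != 0 by rewrite gt_eqF // sqrtr_gt0.
have pk0 := @normal_peak_gt0 R _ s20.
exists (normal_peak 1 / normal_peak (Num.sqrt 2)) => x.
rewrite pdfE normal_pdfE // /normal_fun subr0 sqr_sqrtr // [leRHS]mulrA divfK ?gt_eqF //.
rewrite mulrCA; apply: ler_wpM2l; first exact: normal_peak_ge0.
rewrite (_ : - x ^+ 2 / 2 = - x ^+ 2 / (2 *+ 2) + - (x ^+ 2 / 4)); last by field.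
rewrite expRD mulrCA ler_piMr ?expR_ge0 // expRN ler_pdivrMr ?expR_gt0 // mul1r.
apply: le_trans (expR_ge1Dx _).
have := sqr_ge0 (`|x| / 2 - 1); rewrite -[x ^+ 2]real_normK ?num_real //; nra.
Qed.

Lemma integrable_xpdf : leb.-integrable setT (EFin \o (fun x => `|x| * p x)).
Proof.
have [C hC] := xpdf_le.
have i0 := integrable_EFinZl leb C _ (@integrable_normal_pdf R 0 (Num.sqrt 2)).
apply: le_integrable i0 => //.
  apply/measurable_EFinP; apply: measurable_funM; first exact: normr_measurable.
  exact: measurable_normal_pdf.
move=> x _ /=; rewrite lee_fin ger0_norm ?mulr_ge0 ?normal_pdf_ge0 //.
by apply: le_trans (hC x) (ler_norm _).
Qed.

Lemma integrable_bpdf (f : R -> R) : measurable_fun setT f -> (forall x, `|f x| <= 1) ->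
  leb.-integrable setT (EFin \o (fun x => f x * p x)).
Proof.
move=> mf f1; apply: le_integrable (@integrable_normal_pdf R 0 1) => //.
  by apply/measurable_EFinP; apply: measurable_funM => //; exact: measurable_normal_pdf.
move=> x _ /=; rewrite lee_fin normrM ler_piMl //.
Qed.

Lemma integrable_bxpdf (f : R -> R) : measurable_fun setT f -> (forall x, `|f x| <= 1) ->
  leb.-integrable setT (EFin \o (fun x => x * f x * p x)).
Proof.
move=> mf f1; apply: le_integrable integrable_xpdf => //.
  apply/measurable_EFinP; apply: measurable_funM; last exact: measurable_normal_pdf.
  exact: measurable_funM.
move=> x _ /=; rewrite lee_fin !normrM normr_id ler_wpM2r //.
by rewrite ler_piMr.
Qed.

Lemma measurable_trig (f : R -> R) (t c : R) : continuous f ->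
  measurable_fun setT (fun x : R => f (t * x + c)).
Proof.
move=> cf; apply: (@measurableT_comp _ _ _ _ _ _ f); first exact: continuous_measurable_fun.
by apply: measurable_funD; [apply: measurable_funM|exact: measurable_cst].
Qed.

Lemma pdf_cvg0 : p n%:R @[n --> \oo] --> (0 : R).
Proof.
have P0 := @normal_peak_ge0 R 1.
apply: (@squeeze_cvgr _ _ _ _ (cst 0) (fun n => 2 * normal_peak 1 * n.+1%:R^-1)).
- near=> n; rewrite normal_pdf_ge0 /= pdfE.
  have n1 : (1 <= n)%N by near: n; exact: nbhs_infty_ge.
  rewrite -mulrA mulrCA ler_wpM2l // mulNr expRN -[leRHS]invrK lef_pV2 ?posrE ?invr_gt0 ?expR_gt0 //.
  rewrite invfM invrK; apply: le_trans (expR_ge1Dx _).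
  have : 1 <= n%:R :> R by rewrite ler1n.
  rewrite -[n.+1%:R]natr1; set k := n%:R.
  by have := sqr_ge0 (k - 1); rewrite !expr2; lra.
- exact: cvg_cst.
- rewrite -[X in _ --> X](mulr0 (2 * normal_peak 1)).
  by apply: cvgM; [exact: cvg_cst|exact: cvg_harmonic].
Unshelve. all: end_near. Qed.

(** The integrand is the derivative of [sin (t x + c) * p x], which vanishes at infinity; the
    integrals over growing intervals converge by domination. *)
Lemma Rintegral_derive_pdf (t c : R) :
  Rintegral leb setT (fun x => t * (cos (t * x + c) * p x) - x * sin (t * x + c) * p x) = 0.
Proof.
pose f x := t * (cos (t * x + c) * p x) - x * sin (t * x + c) * p x.
have mc := measurable_trig cos t c (@continuous_cos R).
have ms := measurable_trig sin t c (@continuous_sin R).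
have i1 := integrable_bpdf _ mc (fun x => norm_cos_le1 _).
have i2 := integrable_bxpdf _ ms (fun x => norm_sin_le1 _).
have fi : leb.-integrable setT (EFin \o f).
  by have := @integrableB _ _ _ leb setT measurableT _ _ (integrable_EFinZl leb t _ i1) i2.
have df x : is_derive x (1 : R) (fun x => sin (t * x + c) * p x) (f x).
  have dp := is_derive_pdf x.
  by apply: is_derive_eq; rewrite /f /GRing.scale /=; ring.
have cp : continuous p by exact: continuous_normal_pdf.
have cl : continuous (fun x : R => t * x + c).
  by move=> x; apply: cvgD; [apply: cvgM; [exact: cvg_cst|exact: cvg_id]|exact: cvg_cst].
have cf : continuous f.
  move=> x; apply: cvgB.
    apply: cvgM; first exact: cvg_cst.
    by apply: cvgM; [apply: (continuous_comp (cl x)); exact: continuous_cos|exact: cp].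
  apply: cvgM; last exact: cp.
  by apply: cvgM; [exact: cvg_id|apply: (continuous_comp (cl x)); exact: continuous_sin].
have mf : measurable_fun setT f by exact: continuous_measurable_fun.
pose I (n : nat) := `] - n.+1%:R, n.+1%:R : R]%classic.
have IE n : Rintegral leb setT (fun x => \1_(I n) x * f x) =
    sin (t * n.+1%:R + c) * p n.+1%:R - sin (t * - n.+1%:R + c) * p n.+1%:R.
  have pN x : p (- x) = p x by rewrite !pdfE sqrrN.
  rewrite -{2}[p _]pN -(Rintegral_FTC2 f (fun x => sin (t * x + c) * p x)) //; last first.
    by have : 0 < n.+1%:R :> R by []; lra.
  rewrite [RHS]Rintegral_mkcond; apply: eq_Rintegral => x _.
  by rewrite patch_indic mulrC.
have mI n : measurable (I n) by exact: measurable_itv.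
have mIf n : measurable_fun setT (fun x : R => \1_(I n) x * f x).
  by apply: measurable_funM => //; exact: measurable_indic.
have cIf x : (\1_(I n) x * f x) @[n --> \oo] --> f x.
  apply: cvg_near_cst; near=> n.
  rewrite indicE mem_set ?mul1r // /I /= in_itv /=.
  have : `|x| < n.+1%:R.
    apply: lt_le_trans (truncnS_gt `|x|) _; rewrite ler_nat ltnS; near: n; exact: nbhs_infty_ge.
  by rewrite ltr_norml => /andP[-> /ltW ->].
have lim : (\int[leb]_x (\1_(I n) x * f x)%:E @[n --> \oo] --> \int[leb]_x (f x)%:E)%E.
  apply: (@dominated_cvg _ _ _ leb setT measurableT _ _ (fun x => `|f x|%:E)) => //.
  - by move=> n; apply/measurable_EFinP; exact: mIf.
  - by move=> x _; apply: cvg_EFin; [exact: nearW|exact: cIf].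
  - have := integrable_abse fi; by [].
  - move=> n x _ /=; rewrite lee_fin normrM ler_piMl // indicE.
    by case: (_ \in _); rewrite ?normr1 ?normr0.
have limR : Rintegral leb setT (fun x => \1_(I n) x * f x) @[n --> \oo] --> Rintegral leb setT f.
  apply: fine_cvg; rewrite fineK //; exact: integrable_fin_num.
have lim0 : Rintegral leb setT (fun x => \1_(I n) x * f x) @[n --> \oo] --> (0 : R).
  have p0 : 2 * p n.+1%:R @[n --> \oo] --> (0 : R).
    rewrite -[X in _ --> X](mulr0 2); apply: cvgM; first exact: cvg_cst.
    by have := pdf_cvg0; rewrite -(cvg_shiftS (fun n => p n%:R)).
  apply: norm_cvg0; apply: (@squeeze_cvgr _ _ _ _ (cst 0) (fun n : nat => 2 * p n.+1%:R)) => //.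
    near=> n; rewrite normr_ge0 /= IE -mulrBl normrM (ger0_norm (normal_pdf_ge0 _ _ _)).
    rewrite ler_wpM2r ?normal_pdf_ge0 //; apply: le_trans (ler_normB _ _) _.
    by rewrite [2](_ : _ = 1 + 1) // lerD ?norm_sin_le1.
  exact: cvg_cst.
have := cvg_unique _ limR lim0; apply; exact: Rhausdorff.
Unshelve. all: end_near. Qed.

(** Differentiation under the integral and the previous lemma give [phi' s = - s * phi s], so
    [phi s * expR (s ^+ 2 / 2)] is constant. The phase [c] treats the cosine and sine transforms at
    once, through [c = 0] and [c = - pi / 2]. *)
Lemma normal_cos (t c : R) :
  Rintegral leb setT (fun x => cos (t * x + c) * p x) = cos c * expR (- t ^+ 2 / 2).
Proof.
pose phi t := Rintegral leb setT (fun x => cos (t * x + c) * p x).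
have mc s := measurable_trig cos s c (@continuous_cos R).
have ms s := measurable_trig sin s c (@continuous_sin R).
have dphi (s : R) : is_derive s (1 : R) phi (- s * phi s).
  have d1 (u x : R) : is_derive u (1 : R) (fun u : R => cos (u * x + c) * p x) (- (x * sin (u * x + c) * p x)).
    by apply: is_derive_eq; rewrite /GRing.scale /=; ring.
  have d1E u x : partial1of2 (fun u x : R => cos (u * x + c) * p x) u x = - (x * sin (u * x + c) * p x).
    by rewrite partial1of2E; have -> := @derive_val _ _ _ _ _ _ _ (d1 u x).
  have Is : `]s - 1, s + 1[%classic s by rewrite /= in_itv /=; apply/andP; split; lra.
  have h1 (u : R) : `]s - 1, s + 1[%classic u -> leb.-integrable setT (EFin \o (fun x : R => cos (u * x + c) * p x)).
    by move=> _; apply: integrable_bpdf => // x; exact: norm_cos_le1.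
  have h2 (u x : R) : `]s - 1, s + 1[%classic u -> [set: R] x -> derivable (fun u : R => cos (u * x + c) * p x) u 1.
    by move=> _ _; have [] := d1 u x.
  have h3 (u x : R) : `]s - 1, s + 1[%classic u -> [set: R] x ->
      `|partial1of2 (fun u x : R => cos (u * x + c) * p x) u x| <= `|x| * p x.
    move=> _ _; rewrite d1E normrN !normrM (ger0_norm (normal_pdf_ge0 _ _ _)).
    by rewrite ler_wpM2r ?normal_pdf_ge0 // ler_piMr // norm_sin_le1.
  have h4 (x : R) : 0 <= `|x| * p x by rewrite mulr_ge0 ?normal_pdf_ge0.
  have D := derivable_under_integral measurableT Is h1 h2 h4 integrable_xpdf h3.
  have V := differentiation_under_integral measurableT Is h1 h2 h4 integrable_xpdf h3.
  apply: DeriveDef; first exact: D.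
  rewrite -derive1E; transitivity (- Rintegral leb setT (fun x => x * sin (s * x + c) * p x)).
    rewrite [LHS]V -mulN1r -RintegralZl //.
      by apply: eq_Rintegral => x _; rewrite d1E mulN1r.
    by apply: integrable_bxpdf => // x; exact: norm_sin_le1.
  have := Rintegral_derive_pdf s c; rewrite RintegralB //; last 2 first.
  - apply: (integrable_EFinZl leb s (fun x => cos (s * x + c) * p x)).
    by apply: integrable_bpdf => // x; exact: norm_cos_le1.
  - by apply: integrable_bxpdf => // x; exact: norm_sin_le1.
  rewrite RintegralZl //; last by apply: integrable_bpdf => // x; exact: norm_cos_le1.
  by rewrite /phi => /eqP; rewrite subr_eq0 mulNr => /eqP ->.
pose h s := phi s * expR (s ^+ 2 / 2).
have dh s : is_derive s (1 : R) h 0.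
  by have dp := dphi s; apply: is_derive_eq; rewrite /GRing.scale /=; field.
have h0 : h 0 = cos c.
  rewrite /h expr0n /= mul0r expR0 mulr1 /phi.
  under eq_Rintegral do rewrite mul0r add0r.
  rewrite RintegralZl //; last exact: integrable_normal_pdf.
  by rewrite /Rintegral integral_normal_pdf /= mulr1.
have := is_derive_0_is_cst t 0 dh; rewrite h0 /h => <-.
by rewrite /phi -mulrA -expRD mulNr addrN expR0 mulr1.
Qed.

Lemma rphi_normal (T t : R) :
  rphi (mu : probability _ R) (fun y => T * y) t = (expR (- (t * T) ^+ 2 / 2))%:C%C.
Proof.
have mT : measurable_fun setT (fun y : R => T * y) by exact: measurable_funM.
have ic := integrable_cos (mu : probability _ R) (fun y => T * y) mT 0 (- t).
have iS := integrable_sin (mu : probability _ R) (fun y => T * y) mT 0 (- t).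
have E y : - t * (0 - T * y) = t * T * y by ring.
apply: complex_ext => /=.
- have := normal_cos (t * T) 0; rewrite cos0 mul1r => <-.
  rewrite -Rintegral_normal.
    by apply: eq_Rintegral => y _; rewrite addr0 mulrA.
  by move: ic; congr (_.-integrable _ _); apply/funext => y /=; rewrite E addr0.
- have := normal_cos (t * T) (- (pi / 2)); rewrite cosN cos_pihalf mul0r => H0.
  apply: etrans H0; rewrite -Rintegral_normal.
    by apply: eq_Rintegral => y _; rewrite cosBpihalf mulrA.
  by move: iS; congr (_.-integrable _ _); apply/funext => y /=; rewrite E cosBpihalf.
Qed.

Lemma normal_rcdfE (T x : R) : 0 < T ->
  rcdf (mu : probability _ R) (fun y => T * y) (T * x) = fine (mu `]-oo, x]).
Proof.
move=> T0; rewrite /rcdf; congr (fine (_ _)); apply/seteqP; split => y;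
  by rewrite /= in_itv /= ler_pM2l.
Qed.

Lemma normal_rcdf_lip (T x y : R) : 0 < T -> x <= y ->
  rcdf (mu : probability _ R) (fun y => T * y) y - rcdf (mu : probability _ R) (fun y => T * y) x
    <= normal_peak 1 / T * (y - x).
Proof.
move=> T0 xy.
have ET z : z = T * (z / T) by rewrite mulrC divfK // gt_eqF.
have xyT : x / T <= y / T by rewrite ler_pM2r ?invr_gt0.
rewrite [X in rcdf _ _ X - _]ET [X in _ - rcdf _ _ X]ET !normal_rcdfE //.
have fin A : measurable A -> mu A \is a fin_num by move=> mA; exact: fin_num_measure.
rewrite -fineB ?fin //.
have -> : (mu `]-oo, (y / T)%R] - mu `]-oo, (x / T)%R])%E = mu `](x / T), (y / T)].
  have sub : `]-oo, (x / T)] `<=` (`]-oo, (y / T)] : set R).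
    by apply: subset_itvl; rewrite bnd_simp.
  rewrite (_ : `](x / T), (y / T)]%classic = `]-oo, (y / T)] `\` `]-oo, (x / T)]).
    rewrite measureD ?setIidr //.
    by rewrite -ge0_fin_numE // fin.
  apply/seteqP; split => z /=; rewrite !in_itv /=.
    by move=> /andP[h1 ->]; split => //; apply/negP; rewrite -ltNge.
  by move=> [-> /negP]; rewrite -ltNge => ->.
rewrite -lee_fin fineK ?fin //.
apply: le_trans (_ : \int[leb]_(z in `](x / T)%R, (y / T)%R]) (normal_peak 1)%:E <= _)%E.
  apply: ge0_le_integral => //.
  - by move=> z _; rewrite lee_fin normal_pdf_ge0.
  - by apply/measurable_EFinP; apply: measurable_funTS; exact: measurable_normal_pdf.
  - by move=> z _; rewrite lee_fin normal_pdf_ub.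
rewrite integral_cst //= lebesgue_measure_itv /= lte_fin.
case: ifP => _; first by rewrite -EFinD -EFinM lee_fin -mulrBl [_ / T * _]mulrAC mulrA.
by rewrite mule0 lee_fin mulr_ge0 ?divr_ge0 ?normal_peak_ge0 ?(ltW T0) // subr_ge0.
Qed.

End NormalCharacteristic.

(** * From eigenvalue expansion to a Berry-Esseen bound *)

Section EigenvalueExpansion.
Context {R : realType}.
Implicit Types (la z w : R[i]) (t s x : R).

Lemma cabs_sum (n : nat) (F : nat -> R[i]) (c : R) : (forall i, (i < n)%N -> cabs (F i) <= c) ->
  cabs (\sum_(i < n) F i) <= n%:R * c.
Proof.
elim: n => [|n IH] Fc; first by rewrite big_ord0 cabs0 mul0r.
rewrite big_ord_recr /=; apply: le_trans (cabsD _ _) _.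
rewrite -natr1 mulrDl mul1r lerD ?Fc //; apply: IH => i ni; exact: Fc (ltnW ni).
Qed.

Lemma cabs_subXX (z w : R[i]) (F : R) n : cabs z <= F -> cabs w <= F ->
  cabs (z ^+ n.+1 - w ^+ n.+1) <= n.+1%:R * F ^+ n * cabs (z - w).
Proof.
move=> zF wF; have F0 : 0 <= F by apply: le_trans zF; exact: cabs_ge0.
rewrite subrXX cabsM mulrC ler_wpM2r ?cabs_ge0 //.
apply: (cabs_sum _ (fun i => z ^+ (n - i) * w ^+ i)) => i /ltnSE ni.
rewrite cabsM !cabsX -[in leRHS](subnK ni) exprD.
by rewrite ler_pM ?exprn_ge0 ?cabs_ge0 ?lerXn2r ?nnegrE ?cabs_ge0.
Qed.

Lemma nat_ge_half (x : R) : 1 <= x -> exists n : nat, (0 < n)%N /\ n%:R <= x /\ x / 2 <= n%:R.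
Proof.
move=> x1; exists (Num.truncn x).
have h1 : (Num.truncn x)%:R <= x by rewrite truncn_le; lra.
have h2 := truncnS_gt x; rewrite -[X in X%:R]addn1 natrD in h2.
have n0 : (0 < Num.truncn x)%N by rewrite truncn_gt0.
split => //; split => //.
have : 1 <= (Num.truncn x)%:R :> R by rewrite ler1n.
lra.
Qed.

(** Factor [la^n - rho^n = (la - rho) * Sg]. No branch of the [n]-th root has to be chosen, because
    all powers [la^j] with [j <= n] are close to [rho^j]: thus [Sg] has modulus at least [n / 4],
    and an error [O(t)] divided by [n] gives [O(t^3)]. Taking [n] near [1 / ((1 + s) t^2)] ensures
    both [n t^2 <= 1] and [rho^n >= 1 / 2]. *)
Lemma eigen_expansion (s K Cm t : R) (la : R[i]) (q : nat -> R[i]) :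
  0 < s -> 0 <= K -> 0 <= Cm -> 0 < t ->
  (forall n, cabs (la ^+ n * q n) <= 1) -> (forall n, cabs (q n - 1) <= K * t) ->
  (forall n, n%:R * t ^+ 2 <= 1 ->
     cabs (la ^+ n * q n - (((1 - s * t ^+ 2 / 2) ^+ n)%:C)%C) <= Cm * t) ->
  (1 + s) * t ^+ 2 <= 1 -> 4 * (Cm + 2 * K) * t <= 1 ->
  cabs (la - ((1 - s * t ^+ 2 / 2)%:C)%C) <= 8 * (Cm + 2 * K) * (1 + s) * t ^+ 3.
Proof.
move=> s0 K0 Cm0 t0 a1 qK aR st tK.
have t20 : 0 < t ^+ 2 by rewrite exprn_gt0.
have st0 : 0 < (1 + s) * t ^+ 2 by rewrite mulr_gt0 //; lra.
have [n [n0 [nx xn]]] : exists n : nat, (0 < n)%N /\ n%:R <= ((1 + s) * t ^+ 2)^-1 /\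
    ((1 + s) * t ^+ 2)^-1 / 2 <= n%:R by apply: nat_ge_half; rewrite invf_ge1.
have nst : n%:R * ((1 + s) * t ^+ 2) <= 1.
  by rewrite -ler_pdivlMr // div1r.
have hn (j : nat) : (j <= n)%N -> j%:R * t ^+ 2 <= 1 /\ j%:R * (s * t ^+ 2) <= 1.
  move=> jn; have jn' : j%:R <= n%:R :> R by rewrite ler_nat.
  have h1 : j%:R * t ^+ 2 <= n%:R * t ^+ 2 by rewrite ler_pM2r.
  have h2 : j%:R * (s * t ^+ 2) <= n%:R * (s * t ^+ 2) by rewrite ler_pM2r // mulr_gt0.
  have h3 : 0 <= n%:R * t ^+ 2 by rewrite mulr_ge0 // ltW.
  have h4 : 0 <= n%:R * (s * t ^+ 2) by rewrite !mulr_ge0 // ltW.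
  by move: nst; rewrite mulrDl mul1r mulrDr; split; lra.
set rho := 1 - s * t ^+ 2 / 2 in aR *.
have Cmt : 0 <= Cm * t by rewrite mulr_ge0 // ltW.
have Kt0 : 0 <= K * t by rewrite mulr_ge0 // ltW.
have Kt : K * t <= 1 / 2 by lra.
have r0 : 0 <= s * t ^+ 2 / 2 <= 1.
  have : 0 <= s * t ^+ 2 by rewrite mulr_ge0 // ltW.
  by move: st; rewrite mulrDl; lra.
have rho01 : 0 <= rho <= 1 by rewrite /rho; lra.
have rhoX j : (j <= n)%N -> 1 / 2 <= rho ^+ j.
  move=> /hn[_ hj]; apply: le_trans (bernoulli_le _ _ r0).
  by move: hj; lra.
have laX j : cabs (la ^+ j) <= 2.
  have q1 : 1 / 2 <= cabs (q j).
    have := lerB_cabs 1 (1 - q j); rewrite cabs1 subKr cabsBC.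
    by have := qK j; lra.
  have := a1 j; rewrite cabsM; have := cabs_ge0 (la ^+ j).
  set u := cabs (la ^+ j); set v := cabs (q j) in q1 *; nra.
have laR j : (j <= n)%N -> cabs (la ^+ j - (rho ^+ j)%:C%C) <= (Cm + 2 * K) * t.
  move=> /hn[hj _]; apply: le_trans (cabs_triangle _ (la ^+ j * q j) _) _.
  have -> : la ^+ j - la ^+ j * q j = - (la ^+ j * (q j - 1)) by ring.
  rewrite cabsN cabsM; have := aR j hj; have := qK j; have := laX j.
  have := cabs_ge0 (q j - 1); set u := cabs (la ^+ j); set v := cabs (q j - 1); nra.
case: n n0 nx xn nst hn rhoX laR => // n _ nx xn nst hn rhoX laR.
pose Sg : R[i] := \sum_(i < n.+1) la ^+ (n - i) * (rho%:C%C) ^+ i.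
have E : la ^+ n.+1 - (rho%:C%C) ^+ n.+1 = (la - rho%:C%C) * Sg by rewrite subrXX.
have XC j : (rho%:C%C) ^+ j = (rho ^+ j)%:C%C :> R[i] by rewrite rmorphXn.
have SgE : cabs (Sg - n.+1%:R * (rho%:C%C) ^+ n) <= n.+1%:R * ((Cm + 2 * K) * t).
  have -> : n.+1%:R * (rho%:C%C) ^+ n = \sum_(i < n.+1) (rho%:C%C) ^+ n :> R[i].
    by rewrite sumr_const card_ord mulr_natl.
  rewrite /Sg -sumrB.
  apply: (cabs_sum _ (fun i => la ^+ (n - i) * (rho%:C%C) ^+ i - (rho%:C%C) ^+ n)) => i ni.
  have {2}-> : n = (n - i + i)%N by rewrite subnK // -ltnS.
  rewrite exprD -mulrBl cabsM XC cabsX cabs_real (ger0_norm (x := rho)); last by case/andP: rho01.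
  have h1 : rho ^+ i <= 1 by rewrite exprn_ile1; case/andP: rho01.
  have h0 : 0 <= rho ^+ i by rewrite exprn_ge0; case/andP: rho01.
  apply: le_trans (laR (n - i)%N _); last by apply: leq_trans (leq_subr _ _) _.
  by rewrite ler_piMr ?cabs_ge0.
have SgL : n.+1%:R / 4 <= cabs Sg.
  have := lerB_cabs (n.+1%:R * (rho%:C%C) ^+ n) (n.+1%:R * (rho%:C%C) ^+ n - Sg).
  rewrite subKr [cabs (_ - Sg)]cabsBC; apply: le_trans.
  rewrite XC in SgE *; rewrite cabsM cabs_real ger0_norm; last by rewrite exprn_ge0; case/andP: rho01.
  have -> : cabs (n.+1%:R : R[i]) = n.+1%:R.
    by rewrite -(rmorph_nat (real_complex R)) cabs_real normr_nat.
  have N0 : 0 <= n.+1%:R :> R by [].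
  have h1 : n.+1%:R * (1 / 2) <= n.+1%:R * rho ^+ n by rewrite ler_wpM2l // rhoX.
  have h2 : n.+1%:R * ((Cm + 2 * K) * t) <= n.+1%:R * (1 / 4) by rewrite ler_wpM2l //; lra.
  by lra.
have := laR n.+1 (leqnn _); rewrite -XC E cabsM => hE.
set u := cabs (la - _) in hE *; have u0 : 0 <= u by exact: cabs_ge0.
have h1 : u * (n.+1%:R / 4) <= (Cm + 2 * K) * t.
  by apply: le_trans hE; rewrite ler_wpM2l.
have h2 : u * ((((1 + s) * t ^+ 2)^-1 / 2) / 4) <= (Cm + 2 * K) * t.
  by apply: le_trans h1; rewrite ler_wpM2l // ler_pM2r.
have -> : u = u * ((((1 + s) * t ^+ 2)^-1 / 2) / 4) * (8 * ((1 + s) * t ^+ 2)).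
  by field; rewrite gt_eqF //= gt_eqF //; lra.
apply: le_trans (_ : (Cm + 2 * K) * t * (8 * ((1 + s) * t ^+ 2)) <= _).
  by rewrite ler_wpM2r // mulr_ge0 // ltW.
by rewrite le_eqVlt; apply/orP; left; apply/eqP; ring.
Qed.

Lemma expRN_taylor2 (x : R) : 0 <= x -> expR (- x) <= 1 - x + x ^+ 2 / 2.
Proof.
have D y : is_derive y (1 : R) (fun x : R => 1 - x + x ^+ 2 / 2 - expR (- x)) (- 1 + y + expR (- y)).
  by apply: is_derive_eq; rewrite /GRing.scale /=; field.
move=> x0; rewrite -subr_ge0; apply: (ge0_of_derive _ _ D) => //.
  by rewrite oppr0 expR0; field.
by move=> y _; have := expR_ge1Dx (- y); lra.
Qed.

(** For [t] small the cubic error is at most [s t^2 / 4], half of the quadratic term, which leaves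
    half of the Gaussian exponent to dominate [la]. *)
Lemma eigen_gaussian (s C t : R) (la : R[i]) : 0 < s -> 0 <= C -> 0 < t <= 1 ->
  s * t ^+ 2 <= 1 -> 4 * C * t <= s ->
  cabs (la - ((1 - s * t ^+ 2 / 2)%:C)%C) <= C * t ^+ 3 ->
  cabs la <= expR (- s * t ^+ 2 / 4) /\
  cabs (la - (expR (- s * t ^+ 2 / 2))%:C%C) <= (C + s ^+ 2) * t ^+ 3.
Proof.
move=> s0 C0 /andP[t0 t1] st Ct h.
have t20 : 0 <= t ^+ 2 by rewrite sqr_ge0.
have st0 : 0 <= s * t ^+ 2 by rewrite mulr_ge0 // ltW.
have Ct3 : C * t ^+ 3 <= s * t ^+ 2 / 4.
  rewrite exprS; have : (4 * C * t) * t ^+ 2 <= s * t ^+ 2 by rewrite ler_wpM2r.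
  by lra.
split.
  have := cabs_triangle la ((1 - s * t ^+ 2 / 2)%:C)%C 0; rewrite !subr0 cabs_real ger0_norm; last lra.
  have := expR_ge1Dx (- s * t ^+ 2 / 4); lra.
apply: le_trans (cabs_triangle _ ((1 - s * t ^+ 2 / 2)%:C)%C _) _.
rewrite mulrDl lerD // -(rmorphB (real_complex R)) cabs_real.
have h1 := expRN_taylor2 (s * t ^+ 2 / 2); have h2 := expR_ge1Dx (- (s * t ^+ 2 / 2)).
rewrite (_ : - s * t ^+ 2 / 2 = - (s * t ^+ 2 / 2)); last by ring.
rewrite ler0_norm; last lra.
have t34 : s ^+ 2 * t ^+ 4 <= s ^+ 2 * t ^+ 3.
  by rewrite ler_wpM2l ?sqr_ge0 // [in leLHS]exprS ler_piMl ?exprn_ge0 ?(ltW t0).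
have h3 := h1 ltac:(lra).
have E : (s * t ^+ 2 / 2) ^+ 2 / 2 = s ^+ 2 * t ^+ 4 / 8 by field.
have : 0 <= s ^+ 2 * t ^+ 4 by rewrite mulr_ge0 ?sqr_ge0 // exprn_ge0 // ltW.
by move: h3; rewrite E; lra.
Qed.


Lemma exists_upper (l : seq R) : exists K : R, 1 <= K /\ forall c, c \in l -> c <= K.
Proof.
elim: l => [|c l [K [K1 HK]]]; first by exists 1.
exists (Num.max c K); split; first by rewrite le_max K1 orbT.
by move=> e; rewrite inE le_max => /predU1P[->|/HK ->]; rewrite ?lexx ?orbT.
Qed.

Lemma small_time (s K C dlt : R) : 0 < s -> 0 <= K -> 0 <= C -> 0 < dlt ->
  exists delta, 0 < delta <= 1 /\ delta < dlt /\ forall t, 0 < t <= delta ->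
    (1 + s) * t ^+ 2 <= 1 /\ 4 * K * t <= 1 /\ 4 * C * t <= s.
Proof.
move=> s0 K0 C0 dlt0; pose z := s + 4 * K + 4 * C / s.
have Cs0 : 0 <= 4 * C / s by rewrite divr_ge0 ?(ltW s0) // mulr_ge0.
have z0 : 0 < 1 + z by rewrite /z; lra.
exists (Num.min (dlt / 2) (1 + z)^-1).
have dz : (1 + z)^-1 <= 1 by rewrite invf_le1 //; rewrite /z; lra.
split; first by rewrite lt_min invr_gt0 z0 divr_gt0 //= ge_min dz orbT.
split; first by rewrite gt_min; apply/orP; left; lra.
move=> t /andP[t0]; rewrite le_min => /andP[_]; rewrite -[leRHS]div1r ler_pdivlMr // => tz.
have st0 : 0 <= s * t by rewrite mulr_ge0 ?ltW.
have Kt0 : 0 <= 4 * K * t by rewrite !mulr_ge0 ?(ltW t0).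
have Ct0 : 0 <= 4 * C / s * t by rewrite mulr_ge0 ?(ltW t0).
have tz' : t + s * t + 4 * K * t + 4 * C / s * t <= 1 by move: tz; rewrite /z; lra.
have t1 : t <= 1 by lra.
split; last split; last 2 first.
- by lra.
- have -> : 4 * C * t = s * (4 * C / s * t) by field; rewrite gt_eqF.
  by rewrite -[leRHS]mulr1 ler_pM2l //; lra.
rewrite expr2 mulrA; apply: le_trans (_ : (1 + s) * t <= 1); last by rewrite mulrDl; lra.
by rewrite ler_piMr // mulr_ge0 ?(ltW t0) //; lra.
Qed.

End EigenvalueExpansion.

(** * Integrable weights and decay of order [n^{-1/2}] *)

Section GaussianWeight.
Context {R : realType}.
Local Notation leb := (@lebesgue_measure R).
Local Notation I01 := (`]0 : R, 1]%classic).

(** Trades an exponential with polynomial prefactor for a Cauchy weight, whose integral in [t] is an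
    arctangent when [v = n t^2]. It rests on [(1 + v)^2 <= 2 + 2 v^2] and [exp u >= 1 + u^2 / 2] for
    [u >= 0]. *)
Lemma exp_decay (k v : R) : 0 < k -> 0 <= v ->
  (1 + v) * expR (- (k * v)) <= (2 + 4 / k ^+ 2) / (1 + v).
Proof.
move=> k0 v0; have v1 : 0 < 1 + v by lra.
have kv0 : 0 <= k * v by rewrite mulr_ge0 // ltW.
rewrite ler_pdivlMr // mulrAC expRN ler_pdivrMr ?expR_gt0 //.
have := expR_ge1Dxn 1 kv0; rewrite (_ : 2`!%:R = 2 :> R) // => h.
have k20 : 0 < k ^+ 2 by rewrite exprn_gt0.
have kv2 : 0 <= (k * v) ^+ 2 / 2 by rewrite divr_ge0 ?sqr_ge0.
have h1 : 2 <= 2 * expR (k * v) by lra.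
have h2 : 2 * v ^+ 2 <= 4 / k ^+ 2 * expR (k * v).
  have -> : 2 * v ^+ 2 = 4 / k ^+ 2 * ((k * v) ^+ 2 / 2) by field; rewrite gt_eqF.
  by rewrite ler_wpM2l ?divr_ge0 // ?ltW //; lra.
rewrite mulrDl; have := sqr_ge0 (v - 1); rewrite !expr2 in h2 *; lra.
Qed.

(** With [h = 1 - th] one has [th (1 + h) = 1 - h^2 <= 1], hence [th^n (1 + n h) <= 1] by
    Bernoulli. *)
Lemma geometric_decay (th : R) n : 0 <= th < 1 -> (0 < n)%N ->
  th ^+ n <= (1 - th)^-1 / Num.sqrt n%:R.
Proof.
move=> /andP[th0 th1] n0; set h := 1 - th; have h0 : 0 < h by rewrite /h; lra.
have nR : 1 <= n%:R :> R by rewrite ler1n.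
have s0 : 0 < Num.sqrt (n%:R : R) by rewrite sqrtr_gt0; lra.
have sn : Num.sqrt (n%:R : R) <= n%:R.
  rewrite -[leRHS]ger0_norm // -sqrtr_sqr ler_wsqrtr // expr2 ler_peMl //.
have key : th ^+ n * (1 + n%:R * h) <= 1.
  have : th ^+ n * (1 + h) ^+ n <= 1.
    rewrite -exprMn exprn_ile1 // /h; first by rewrite mulr_ge0 //; lra.
    by have := sqr_ge0 (1 - th); rewrite !expr2; lra.
  apply: le_trans; rewrite ler_wpM2l ?exprn_ge0 //.
  elim: (n) => [|j IH]; first by rewrite mul0r addr0.
  rewrite exprS; apply: le_trans (_ : (1 + h) * (1 + j%:R * h) <= _); last first.
    by rewrite ler_wpM2l //; lra.
  have : 0 <= j%:R * h * h by rewrite !mulr_ge0 // ltW.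
  by rewrite -natr1 !mulrDl !mulrDr; lra.
rewrite -invfM -[leRHS]div1r ler_pdivlMr ?mulr_gt0 //.
apply: le_trans key; rewrite ler_wpM2l ?exprn_ge0 //.
have : h * Num.sqrt n%:R <= h * n%:R by rewrite ler_pM2l.
by rewrite mulrC; lra.
Qed.

Lemma integral_cauchy (delta : R) (n : nat) : 0 < delta -> (0 < n)%N ->
  let b := fun t : R => delta / (1 + n%:R * (delta * t) ^+ 2) in
  leb.-integrable I01 (EFin \o b) /\ \int[leb]_(t in I01) b t <= 2 / Num.sqrt n%:R.
Proof.
move=> d0 n0 b.
have nR : 1 <= n%:R :> R by rewrite ler1n.
have s0 : 0 < Num.sqrt (n%:R : R) by rewrite sqrtr_gt0; lra.
have ss : Num.sqrt (n%:R : R) ^+ 2 = n%:R by rewrite sqr_sqrtr //; lra.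
have den t : 1 <= 1 + n%:R * (delta * t) ^+ 2 by rewrite lerDl mulr_ge0 ?sqr_ge0.
have D t : is_derive t (1 : R) (fun t => atan (Num.sqrt n%:R * delta * t) / Num.sqrt n%:R) (b t).
  have da (x : R) : is_derive x (1 : R) atan ((1 + x ^+ 2)^-1).
    by apply: DeriveDef; [exact: derivable_atan|rewrite -derive1E derive1_atan].
  have den' : 1 + (Num.sqrt n%:R * delta * t) ^+ 2 != 0.
    by rewrite gt_eqF // ltr_pwDl // sqr_ge0.
  apply: is_derive_eq; rewrite /GRing.scale /= /b -[X in 1 + X * _]ss.
  move: den' s0; set q := Num.sqrt _ => den' s0.
  by field; rewrite mulrA den' gt_eqF.
have cb : continuous b.
  move=> t; apply: cvgM; first exact: cvg_cst.
  apply: cvgV; first by rewrite gt_eqF //; have := den t; lra.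
  apply: cvgD; first exact: cvg_cst.
  apply: cvgM; first exact: cvg_cst.
  by apply: (@continuous_comp _ _ _ (fun t => delta * t) (fun z => z ^+ 2));
    [apply: cvgM; [exact: cvg_cst|exact: cvg_id]|exact: sqr_continuous].
split.
  have lebI : (leb I01 < +oo)%E.
    by rewrite lebesgue_measure_itv /= lte_fin ltr01 -EFinD ltry.
  apply: measurable_bounded_integrable => //.
    by apply: measurable_funTS; exact: continuous_measurable_fun.
  exists delta; split; first exact: num_real.
  move=> M M2 t _ /=; apply: le_trans (ltW M2).
  rewrite ger0_norm ?divr_ge0 ?(ltW d0) //; last by have := den t; lra.
  rewrite ler_pdivrMr; last by have := den t; lra.
  by rewrite ler_peMr // ltW.
rewrite (Rintegral_FTC2 b _ 0 1 ltr01 D cb) mulr0 atan0 mul0r subr0 mulr1.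
rewrite ler_pM2r ?invr_gt0 //; apply: le_trans (ltW (atan_ltpi2 _)) _.
exact: ltW (pihalf_lt2 _).
Qed.

End GaussianWeight.

(** * From an expansion of characteristic functions to the normal approximation *)

Section BerryEsseen.
Context {R : realType} {d : measure_display} {T : measurableType d}.
Context (P : probability T R) (S : nat -> T -> R).
Hypothesis mS : forall n, measurable_fun setT (S n).
Local Notation leb := (@lebesgue_measure R).
Local Notation I01 := (`]0 : R, 1]%classic).

Lemma rphi_scale (X : T -> R) (a t : R) : rphi P (fun w => a * X w) t = rphi P X (a * t).
Proof.
by rewrite /rphi; congr (cint _ _); apply/funext => w; rewrite mulrA [t * a]mulrC.
Qed.

Lemma rcdf_scale (X : T -> R) (a x : R) : 0 < a ->
  rcdf P (fun w => a * X w) (a * x) = rcdf P X x.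
Proof.
move=> a0; rewrite /rcdf; congr (fine (P _)).
by apply/seteqP; split => w /=; rewrite ler_pM2l.
Qed.

(** The difference of [n]-th powers is at most [n F^(n-1) C t^3]. For [n >= 2] the exponent [n - 1]
    is at least [n / 2], so [F^(n-1) <= exp (- s n t^2 / 8)], and [exp_decay] absorbs [n t^2]. One
    factor [t] is kept outside for the division by [t] in Esseen's bound. *)
Lemma charfun_gap (s C th t : R) (la r g phi : R[i]) n : (2 <= n)%N -> 0 < s -> 0 <= C -> 0 < t <= 1 ->
  0 <= th ->
  cabs la <= expR (- s * t ^+ 2 / 4) ->
  cabs (la - (expR (- s * t ^+ 2 / 2))%:C%C) <= C * t ^+ 3 ->
  phi = la ^+ n * r + g -> cabs (r - 1) <= C * t -> cabs g <= C * t * th ^+ n ->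
  cabs (phi - (expR (- s * n%:R * t ^+ 2 / 2))%:C%C) <=
    t * (C * (2 + 4 / (s / 8) ^+ 2) / (1 + n%:R * t ^+ 2) + C * th ^+ n).
Proof.
case: n => [|[|n]] // _ s0 C0 /andP[t0 t1] th0 hla hE -> hr hg.
set m := n.+2; set F := expR _ in hla; set E := expR _ in hE.
have v0 : 0 <= m%:R * t ^+ 2 by rewrite mulr_ge0 ?sqr_ge0.
have st0 : 0 <= s * t ^+ 2 by rewrite mulr_ge0 ?sqr_ge0 // ltW.
have EF : cabs (E%:C%C : R[i]) <= F.
  by rewrite cabs_real ger0_norm ?expR_ge0 // ler_expR; lra.
have FX : F ^+ n.+1 <= expR (- (s / 8 * (m%:R * t ^+ 2))).
  rewrite -expRM_natl ler_expR /m -[n.+2%:R]natr1 -[n.+1%:R]natr1.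
  have : 0 <= n%:R * (s * t ^+ 2) by rewrite mulr_ge0.
  by set k := n%:R; lra.
have F1 : F <= 1 by rewrite -expR0 ler_expR; lra.
have F0 : 0 <= F by exact: expR_ge0.
have EX : (expR (- s * m%:R * t ^+ 2 / 2))%:C%C = (E%:C%C) ^+ m :> R[i].
  by rewrite -rmorphXn -expRM_natl; congr (expR _)%:C%C; ring.
rewrite EX; set w := la ^+ m.
have -> : w * r + g - (E%:C%C) ^+ m = (w - (E%:C%C) ^+ m) + w * (r - 1) + g by ring.
have h1 : cabs (w - (E%:C%C) ^+ m) <= m%:R * F ^+ n.+1 * (C * t ^+ 3).
  apply: le_trans (cabs_subXX _ _ F n.+1 hla EF) _.
  by rewrite ler_wpM2l // mulr_ge0 // exprn_ge0.
have h2 : cabs (w * (r - 1)) <= F ^+ n.+1 * (C * t).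
  rewrite cabsM ler_pM ?cabs_ge0 // cabsX /m [cabs la ^+ _]exprS.
  rewrite -[leRHS]mul1r ler_pM ?exprn_ge0 ?cabs_ge0 //; first exact: le_trans hla F1.
  by rewrite lerXn2r ?nnegrE ?cabs_ge0.
apply: le_trans (cabsD _ _) _; apply: le_trans (lerD (cabsD _ _) (lexx _)) _.
apply: le_trans (_ : C * t * ((1 + m%:R * t ^+ 2) * F ^+ n.+1) + C * t * th ^+ m <= _).
  rewrite lerD //; apply: le_trans (lerD h1 h2) _.
  by rewrite le_eqVlt; apply/orP; left; apply/eqP; ring.
have -> : t * (C * (2 + 4 / (s / 8) ^+ 2) / (1 + m%:R * t ^+ 2) + C * th ^+ m) =
  C * t * ((2 + 4 / (s / 8) ^+ 2) / (1 + m%:R * t ^+ 2)) + C * t * th ^+ m by ring.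
rewrite lerD2r ler_wpM2l ?mulr_ge0 ?(ltW t0) //.
apply: le_trans (exp_decay (s / 8) _ _ v0); last by rewrite divr_gt0.
by rewrite ler_wpM2l // addr_ge0.
Qed.

(** Esseen's bound looks at frequencies in []0, 1]], so it is applied to [delta * S n], which probes
    the characteristic function of [S n] on []0, delta]]. The Gaussian to compare with has standard
    deviation [Tn = delta * sqrt (s n)]; its distribution function has Lipschitz constant of order
    [n^{-1/2}]. *)
Lemma berry_esseen_of_expansion (s C th delta : R) :
  0 < s -> 0 <= C -> 0 < delta <= 1 -> 0 <= th < 1 ->
  (forall t : R, 0 < t <= delta -> exists la : R[i],
     cabs la <= expR (- s * t ^+ 2 / 4) /\
     cabs (la - (expR (- s * t ^+ 2 / 2))%:C%C) <= C * t ^+ 3 /\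
     forall n, exists r g, rphi P (S n) t = la ^+ n * r + g /\
       cabs (r - 1) <= C * t /\ cabs g <= C * t * th ^+ n) ->
  exists c, forall n, (2 <= n)%N -> forall x,
    `| rcdf P (S n) (Num.sqrt s * Num.sqrt n%:R * x) - fine (normal_prob 0 1 `]-oo, x]) |
      <= c / Num.sqrt n%:R.
Proof.
move=> s0 C0 /andP[d0 d1] th01 H; have /andP[th0 th1] := th01.
have M0 := @fejer_mass_gt0 R.
have M1 : 0 < fejer_mass / 12 :> R by rewrite divr_gt0.
have [h0 h00 tl] := fejer_tail _ M1.
have sg0 : 0 < Num.sqrt s by rewrite sqrtr_gt0.
set A := C * (2 + 4 / (s / 8) ^+ 2).
have A0 : 0 <= A by rewrite mulr_ge0 // addr_ge0 // divr_ge0 // sqr_ge0.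
pose B := A * 2 + C * (1 - th)^-1.
pose L := normal_peak 1 / (delta * Num.sqrt s).
exists (4 / 3 * (4 * B / fejer_mass + 4 * L * h0)) => n n2 x.
have n0 : (0 < n)%N by exact: leq_trans n2.
have nR : 1 <= n%:R :> R by rewrite ler1n.
have rn0 : 0 < Num.sqrt (n%:R : R) by rewrite sqrtr_gt0; lra.
set rn := Num.sqrt (n%:R : R) in rn0 *.
have rn2 : rn ^+ 2 = n%:R by rewrite sqr_sqrtr //; lra.
pose Tn := delta * Num.sqrt s * rn.
have T0 : 0 < Tn by rewrite !mulr_gt0.
have [ib bB] := integral_cauchy delta n d0 n0.
set b := fun t : R => delta / (1 + n%:R * (delta * t) ^+ 2) in ib bB.
pose b' (t : R) := A * b t + C * delta * th ^+ n.
have lebI : (leb I01 < +oo)%E.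
  by rewrite lebesgue_measure_itv /= lte_fin ltr01 -EFinD ltry.
have i1 : leb.-integrable I01 (EFin \o (fun t => A * b t)).
  by have := @integrableZl _ _ _ leb I01 (measurable_itv _) A _ ib.
have i2 : leb.-integrable I01 (EFin \o (fun t : R => C * delta * th ^+ n)).
  apply: measurable_bounded_integrable => //.
  exists `|C * delta * th ^+ n|; split; first exact: num_real.
  by move=> M M2 w _ /=; exact: ltW.
have ib' : leb.-integrable I01 (EFin \o b').
  by have := @integrableD _ _ _ leb I01 (measurable_itv _) _ _ i1 i2.
have Ib' : \int[leb]_(t in I01) b' t <= B / rn.
  rewrite /b' RintegralD // RintegralZl // Rintegral_cst //= lebesgue_measure_itv /= lte_fin ltr01 /=.
  rewrite /B mulrDl lerD //; first by rewrite -mulrA ler_wpM2l.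
  rewrite subr0 mulr1 -!mulrA ler_wpM2l //.
  apply: le_trans (geometric_decay th n th01 n0).
  by rewrite ler_piMl // exprn_ge0.
have Hb (t : R) : 0 < t <= 1 ->
  cabs (rphi P (fun w => delta * S n w) t - rphi (normal_prob 0 1 : probability _ R) (fun y => Tn * y) t)
    <= t * b' t.
  move=> /andP[t0 t1]; rewrite rphi_scale rphi_normal.
  have dt : 0 < delta * t <= delta by rewrite mulr_gt0 // ler_piMr // ltW.
  have dt1 : 0 < delta * t <= 1 by case/andP: dt => -> h; exact: le_trans h d1.
  have [la [l1 [l2 /(_ n) [r [g [e1 [e2 e3]]]]]]] := H _ dt.
  have -> : - (t * Tn) ^+ 2 / 2 = - s * n%:R * (delta * t) ^+ 2 / 2.
    rewrite /Tn -rn2 -[in RHS](sqr_sqrtr (ltW s0)); ring.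
  have := charfun_gap s C th _ la r g _ n n2 s0 C0 dt1 th0 l1 l2 e1 e2 e3.
  move=> /le_trans; apply.
  rewrite -/A /b' /b.
  have den : 1 + n%:R * (delta * t) ^+ 2 != 0.
    by rewrite gt_eqF // ltr_pwDl // mulr_ge0 ?sqr_ge0.
  rewrite le_eqVlt; apply/orP; left; apply/eqP; field; exact: den.
rewrite -(normal_rcdfE Tn x T0).
rewrite -(rcdf_scale (S n) delta _ d0) (_ : delta * (Num.sqrt s * rn * x) = Tn * x); last first.
  by rewrite /Tn !mulrA.
have L0 : 0 <= L / rn by rewrite /L !divr_ge0 ?normal_peak_ge0 ?mulr_ge0 // ltW.
have mX1 : measurable_fun setT (fun w => delta * S n w).
  by apply: measurable_funM => //; exact: measurable_cst.
have mX2 : measurable_fun setT (fun y : R => Tn * y) by exact: measurable_funM.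
have lip (y z : R) : y <= z ->
    rcdf (normal_prob 0 1 : probability _ R) (fun y => Tn * y) z -
    rcdf (normal_prob 0 1 : probability _ R) (fun y => Tn * y) y <= L / rn * (z - y).
  move=> yz; apply: le_trans (normal_rcdf_lip Tn y z T0 yz) _.
  by rewrite /L /Tn [(_ * rn)^-1]invfM [normal_peak 1 * (_ / rn)]mulrA.
have := esseen P _ (normal_prob 0 1 : probability _ R) _ b' (B / rn) (L / rn) h0 mX1 mX2
  ib' Hb Ib' L0 lip h00 tl (Tn * x).
move=> /le_trans; apply.
by rewrite le_eqVlt; apply/orP; left; apply/eqP; field; rewrite !gt_eqF.
Qed.

End BerryEsseen.

(** * The Fourier kernels of the chain *)

Section BanachFunctions.
Context {R : realType} {d : measure_display} {E : measurableType d}.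
Local Notation fn := (E -> R[i]).
Implicit Types (S : set fn) (N p : fn -> R).

Lemma banach_seminorm S N : banach_fun S N -> seminorm_on S N.
Proof. by move=> [_ [_ [_ [_ [N0 [_ [ND [NZ _]]]]]]]]. Qed.

Lemma seminorm_sub (S S2 : set fn) p : S `<=` S2 -> seminorm_on S2 p -> seminorm_on S p.
Proof.
move=> SS [p0 [pD pZ]]; split; first by move=> f /SS; exact: p0.
by split; [move=> f g /SS Sf /SS; exact: pD|move=> a f /SS; exact: pZ].
Qed.

Lemma banach_complete S N : banach_fun S N -> forall u : nat -> fn, (forall n, S (u n)) ->
  (forall e : R, 0 < e -> exists M, forall m n, (M <= m)%N -> (M <= n)%N ->
     N (u m \- u n) < e) ->
  exists g, S g /\ forall e : R, 0 < e -> exists M, forall n, (M <= n)%N -> N (u n \- g) < e.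
Proof.
move=> [_ [_ [_ [_ [_ [_ [_ [_ Nc]]]]]]]] u Su /(Nc u Su) [g [Sg ug]].
exists g; split => // e e0.
move: ug => /cvgrPdist_lt /(_ e e0) [M _ HM]; exists M => n /HM /=.
by rewrite sub0r normrN; apply: le_lt_trans; exact: ler_norm.
Qed.

Lemma banachB S N : banach_fun S N -> forall f g, S f -> S g -> S (fun x => f x - g x).
Proof.
move=> [_ [_ [SD [SZ _]]]] f g Sf Sg.
rewrite (_ : (fun x => _) = (fun x => f x + (-1) * g x)); first by apply: SD => //; exact: SZ.
by apply/funext => x; rewrite mulN1r.
Qed.

(** Extends to the whole space the bounds that the hypotheses state on the unit ball; for [N f = 0]
    the function is zero and homogeneity with factor 0 gives [p f = 0]. *)
Lemma homogeneous_bound S N p (c : R) : banach_fun S N ->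
  (forall (a : R) f, 0 <= a -> S f -> p (fun x => a%:C%C * f x) = a * p f) ->
  (forall f, S f -> N f <= 1 -> p f <= c) ->
  forall f, S f -> p f <= c * N f.
Proof.
move=> [_ [_ [_ [SZ [N0 [N_eq0 [_ [NZ _]]]]]]]] pZ pc f Sf.
have [Nf0|Nf0] := eqVneq (N f) 0.
  have f0 := N_eq0 f Sf Nf0; have := pZ 0 f (lexx _) Sf.
  have -> : (fun x => (0 : R)%:C%C * f x) = f by rewrite f0; apply/funext => x; rewrite mulr0.
  by move=> ->; rewrite Nf0 mulr0 mul0r.
have Np : 0 < N f by rewrite lt_def Nf0 N0.
have := pc _ (SZ ((N f)^-1)%:C%C f Sf).
rewrite pZ ?invr_ge0 ?N0 // NZ // cabs_real ger0_norm ?invr_ge0 ?N0 // mulVf // => /(_ (lexx _)).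
by rewrite mulrC ler_pdivrMr.
Qed.

(** The rate [kappa] is only assumed to be less than 1. If it is negative, the inequality at
    exponent 1 forces [c * y = 0], its left side being nonnegative. *)
Lemma geometric_rate (x : nat -> R) (y c kappa ka : R) : 0 <= y -> 0 <= c ->
  (forall n, 0 <= x n) -> (forall n, (1 <= n)%N -> x n <= c * kappa ^+ n * y) ->
  0 <= ka -> kappa <= ka -> forall n, (1 <= n)%N -> x n <= c * ka ^+ n * y.
Proof.
move=> y0 c0 x0 xk ka0 kk n n1; apply: le_trans (xk n n1) _.
have [k0|k0] := lerP 0 kappa.
  by rewrite ler_wpM2r // ler_wpM2l // lerXn2r.
have cy : c * y = 0.
  have := le_trans (x0 1%N) (xk 1%N (leqnn _)); rewrite expr1 mulrAC => h.
  have cy0 : 0 <= c * y by rewrite mulr_ge0.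
  by apply/eqP; rewrite eq_le cy0 andbT -(nmulr_lge0 _ k0).
by rewrite [leLHS]mulrAC [leRHS]mulrAC cy !mul0r.
Qed.

End BanachFunctions.

(** * The operators [Q(t)] satisfy the abstract hypotheses *)

Section PerturbedKernel.
Context {R : realType} {d : measure_display} {E : measurableType d}.
Context (Q : R.-pker E ~> E) (nu : probability E R).
Hypothesis nu_inv : forall A, measurable A -> nu A = (\int[nu]_x Q x A)%E.
Context (xi : E -> R).
Hypothesis xi_meas : measurable_fun setT xi.
Context (S : set (E -> R[i])) (N : (E -> R[i]) -> R).
Context (S2 : set (E -> R[i])) (N2 : (E -> R[i]) -> R).
Hypothesis bS : banach_fun S N.
Hypothesis bS2 : banach_fun S2 N2.
Hypothesis SS2 : S `<=` S2.
Hypothesis gS : geom_ergodic Q nu S N.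
Hypothesis gS2 : geom_ergodic Q nu S2 N2.

Definition L1norm (f : E -> R[i]) : R := Rintegral nu setT (fun x => cabs (f x)).

Lemma space_cmeas f : S f -> cmeas f. Proof. exact: bS.1. Qed.

Lemma space_eL1_lty f : S f -> (eL1 nu f < +oo)%E.
Proof.
move=> Sf; have [_ [[hL1 _] _]] := gS.
have /integrableP[_] := hL1 f Sf; congr (_ < _)%E.
by apply: eq_integral => x _ /=; rewrite ger0_norm // cabs_ge0.
Qed.

Lemma eL1E f : (eL1 nu f < +oo)%E -> eL1 nu f = (L1norm f)%:E.
Proof. by move=> h; rewrite /L1norm /Rintegral fineK // ge0_fin_numE // eL1_ge0. Qed.

Lemma space_cintegrable f : S f -> cintegrable nu f.
Proof. by move=> Sf; apply/(cintegrableP _ _ (space_cmeas f Sf)); exact: space_eL1_lty. Qed.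

Lemma L1norm_ge0 f : 0 <= L1norm f.
Proof. by apply: Rintegral_ge0 => x _; exact: cabs_ge0. Qed.

Lemma space_add f g : S f -> S g -> S (f \+ g).
Proof. by move=> Sf Sg; have [_ [_ [h _]]] := bS; exact: h. Qed.

Lemma space_scale (a : R[i]) f : S f -> S (a \*o f).
Proof. by move=> Sf; have [_ [_ [_ [h _]]]] := bS; exact: h. Qed.

Lemma L1norm_seminorm : seminorm_on S L1norm.
Proof.
split; first by move=> f _; exact: L1norm_ge0.
split => [f g Sf Sg|a f Sf].
  rewrite -lee_fin EFinD -!eL1E ?space_eL1_lty //; last exact: space_add.
  by apply: eL1D; exact: space_cmeas.
apply: EFin_inj; rewrite EFinM -!eL1E ?space_eL1_lty //; last exact: space_scale.
by apply: eL1Z; exact: space_cmeas.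
Qed.

Lemma cint_linear (a : R[i]) f g : S f -> S g ->
  cint nu ((a \*o f) \+ g) = a * cint nu f + cint nu g.
Proof.
move=> Sf Sg; rewrite cintD ?cintZ //; try exact: space_cintegrable.
by apply: space_cintegrable; exact: space_scale.
Qed.

Lemma cabs_cint_le f : S f -> cabs (cint nu f) <= L1norm f.
Proof.
move=> Sf; rewrite -lee_fin -eL1E ?space_eL1_lty //.
by apply: le_cabs_cint; exact: space_cmeas.
Qed.

Lemma Q_integrable f x : S f -> cintegrable (Q x) f.
Proof. by move=> Sf; have [_ [_ [h _]]] := gS; exact: h. Qed.

Lemma Qt_integrable t f x : S f -> cintegrable (Q x) (fun y => expi (t * xi y) * f y).
Proof.
move=> Sf; apply: cintegrable_expiM; [|exact: space_cmeas|exact: Q_integrable].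
exact: measurable_funM.
Qed.

Lemma Qop_linear : lin_on S (Qop Q).
Proof.
have [_ [_ [_ [[h _] _]]]] := gS.
split => // a f g Sf Sg; apply/funext => x; rewrite /Qop /=.
rewrite cintD ?cintZ //; try exact: Q_integrable.
by apply: Q_integrable; exact: space_scale.
Qed.

Lemma Qt_linear t : (forall f, S f -> S (Qt Q xi t f)) -> lin_on S (Qt Q xi t).
Proof.
move=> h; split => // a f g Sf Sg; apply/funext => x; rewrite /Qt /Qop /=.
have -> : (fun y => expi (t * xi y) * (a * f y + g y)) =
    (fun y => a * (expi (t * xi y) * f y) + expi (t * xi y) * g y).
  by apply/funext => y; ring.
have mE f' : S f' -> cmeas (fun y => expi (t * xi y) * f' y).
  by move=> Sf'; apply: cmeasM; [apply: cmeas_expi; exact: measurable_funM|exact: space_cmeas].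
rewrite cintD ?cintZ //; try exact: Qt_integrable.
by apply: cintegrableZ; [exact: mE|exact: Qt_integrable].
Qed.

Lemma eL1_Qt t f : cmeas f -> (eL1 nu (Qt Q xi t f) <= eL1 nu f)%E.
Proof.
move=> mf; apply: le_trans (eL1_Qop Q nu nu_inv _ _) _.
  by apply: cmeasM => //; apply: cmeas_expi; exact: measurable_funM.
rewrite /eL1; under eq_integral do rewrite cabsM cabs_expi mul1r.
exact: lexx.
Qed.

Lemma L1norm_Qt t f : S f -> S (Qt Q xi t f) -> L1norm (Qt Q xi t f) <= L1norm f.
Proof.
by move=> Sf SQ; rewrite -lee_fin -!eL1E ?space_eL1_lty // eL1_Qt //; exact: space_cmeas.
Qed.

Lemma L1norm_Qop f : S f -> L1norm (Qop Q f) <= L1norm f.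
Proof.
move=> Sf; rewrite -lee_fin -!eL1E ?space_eL1_lty //; last exact: Qop_linear.1.
by apply: eL1_Qop => //; exact: space_cmeas.
Qed.

Lemma iter_Qt_le1 t n : cabs (cint nu (iter n (Qt Q xi t) cst1)) <= 1.
Proof.
have c11 : cmeas (cst1 : E -> R[i]) by exact: cmeas_cst.
have mQt f : cmeas f -> cmeas (Qt Q xi t f).
  move=> mf; apply: cmeas_Qop; apply: cmeasM => //.
  by apply: cmeas_expi; exact: measurable_funM.
have mit : cmeas (iter n (Qt Q xi t) cst1) by elim: n => //= n IH; exact: mQt.
rewrite -lee_fin; apply: le_trans (le_cabs_cint _ _ mit) _.
have o1 : eL1 nu cst1 = 1%E.
  rewrite /eL1; under eq_integral do rewrite /cst1 cabs1.
  by rewrite integral_cst // mul1e; exact: probability_setT.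
have : (eL1 nu (iter n (Qt Q xi t) cst1) <= eL1 nu cst1)%E.
  elim: n mit => [|n IH] mit /=; first exact: lexx.
  have mit' : cmeas (iter n (Qt Q xi t) cst1) by elim: (n) => //= k IHk; exact: mQt.
  by apply: le_trans (IH mit'); exact: eL1_Qt.
by rewrite o1.
Qed.

Lemma geom_ker (S' : set (E -> R[i])) (N' : (E -> R[i]) -> R) : banach_fun S' N' ->
  geom_ergodic Q nu S' N' -> exists c kappa, 0 <= c /\ kappa < 1 /\
  forall ka n f, 0 <= ka -> kappa <= ka -> S' f -> cint nu f = 0 ->
    N' (iter n (Qop Q) f) <= (c + 1) * ka ^+ n * N' f.
Proof.
move=> [_ [_ [_ [_ [N0 _]]]]] [_ [_ [_ [[SQ _] [kappa [c [k1 [c0 H]]]]]]]].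
exists c, kappa; split => //; split => // ka n f ka0 kka Sf f0.
have Sit m : S' (iter m (Qop Q) f) by elim: m => //= m; exact: SQ.
case: n => [|n]; first by rewrite /= expr0 mulr1 ler_peMl ?N0 //; lra.
apply: le_trans (geometric_rate (fun n => N' (iter n (Qop Q) f)) (N' f) c kappa ka
   (N0 _ Sf) c0 (fun n => N0 _ (Sit n)) _ ka0 kka n.+1 (ltn0Sn n)) _.
  move=> m m1; have := H m f m1 Sf; rewrite f0.
  by under eq_fun do rewrite subr0.
rewrite ler_wpM2r ?N0 // ler_wpM2r ?exprn_ge0 //; lra.
Qed.

(** Even powers of a negative [kappa] need not be dominated by those of [ka]. For an even exponent
    [n.+1] the inequality is therefore used at the odd exponent [n] on [Qt f]: the strong term is
    then nonpositive, and [Qt] contracts [L1norm]. The constant [c + 1] covers exponent 0. *)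
Lemma Qt_power_bound (kappa c ka t : R) : 0 <= c -> 0 <= ka -> kappa <= ka ->
  (forall f, S f -> S (Qt Q xi t f)) ->
  (forall n f, (1 <= n)%N -> S f ->
     N (iter n (Qt Q xi t) f) <= c * kappa ^+ n * N f + c * L1norm f) ->
  forall n f, S f ->
     N (iter n (Qt Q xi t) f) <= (c + 1) * ka ^+ n * N f + (c + 1) * L1norm f.
Proof.
move=> c0 ka0 kka SQ H n f Sf.
have [_ [_ [_ [_ [N0 _]]]]] := bS.
have w0 g := L1norm_ge0 g.
have step m g : S g -> 0 <= kappa \/ odd m ->
    (1 <= m)%N -> N (iter m (Qt Q xi t) g) <= c * ka ^+ m * N g + c * L1norm g.
  move=> Sg hm m1; apply: le_trans (H m g m1 Sg) _; rewrite lerD2r ler_wpM2r ?N0 // ler_wpM2l //.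
  case: hm => [k0|om]; first by rewrite lerXn2r.
  have [k0|k0] := lerP 0 kappa; first by rewrite lerXn2r.
  apply: (@le_trans _ _ 0); last by rewrite exprn_ge0.
  by rewrite exprn_odd_le0 // ltW.
have weaken m g : S g -> c * ka ^+ m * N g + c * L1norm g <= (c + 1) * ka ^+ m * N g + (c + 1) * L1norm g.
  move=> Sg; have h1 : 0 <= ka ^+ m * N g by rewrite mulr_ge0 ?exprn_ge0 ?N0.
  by have := w0 g; rewrite -!mulrA !mulrDl !mul1r; lra.
case: n => [|n].
  rewrite /= expr0 mulr1; have := N0 f Sf; have := w0 f => h1 h2.
  have : 0 <= c * N f by rewrite mulr_ge0.
  have : 0 <= c * L1norm f by rewrite mulr_ge0.
  by rewrite !mulrDl; lra.
have [h|h] := pselect (0 <= kappa \/ odd n.+1).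
  by apply: le_trans (step _ f Sf h (ltn0Sn _)) _; exact: weaken.
have k0 : kappa < 0 by rewrite ltNge; apply/negP => k0; apply: h; left.
have on : odd n by apply: contrapT => /negP on; apply: h; right.
have n1 : (1 <= n)%N by case: (n) on.
rewrite iterSr; apply: le_trans (H n _ n1 (SQ _ Sf)) _.
have h1 : c * kappa ^+ n * N (Qt Q xi t f) <= 0.
  rewrite mulr_le0_ge0 ?N0 //; last exact: SQ.
  by rewrite mulr_ge0_le0 // exprn_odd_le0 // ltW.
have h2 : c * L1norm (Qt Q xi t f) <= c * L1norm f.
  by rewrite ler_wpM2l // L1norm_Qt //; exact: SQ.
have h3 : 0 <= (c + 1) * ka ^+ n.+1 * N f.
  by rewrite !mulr_ge0 ?exprn_ge0 ?N0 //; lra.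
by have := w0 f; rewrite mulrDl mul1r; lra.
Qed.

(** [Q(t) f - Q f] is [Q] applied to [(expi (t * xi) - 1) f], so invariance of [nu] leads to the
    quantity bounded in (H3). *)
Lemma L1norm_QtB t f : S f -> S (Qt Q xi t f) ->
  ((L1norm (Qt Q xi t f \- Qop Q f))%:E <=
    \int[nu]_x (cabs (expi (t * xi x) - 1) * cabs (f x))%:E)%E.
Proof.
move=> Sf SQ; have mE : cmeas (fun y => (expi (t * xi y) - 1) * f y).
  apply: cmeasM; last exact: space_cmeas.
  by apply: cmeasB; [apply: cmeas_expi; exact: measurable_funM|exact: cmeas_cst].
have SB : S (Qt Q xi t f \- Qop Q f) by apply: (banachB S N bS) => //; exact: Qop_linear.1.
rewrite -eL1E ?space_eL1_lty //.
have -> : Qt Q xi t f \- Qop Q f = Qop Q (fun y => (expi (t * xi y) - 1) * f y).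
  apply/funext => x; rewrite /Qt /Qop /= -cintB //.
  - by congr (cint _ _); apply/funext => y; rewrite mulrBl mul1r.
  - exact: Qt_integrable.
  - exact: Q_integrable.
apply: le_trans (eL1_Qop Q nu nu_inv _ mE) _.
by rewrite /eL1; under eq_integral do rewrite cabsM; exact: lexx.
Qed.

Lemma Qt_expansion : hypHtilde Q nu xi S N S2 N2 ->
  exists K dlt th : R, 0 < dlt /\ 0 < th < 1 /\ 0 <= K /\
  forall t, 0 < t < dlt -> exists (la : R[i]) (h : E -> R[i]),
    S h /\ cint nu h = 1 /\ cabs (la - 1) <= K * t /\
    N2 (fun x => h x - 1) <= K * t /\
    forall n, exists (q : R[i]) (g : E -> R[i]), S g /\ cint nu g = 0 /\
      iter n (Qt Q xi t) cst1 = (fun x => la ^+ n * q * h x + g x) /\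
      cabs (q - 1) <= K * t /\ N2 g <= K * t * th ^+ n.
Proof.
move=> [[_ [_ [_ [_ [_ [[c3 [d3 [d30 H3]]] [a [b [/andP[a0 b0] [Qtb [kappa [c4 [k1 [c40 [H4 _]]]]]]]]]]]]]]]
  [_ [_ [_ [c5 [d5 [d50 H5]]]]]]].
have [S1 [[_ [c1 HL1]] _]] := gS.
have [_ [_ [_ [[SQ2 [c2 HQ2]] _]]]] := gS2.
have [cS [kS [cS0 [kS1 HS]]]] := geom_ker S N bS gS.
have [cT [kT [cT0 [kT1 HT]]]] := geom_ker S2 N2 bS2 gS2.
have Nn := banach_seminorm S N bS.
have N2n' := banach_seminorm S2 N2 bS2.
have N2n := seminorm_sub S S2 N2 SS2 N2n'.
(* A common rate for both spaces and for (H4); the entry 1/2 makes it positive. *)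
pose ka := Num.max (1 / 2) (Num.max kS (Num.max kT kappa)).
have ka01 : 0 < ka < 1 by rewrite !gt_max !lt_max; apply/andP; split; [apply/orP; left; lra|rewrite kS1 kT1 k1 andbT; lra].
have [ka0 ka1] := andP ka01.
have [kSa [kTa kpa]] : kS <= ka /\ kT <= ka /\ kappa <= ka.
  by rewrite !le_max !lexx /= !orbT.
have [K [K1 HK]] := exists_upper [:: c1; c2; cS + 1; cT + 1; c4 + 1; c3; c5].
have [c1K c2K cSK cTK] : [/\ c1 <= K, c2 <= K, cS + 1 <= K & cT + 1 <= K].
  by split; apply: HK; rewrite !inE eqxx ?orbT.
have [c4K c3K c5K] : [/\ c4 + 1 <= K, c3 <= K & c5 <= K].
  by split; apply: HK; rewrite !inE eqxx ?orbT.
have w0 f := L1norm_ge0 f.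
have nu1 : cint nu (fun=> 1) = 1 by rewrite cint_cst //; exact: probability_setT.
have wN f : S f -> L1norm f <= K * N f.
  move=> Sf; apply: le_trans (HL1 f Sf) _.
  by rewrite ler_wpM2r ?(Nn.1 f Sf) //.
have Aw f : S f -> L1norm (Qop Q f) <= K * L1norm f.
  move=> Sf; apply: le_trans (L1norm_Qop f Sf) _.
  by rewrite ler_peMl.
have AN2 f : S f -> N2 (Qop Q f) <= K * N2 f.
  move=> Sf; apply: le_trans (HQ2 f (SS2 _ Sf)) _.
  by rewrite ler_wpM2r ?(N2n.1 f Sf) //.
have AnN n f : S f -> cint nu f = 0 -> N (iter n (Qop Q) f) <= K * ka ^+ n * N f.
  move=> Sf f0; apply: le_trans (HS ka n f (ltW ka0) kSa Sf f0) _.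
  by rewrite ler_wpM2r ?(Nn.1 f Sf) // ler_wpM2r ?exprn_ge0 ?(ltW ka0) //.
have AnN2 n f : S f -> cint nu f = 0 -> N2 (iter n (Qop Q) f) <= K * ka ^+ n * N2 f.
  move=> Sf f0; apply: le_trans (HT ka n f (ltW ka0) kTa (SS2 _ Sf) f0) _.
  by rewrite ler_wpM2r ?(N2n.1 f Sf) // ler_wpM2r ?exprn_ge0 ?(ltW ka0) //.
have Neq0 f : S f -> N f = 0 -> f = (fun=> 0).
  by have [_ [_ [_ [_ [_ [h _]]]]]] := bS; exact: h.
have Anu f : S f -> cint nu (Qop Q f) = cint nu f.
  by move=> Sf; apply: cint_Qop => //; exact: space_cintegrable.
have [K' [dlt [th [dlt0 [th01 [K'0 HB]]]]]] :=
  spectral_perturbation S N L1norm N2 (cint nu) (Qop Q) K ka space_add space_scale S1 Nn L1norm_seminorm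
   N2n Neq0 (banach_complete S N bS) cint_linear nu1 cabs_cint_le wN K1 ka01 Qop_linear
   (Qop1 Q 1) Anu Aw AN2 AnN AnN2.
exists K', (Num.min dlt (Num.min b (Num.min d3 d5))), th.
split; first by rewrite !lt_min dlt0 b0 d30 d50.
split => //; split => // t /andP[t0]; rewrite !lt_min => /and4P[tdlt tb td3 td5].
have tab : a < t < b by rewrite tb andbT (lt_trans a0).
have tn : `|t| = t by rewrite gtr0_norm.
have SQt f : S f -> S (Qt Q xi t f) by have [h _] := Qtb t tab; exact: h.
have hB : perturbed S N L1norm N2 (Qop Q) K ka (Qt Q xi t) t.
  split; first exact: Qt_linear.
  split.
    move=> n f Sf; apply: le_trans (Qt_power_bound kappa c4 ka t c40 (ltW ka0) kpa SQt _ n f Sf) _.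
      by move=> m g m1' Sg; exact: H4.
    apply: lerD; last by rewrite ler_wpM2r.
    by rewrite ler_wpM2r ?(Nn.1 f Sf) // ler_wpM2r ?exprn_ge0 ?(ltW ka0).
  have SB f : S f -> S (Qt Q xi t f \- Qop Q f).
    by move=> Sf; apply: (banachB S N bS); [exact: SQt|exact: Qop_linear.1].
  have lin (e : R[i]) f : S f -> Qt Q xi t (fun x => e * f x) \- Qop Q (fun x => e * f x) =
      e \*o (Qt Q xi t f \- Qop Q f).
    move=> Sf; have S0 : S (fun=> 0) by have [_ [h _]] := bS.
    have e1 : (fun x => e * f x) = (e \*o f) \+ (fun=> 0) by apply/funext => x /=; rewrite addr0.
    have z1 : Qop Q (fun=> 0) = (fun=> 0) by exact: Qop1.
    have z2 : Qt Q xi t (fun=> 0) = (fun=> 0).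
      by rewrite /Qt; under [X in Qop _ X]eq_fun do rewrite mulr0; exact: Qop1.
    rewrite e1 (Qt_linear t SQt).2 // Qop_linear.2 // z1 z2.
    by apply/funext => x /=; rewrite !addr0 mulrBr.
  split.
    move=> f Sf; apply: le_trans (_ : c3 * t * N f <= _); last first.
      by rewrite ler_wpM2r ?(Nn.1 f Sf) // ler_wpM2r ?(ltW t0) //.
    apply: (homogeneous_bound S N (fun f => L1norm (Qt Q xi t f \- Qop Q f)) _ bS) => //.
      move=> e g e0 Sg; rewrite lin // (L1norm_seminorm.2.2 _ _ (SB g Sg)) cabs_real ger0_norm //.
    move=> g Sg Ng; rewrite -lee_fin; apply: le_trans (L1norm_QtB t g Sg (SQt g Sg)) _.
    by have := H3 t _ g Sg Ng; rewrite tn; apply.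
  move=> f Sf; apply: le_trans (_ : c5 * t * N f <= _); last first.
    by rewrite ler_wpM2r ?(Nn.1 f Sf) // ler_wpM2r ?(ltW t0) //.
  apply: (homogeneous_bound S N (fun f => N2 (Qt Q xi t f \- Qop Q f)) _ bS) => //.
    move=> e g e0 Sg; rewrite lin // (N2n.2.2 _ _ (SB g Sg)) cabs_real ger0_norm //.
  by move=> g Sg Ng; have := H5 t _ g Sg Ng; rewrite tn; apply.
have t0d : 0 <= t < dlt by rewrite (ltW t0).
have [la [h [Sh [h1 [h2 [h3 h4]]]]]] := HB (Qt Q xi t) t t0d hB.
by exists la, h; do !split.
Qed.

End PerturbedKernel.

(** * The Poisson equation and the estimate under the stationary law *)

Section PoissonEquation.
Context {R : realType} {d : measure_display} {E : measurableType d}.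
Context (Q : R.-pker E ~> E) (nu : probability E R).
Hypothesis nu_inv : forall A, measurable A -> nu A = (\int[nu]_x Q x A)%E.
Context (xi : E -> R).
Context (S : set (E -> R[i])) (N : (E -> R[i]) -> R).
Hypothesis bS : banach_fun S N.
Hypothesis gS : geom_ergodic Q nu S N.
Hypothesis Sxi : S (fun x => (xi x)%:C%C).

(** The partial sums satisfy [Q (u n) = u (n + 1) - xi]; the identity passes to the limit because
    [Q] is bounded for [N], and it holds everywhere since [N] separates functions. *)
Lemma Qop_xicheck g : is_xicheck Q S N xi g ->
  Qop Q g = (fun x => g x - (xi x)%:C%C).
Proof.
move=> [Sg ug]; pose xc : E -> R[i] := fun y => (xi y)%:C%C.
have QL := Qop_linear Q nu S N bS gS.
have [_ [_ [SD [SZ [N0 [N_eq0 [ND [NZ _]]]]]]]] := bS.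
have Nn := banach_seminorm S N bS.
have [_ [_ [_ [[SQ [c Hc]] _]]]] := gS.
pose u n : E -> R[i] := fun x => \sum_(k < n) iter k (Qop Q) xc x.
have Sit k : S (iter k (Qop Q) xc) by elim: k => //= k; exact: SQ.
have u0 : u 0 = (fun=> 0) by apply/funext => x; rewrite /u big_ord0.
have uS n : u n.+1 = (fun x => u n x + iter n (Qop Q) xc x).
  by apply/funext => x; rewrite /u big_ord_recr.
have Su n : S (u n).
  elim: n => [|n IH]; first by rewrite u0; have [_ [h _]] := bS; exact: h.
  by rewrite uS; exact: SD.
have QD f h : S f -> S h -> Qop Q (fun x => f x + h x) = (fun x => Qop Q f x + Qop Q h x).
  move=> Sf Sh; have := QL.2 1 f h Sf Sh.
  have -> : (1 \*o f) \+ h = (fun x => f x + h x) by apply/funext => x /=; rewrite mul1r.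
  by move=> ->; apply/funext => x /=; rewrite mul1r.
have Qu n : Qop Q (u n) = (fun x => u n.+1 x - xc x).
  elim: n => [|n IH].
    by rewrite uS u0 Qop1; apply/funext => x; rewrite add0r subrr.
  rewrite [in LHS]uS QD // IH [in RHS]uS; apply/funext => x /=; ring.
pose D : E -> R[i] := fun x => Qop Q g x - (g x - xc x).
have SB f h : S f -> S h -> S (fun x => f x - h x) by exact: (banachB S N bS).
have SDf : S D by apply: (SB); [exact: SQ|exact: (SB)].
have ND0 : N D = 0.
  apply/eqP; rewrite eq_le N0 // andbT; apply: (ler_small_mul _ (`|c| + 1)).
    by rewrite addr_ge0.
  have ug' : N (fun x => u n x - g x) @[n --> \oo] --> (0 : R) := ug.
  move=> e e0; move: ug' => /cvgrPdist_lt /(_ e e0) [M _ HM].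
  have hM n : (M <= n)%N -> N (fun x => u n x - g x) <= e.
    move=> /HM /=; rewrite sub0r normrN => h; apply: le_trans (ltW h); exact: ler_norm.
  have NC f h : S f -> S h -> N (fun x => f x - h x) = N (fun x => h x - f x).
    move=> Sf Sh; rewrite -[RHS]mul1r -(cabs1 (R := R)) -cabsN -NZ; last exact: SB.
    by congr N; apply/funext => x; rewrite mulN1r opprB.
  have SQB n : S (fun x => g x - u n x) by exact: SB.
  have DE : D = (fun x => Qop Q (fun y => g y - u M y) x + (u M.+1 x - g x)).
    have e1 : g = (fun y => (g y - u M y) + u M y) by apply/funext => y; rewrite subrK.
    rewrite /D {1}e1 QD // Qu; apply/funext => x; ring.
  rewrite DE; apply: le_trans (ND _ _ _ _) _; [exact: SQ|exact: SB|].
  rewrite mulrDl mul1r lerD //; last exact: hM.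
  apply: le_trans (Hc _ _) _; first exact: SQB.
  apply: le_trans (_ : `|c| * N (fun y => g y - u M y) <= _).
    by rewrite ler_wpM2r ?N0 ?ler_norm.
  by rewrite ler_wpM2l // NC // hM.
have := N_eq0 _ SDf ND0 => DE; apply/funext => x.
have := congr1 (fun f => f x) DE; rewrite /D /= => /eqP; rewrite subr_eq0 => /eqP ->.
by [].
Qed.

(** Each term is finite because the series is. Adding [2^-k] makes [m k] positive and accounts for
    the 2 in the bound of the sums. *)
Lemma summable_powers (I : nat -> \bar R) : (forall p, 0 <= I p)%E ->
  (\sum_(0 <= p <oo) poweR (I p) (2 / 3) < +oo)%E ->
  exists m (B : R), (forall k, 0 < m k) /\
    (forall k, (I k <= (powR (m k) (3 / 2))%:E)%E) /\ (forall n, \sum_(k < n) m k <= B).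
Proof.
move=> I0 hI; set F := fun p => poweR (I p) (2 / 3) in hI.
have F0 p : (0 <= F p)%E by exact: poweR_ge0.
set tot := (\sum_(0 <= p <oo) F p)%E in hI.
have part n : (\sum_(0 <= p < n) F p <= tot)%E by apply: (nneseries_lim_ge (P := xpredT)) => p _ _; exact: F0.
have tot0 : (0 <= tot)%E by exact: nneseries_ge0.
have totf : tot \is a fin_num by rewrite ge0_fin_numE.
have Ff p : F p \is a fin_num.
  rewrite ge0_fin_numE //; apply: le_lt_trans hI; apply: le_trans (part p.+1).
  by rewrite big_nat_recr //= leeDr // sume_ge0.
pose m k := fine (F k) + (1 / 2) ^+ k.
have h0 k : 0 < (1 / 2 : R) ^+ k by rewrite exprn_gt0 // divr_gt0.
exists m, (fine tot + 2); split; first by move=> k; rewrite ltr_wpDl ?fine_ge0.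
split=> [k|n].
  have := Ff k; have := I0 k; rewrite /m /F; case: (I k) => [r|//|//].
    rewrite lee_fin => r0 _; rewrite lee_fin poweR_EFin /=.
    apply: (@le_trans _ _ (powR (powR r (2 / 3)) (3 / 2))).
      by rewrite -powRrM (_ : 2 / 3 * (3 / 2) = 1) ?powRr1 //; field.
    apply: ge0_ler_powR; rewrite ?nnegrE ?powR_ge0 ?addr_ge0 ?powR_ge0 ?(ltW (h0 k)) ?lerDl ?(ltW (h0 k)) //; lra.
  by rewrite poweRyr //; lra.
rewrite big_split /=; apply: lerD.
  rewrite -lee_fin fineK // -sumEFin; apply: le_trans (part n).
  rewrite big_mkord; apply: lee_sum => i _; by rewrite fineK.
have -> : \sum_(i < n) (1 / 2 : R) ^+ i = 2 - 2 * (1 / 2) ^+ n.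
  elim: n => [|n IH]; first by rewrite big_ord0 expr0; lra.
  by rewrite big_ord_recr /= IH exprS; lra.
by have := h0 n; lra.
Qed.

(** [xi] is real while [g] is complex-valued, so the martingale argument runs on the real part of
    the Poisson equation. Both [G] and [w] have third moments, because [g] and [Q g] lie in [S]. *)
Lemma charfun_stationary g : is_xicheck Q S N xi g -> in_L3 nu S ->
  0 < sigma2 Q nu g ->
  (\sum_(0 <= p <oo)
     poweR (\int[nu]_x (powR `|iter p (Qr Q) (psi Q nu g) x| (3 / 2))%:E) (2 / 3) < +oo)%E ->
  exists C : R, 0 <= C /\ forall t n, 0 < t <= 1 -> sigma2 Q nu g * t ^+ 2 / 2 <= 1 ->
    n%:R * t ^+ 2 <= 1 ->
    cabs (cint nu (iter n (Qt Q xi t) cst1) -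
       ((1 - sigma2 Q nu g * t ^+ 2 / 2) ^+ n)%:C%C) <= C * t.
Proof.
move=> hg L3 s0 hsum; have QE := Qop_xicheck g hg.
have Sg : S g := hg.1.
have SQ : S (Qop Q g) by have [_ [_ [_ [[h _] _]]]] := gS; exact: h.
pose G x := complex.Re (g x).
pose w x := Rintegral (Q x) setT G.
have wQ x : w x = complex.Re (Qop Q g x) by [].
have mg : cmeas g by exact: bS.1.
have mw : measurable_fun setT w by exact: measurable_kernel_Rintegral mg.1.
have cube (F : E -> R[i]) (f : E -> R) : S F -> measurable_fun setT f -> (forall x, `|f x| <= cabs (F x)) ->
    exists c, (\int[nu]_x (`|f x| ^+ 3)%:E <= c%:E)%E.
  move=> SF mf fF; have iF := L3 F SF.
  exists (fine (\int[nu]_x (cabs (F x) ^+ 3)%:E)%E).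
  rewrite fineK; last exact: integrable_fin_num iF.
  apply: ge0_le_integral => //.
  - by apply/measurable_EFinP; apply: measurable_funX; exact: measurableT_comp.
  - by apply: measurable_int iF.
  - by move=> x _; rewrite lee_fin lerXn2r ?nnegrE ?cabs_ge0.
have [cG hcG] := cube g G Sg mg.1 (fun x => Re_le_cabs (g x)).
have [cw hcw] := cube (Qop Q g) w SQ mw (fun x => Re_le_cabs (Qop Q g x)).
have iG x : (Q x).-integrable setT (EFin \o G).
  by have [_ [_ [h _]]] := gS; have [] := h g Sg x.
have xiE x : xi x = G x - w x.
  by rewrite wQ QE cReD cReN /= /G; ring.
have psiE x : psi Q nu g x = Rintegral (Q x) setT (fun y => G y ^+ 2) - w x ^+ 2 - sigma2 Q nu g.
  by [].
have I0 p : (0 <= \int[nu]_x (powR `|iter p (Qr Q) (psi Q nu g) x| (3 / 2))%:E)%E.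
  by apply: integral_ge0 => x _; rewrite lee_fin powR_ge0.
have [m [Bm [m0 [hm hBm]]]] := summable_powers _ I0 hsum.
exists `|Cmart cG cw Bm|; split => // t n /andP[t0 t1] st nt.
have tn : `|t| = t by rewrite gtr0_norm.
have t1' : `|t| <= 1 by rewrite tn.
have := martingale_charfun Q nu nu_inv xi G w mg.1 mw cG cw hcG hcw (fun x => erefl) iG xiE
  (psi Q nu g) (sigma2 Q nu g) psiE (ltW s0) m Bm m0 hm hBm t t1' st n nt.
rewrite tn => /le_trans; apply; rewrite ler_wpM2r ?(ltW t0) //; exact: ler_norm.
Qed.

End PoissonEquation.

(** Two laws intervene. The eigenvalue is expanded under [nu], where the martingale estimate is
    available. The decomposition of [Q(t)^n 1] is then integrated against [mu0], whose continuity on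
    the larger space turns the errors measured by [N2] into numerical ones. *)
Theorem theorem2p2 (R : realType) (d : measure_display) (E : measurableType d)
  (Q : R.-pker E ~> E) (nu : probability E R)
  (nu_inv : forall A, measurable A -> nu A = (\int[nu]_x Q x A)%E)
  (xi : E -> R) (xi_meas : measurable_fun setT xi)
  (xi_int : nu.-integrable setT (fun x => (xi x)%:E))
  (xi_center : (\int[nu]_x (xi x)%:E = 0)%E)
  (mu0 : probability E R)
  (dO : measure_display) (Omega : measurableType dO) (P : probability Omega R)
  (X : nat -> Omega -> E) (hX : markov_chain P X Q mu0)
  (S : set (E -> R[i])) (N : (E -> R[i]) -> R)
  (S2 : set (E -> R[i])) (N2 : (E -> R[i]) -> R)
  (hH : hypHtilde Q nu xi S N S2 N2)
  (g : E -> R[i]) (hg : is_xicheck Q S N xi g)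
  (hsigma : 0 < sigma2 Q nu g)
  (hmu0 : cont_form mu0 S N) (hmu0' : cont_form mu0 S2 N2) :
  let sigma := Num.sqrt (sigma2 Q nu g) in
  let Sn n w := \sum_(1 <= k < n.+1) xi (X k w) in
  exists (c : R) (M : nat), forall n : nat, (M <= n)%N -> (0 < n)%N ->
    forall x : R,
      `| fine (P [set w | Sn n w / (sigma * Num.sqrt n%:R) <= x])
         - fine (normal_prob 0 1 `]-oo, x]) | <= c / Num.sqrt n%:R.
Proof.
move=> sigma Sn; set s := sigma2 Q nu g in hsigma sigma *.
have [[bS [L3 [Sxi [gS [H2 _]]]]] [bS2 [SS2 [gS2 _]]]] := hH.
have [K [dlt [th [dlt0 [/andP[th0 th1] [K0 HK]]]]]] :=
  Qt_expansion Q nu nu_inv xi xi_meas S N S2 N2 bS bS2 SS2 gS gS2 hH.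
have [Cm [Cm0 HCm]] := charfun_stationary Q nu nu_inv xi S N bS gS Sxi g hg L3 hsigma (H2 g hg).
have [mu0i [c Hc]] := hmu0'.
have mSn n : measurable_fun setT (Sn n).
  rewrite /Sn; apply: measurable_sum => k.
  by apply: measurableT_comp => //; exact: hX.1.
have s0 : 0 <= s := ltW hsigma.
have K20 : 0 <= 2 * K by exact: mulr_ge0.
pose K1 := Cm + 2 * K; have K10 : 0 <= K1 by exact: addr_ge0.
pose C1 := 8 * K1 * (1 + s).
have C10 : 0 <= C1 by apply: mulr_ge0; [exact: mulr_ge0|exact: addr_ge0].
pose a := `|c|; have a0 : 0 <= a by exact: normr_ge0.
have aK0 : 0 <= a * K by rewrite mulr_ge0.
(* One entry for each error: of [la] against the Gaussian, of [r = q n * mu0 (h)] against 1, and of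
   the remainder integrated by [mu0]. *)
have [C [C1' HC]] := exists_upper [:: C1 + s ^+ 2; K * (1 + a * K) + a * K; a * K].
have C0 : 0 <= C by exact: le_trans ler01 C1'.
have [CC1 CC2 CC3] : [/\ C1 + s ^+ 2 <= C, K * (1 + a * K) + a * K <= C & a * K <= C].
  by split; apply: HC; rewrite !inE eqxx ?orbT.
have [delta [delta01 [dd small]]] := small_time s K1 C1 dlt hsigma K10 C10 dlt0.
have [delta0 delta1] := andP delta01.
have main (t : R) : 0 < t <= delta -> exists la : R[i],
     cabs la <= expR (- s * t ^+ 2 / 4) /\
     cabs (la - (expR (- s * t ^+ 2 / 2))%:C%C) <= C * t ^+ 3 /\
     forall n, exists r h, rphi P (Sn n) t = la ^+ n * r + h /\
       cabs (r - 1) <= C * t /\ cabs h <= C * t * th ^+ n.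
  move=> t0d; have [h1 [h3 h4]] := small t t0d.
  have /andP[t0 td] := t0d.
  have t1 : 0 < t <= 1 by rewrite t0 (le_trans td).
  have tdlt : 0 < t < dlt by rewrite t0 (le_lt_trans td).
  have t01 : t <= 1 by case/andP: t1.
  have stt : s * t ^+ 2 <= 1.
    by apply: le_trans h1; rewrite ler_wpM2r ?sqr_ge0 // lerDr.
  have h2 : s * t ^+ 2 / 2 <= 1.
    by rewrite ler_pdivrMr // mul1r (le_trans stt) // ler1n.
  have [la [h [Sh [h_nu [la1 [hN2 Hn]]]]]] := HK t tdlt.
  (* The scalars are chosen once for all [n], because [eigen_expansion] takes them as a sequence. *)
  pose q n := projT1 (cid (Hn n)).
  have qP n : exists f, S f /\ cint nu f = 0 /\
      iter n (Qt Q xi t) cst1 = (fun x => la ^+ n * q n * h x + f x) /\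
      cabs (q n - 1) <= K * t /\ N2 f <= K * t * th ^+ n by exact: projT2 (cid (Hn n)).
  have Sc := space_cintegrable Q nu S N bS gS.
  have nuE n : cint nu (iter n (Qt Q xi t) cst1) = la ^+ n * q n.
    have [f [Sf [f0 [-> _]]]] := qP n.
    by have := cint_linear Q nu S N bS gS (la ^+ n * q n) h f Sh Sf; rewrite h_nu f0 mulr1 addr0.
  exists la.
  have lar : cabs (la - (1 - s * t ^+ 2 / 2)%:C%C) <= C1 * t ^+ 3.
    apply: (eigen_expansion s K Cm t la q) => //.
    - by move=> n; rewrite -nuE; exact: iter_Qt_le1.
    - by move=> n; have [f [_ [_ [_ []]]]] := qP n.
    - by move=> n nt; rewrite -nuE; exact: HCm.
  have [l1 l2] := eigen_gaussian s C1 t la hsigma C10 t1 stt h4 lar.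
  split => //; split.
    by apply: le_trans l2 _; rewrite ler_wpM2r ?exprn_ge0 ?(ltW t0).
  move=> n; have [f [Sf [_ [fE [q1 fN]]]]] := qP n.
  have [S1 _] := gS2.
  have h01 : cabs (cint mu0 h - 1) <= a * (K * t).
    have -> : cint mu0 h - 1 = cint mu0 (fun x => h x - 1).
      rewrite cintB ?cint_cst //; first exact: probability_setT.
      - exact: mu0i (SS2 _ Sh).
      - exact: mu0i S1.
    apply: le_trans (Hc _ _) _; first exact: (banachB S2 N2 bS2 h cst1 (SS2 _ Sh) S1).
    apply: le_trans (_ : a * N2 (fun x => h x - 1) <= _); last by rewrite ler_wpM2l.
    rewrite ler_wpM2r ?ler_norm //; have [_ [_ [_ [_ [N20 _]]]]] := bS2.
    by apply: N20; exact: (banachB S2 N2 bS2 h cst1 (SS2 _ Sh) S1).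
  exists (q n * cint mu0 h), (cint mu0 f); split.
    rewrite /rphi (chain_charfun Q P X mu0 hX xi t n xi_meas) fE.
    rewrite cintD ?cintZ ?mulrA //; try exact: mu0i (SS2 _ _).
    have [_ [_ [_ [SZ _]]]] := bS2.
    by apply: mu0i; apply: SZ; exact: SS2.
  have Kt0 : 0 <= K * t by rewrite mulr_ge0 // ltW.
  split.
    have -> : q n * cint mu0 h - 1 = (q n - 1) * cint mu0 h + (cint mu0 h - 1) by ring.
    apply: le_trans (cabsD _ _) _; rewrite cabsM.
    have m1 : cabs (cint mu0 h) <= 1 + a * K.
      have := le_trans (lerB_cabs (cint mu0 h) 1) h01; rewrite cabs1 lerBlDl => /le_trans; apply.
      by rewrite lerD2l ler_wpM2l // ler_piMr.
    apply: le_trans (lerD (ler_pM (cabs_ge0 _) (cabs_ge0 _) q1 m1) h01) _.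
    by rewrite mulrAC [a * (K * t)]mulrA -mulrDl ler_wpM2r ?(ltW t0).
  apply: le_trans (Hc _ (SS2 _ Sf)) _.
  apply: le_trans (_ : a * (K * t * th ^+ n) <= _).
    apply: le_trans (_ : a * N2 f <= _); last by rewrite ler_wpM2l.
    rewrite ler_wpM2r ?ler_norm //; have [_ [_ [_ [_ [N20 _]]]]] := bS2.
    by apply: N20; exact: SS2.
  by rewrite !mulrA ler_wpM2r ?exprn_ge0 ?(ltW th0) // ler_wpM2r ?(ltW t0).
have th01 : 0 <= th < 1 by rewrite th1 ltW.
have [c' Hc'] := berry_esseen_of_expansion P Sn mSn s C th delta hsigma C0 delta01 th01 main.
(* The threshold 2 is inherited from [charfun_gap]. *)
exists c', 2%N => n n2 n0 x.
have := Hc' n n2 x; congr (`|_ - _| <= _); rewrite /rcdf; congr (fine (P _)).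
have sn0 : 0 < sigma * Num.sqrt n%:R.
  by rewrite mulr_gt0 ?sqrtr_gt0 // ltr0n.
by apply/seteqP; split => w /=; rewrite ler_pdivrMr // mulrC.
Qed.
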